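(* Let $G$ be an abelian group and $\mathbb{F}$ a field. (1) If $\mathcal{B}$ is a $G$-graded-central-simple algebra over $\mathbb{F}$, then there exist a subgroup $H$ of $G$, an algebra $\mathcal{A}$ graded by $\overline{G}=G/H$ which is central simple as an ungraded algebra, and $\tau\in\mathrm{Z}^2_{\mathrm{sym}}(G,\mathbb{F}^\times)$ such that $\mathcal{B}\simeq_G L^\tau_\pi(\mathcal{A})$, where $\pi:G\to\overline{G}$ is the canonical projection. (2) Conversely, if $H\le G$, $\mathcal{A}$ is a central simple $\overline{G}=G/H$-graded algebra and $\tau\in\mathrm{Z}^2_{\mathrm{sym}}(G,\mathbb{F}^\times)$, then $L^\tau_\pi(\mathcal{A})$ is $G$-graded-central-simple and $C(L^\tau_\pi(\mathcal{A}))\simeq_G\mathbb{F}^{\tau'}H$, where $\tau'=\tau|_{H\times H}$. (3) For $i=1,2$ let $H_i\le G$, $\pi_i:G\to G/H_i$ the canonical projection, $\mathcal{A}_i$ a central simple $G/H_i$-graded algebra, and $\tau_i\in\mathrm{Z}^2_{\mathrm{sym}}(G,\mathbb{F}^\times)$. Then $L^{\tau_1}_{\pi_1}(\mathcal{A}_1)\simeq_G L^{\tau_2}_{\pi_2}(\mathcal{A}_2)$ if and only if $H_1=H_2=:H$ (so $\pi_1=\pi_2=:\pi:G\to\overline{G}=G/H$) and there exists $\mu\in\mathrm{Z}^2_{\mathrm{sym}}(\overline{G},\mathbb{F}^\times)$ such that $[\tau_1]=\pi^*([\mu])[\tau_2]$ in $\mathrm{H}^2_{\mathrm{sym}}(G,\mathbb{F}^\times)$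 and $\mathcal{A}_1^\mu\simeq_{\overline{G}}\mathcal{A}_2$.
   Context: Algebras are arbitrary (nonassociative, possibly infinite-dimensional) algebras over $\mathbb{F}$. A $G$-grading is a decomposition $\mathcal{A}=\bigoplus_g\mathcal{A}_g$ with $\mathcal{A}_g\mathcal{A}_h\subseteq\mathcal{A}_{gh}$; $\simeq_G$ denotes graded isomorphism. Centroid: $C(\mathcal{A})=\{c\in\mathrm{End}_{\mathbb{F}}(\mathcal{A})\mid c(xy)=c(x)y=xc(y)\}$, $C(\mathcal{A})_g=\{c\in C(\mathcal{A}): c\mathcal{A}_{g'}\subseteq\mathcal{A}_{gg'}\ \forall g'\}$. An algebra is central simple if it is simple and its centroid is $\mathbb{F}1$. A $G$-graded algebra is graded-simple if $\mathcal{A}^2=\mathcal{A}$ and there are no proper nonzero graded ideals, graded-central if $C(\mathcal{A})_e=\mathbb{F}1$, graded-central-simple if both; for such algebras $C(\mathcal{A})=\bigoplus_gC(\mathcal{A})_g$ is $G$-graded. Symmetric $2$-cocycles $\mathrm{Z}^2_{\mathrm{sym}}(A,\mathbb{F}^\times)$: maps $\tau:A\times A\to\mathbb{F}^\times$ with $\tau(a_1,a_2)\tau(a_1a_2,a_3)=\tau(a_1,a_2a_3)\tau(a_2,a_3)$ and $\tau(a_1,a_2)=\tau(a_2,a_1)$; coboundaries $\mathrm{d}\gamma(a_1,a_2)=\gamma(a_1)\gamma(a_2)\gamma(a_1a_2)^{-1}$; $\mathrm{H}^2_{\mathrm{sym}}=\mathrm{Z}^2_{\mathrm{sym}}/\mathrm{B}^2$.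 For $\pi:G\to\overline{G}$, $\pi^*:\mathrm{H}^2_{\mathrm{sym}}(\overline{G},\mathbb{F}^\times)\to\mathrm{H}^2_{\mathrm{sym}}(G,\mathbb{F}^\times)$, $[\mu]\mapsto[\mu\circ(\pi\times\pi)]$. The $\tau$-twist $\mathcal{A}^\tau$ of a graded algebra is the same graded space with multiplication $x*y=\tau(g_1,g_2)xy$ for $x\in\mathcal{A}_{g_1},y\in\mathcal{A}_{g_2}$. The twisted group algebra $\mathbb{F}^{\tau'}H$ is the $\tau'$-twist of the group algebra $\mathbb{F}H$ with its natural grading (viewed as $G$-graded with support $H$). For $H\le G$, $\pi:G\to\overline{G}=G/H$, $g\mapsto\bar g$, and a $\overline{G}$-graded algebra $\mathcal{A}$, the loop algebra is the $G$-graded subalgebra $L_\pi(\mathcal{A})=\bigoplus_{g\in G}\mathcal{A}_{\bar g}\otimes g$ of $\mathcal{A}\otimes_{\mathbb{F}}\mathbb{F}G$ (degree of $\mathcal{A}_{\bar g}\otimes g$ is $g$), and $L^\tau_\pi(\mathcal{A}):=(L_\pi(\mathcal{A}))^\tau$ for $\tau\in\mathrm{Z}^2_{\mathrm{sym}}(G,\mathbb{F}^\times)$. *)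

(* Defs.v *)
From HB Require Import structures.
From mathcomp Require Import all_boot all_order all_algebra.
From Stdlib Require Import IndefiniteDescription ClassicalDescription FunctionalExtensionality PropExtensionality.
Set Implicit Arguments. Unset Strict Implicit. Unset Printing Implicit Defensive.
Import GRing.Theory.
Local Open Scope ring_scope.

Definition asbool (P : Prop) : bool :=
  if excluded_middle_informative P then true else false.
Lemma asboolP (P : Prop) : reflect P (asbool P).
Proof. rewrite /asbool; case: excluded_middle_informative => h; by constructor. Qed.

Section ClassicalChoice.
Variable T : Type.
Definition cfind (P : pred T) (n : nat) : option T :=
  match excluded_middle_informative (exists x, P x) with
  | left h => Some (proj1_sig (constructive_indefinite_description _ h))
  | right _ => None end.
Lemma cfind_correct P n x : cfind P n = Some x -> P x.
Proof.
rewrite /cfind; case: excluded_middle_informative => // h [<-].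
by case: constructive_indefinite_description.
Qed.
Lemma cfind_complete (P : pred T) : (exists x, P x) -> exists n, cfind P n.
Proof. by move=> h; exists 0%N; rewrite /cfind; case: excluded_middle_informative. Qed.
Lemma cfind_ext (P Q : pred T) : P =1 Q -> cfind P =1 cfind Q.
Proof. by move=> /functional_extensionality ->. Qed.
End ClassicalChoice.

Section FunSpace.
Variables (R : pzRingType) (T : Type) (V : lmodType R).
Definition funT := T -> V.
Lemma funT_eqP : Equality.axiom (fun f g : funT => asbool (f = g)).
Proof. by move=> f g; apply: (iffP (asboolP _)). Qed.
HB.instance Definition _ := hasDecEq.Build funT funT_eqP.
HB.instance Definition _ := hasChoice.Build funT
  (@cfind_correct funT) (@cfind_complete funT) (@cfind_ext funT).
Definition fzero : funT := fun _ => 0.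
Definition fopp (f : funT) : funT := fun x => - f x.
Definition fadd (f g : funT) : funT := fun x => f x + g x.
Definition fscale (a : R) (f : funT) : funT := fun x => a *: f x.
Lemma faddA : associative fadd.
Proof. by move=> f g h; apply: functional_extensionality => x; rewrite /fadd addrA. Qed.
Lemma faddC : commutative fadd.
Proof. by move=> f g; apply: functional_extensionality => x; rewrite /fadd addrC. Qed.
Lemma fadd0 : left_id fzero fadd.
Proof. by move=> f; apply: functional_extensionality => x; rewrite /fadd add0r. Qed.
Lemma faddN : left_inverse fzero fopp fadd.
Proof. by move=> f; apply: functional_extensionality => x; rewrite /fadd /fopp addNr. Qed.
HB.instance Definition _ := GRing.isZmodule.Build funT faddA faddC fadd0 faddN.
Lemma fscaleA a b (f : funT) : fscale a (fscale b f) = fscale (a * b) f.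
Proof. by apply: functional_extensionality => x; rewrite /fscale scalerA. Qed.
Lemma fscale1 : left_id 1 fscale.
Proof. by move=> f; apply: functional_extensionality => x; rewrite /fscale scale1r. Qed.
Lemma fscaleDr : right_distributive fscale +%R.
Proof. by move=> a f g; apply: functional_extensionality => x; rewrite /fscale /= /fadd scalerDr. Qed.
Lemma fscaleDl (f : funT) : {morph fscale^~ f : a b / a + b}.
Proof. by move=> a b; apply: functional_extensionality => x; rewrite /fscale /= /fadd scalerDl. Qed.
HB.instance Definition _ := GRing.Zmodule_isLmodule.Build R funT fscaleA fscale1 fscaleDr fscaleDl.
End FunSpace.

Section Span.
Variables (F : fieldType) (V : lmodType F) (P : pred V).
Definition inspan (v : V) : Prop :=
  forall Q : pred V, 0 \in Q -> (forall a x y, x \in Q -> y \in Q -> a *: x + y \in Q) ->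
    {subset P <= Q} -> v \in Q.
Definition spanP : pred V := fun v => asbool (inspan v).
Lemma spanP_closed : subsemimod_closed spanP.
Proof.
have h0 : 0 \in spanP by rewrite unfold_in; apply/asboolP => Q.
have hl a x y : x \in spanP -> y \in spanP -> a *: x + y \in spanP.
  rewrite !unfold_in => /asboolP hx /asboolP hy; apply/asboolP => Q Q0 QL QP.
  by apply: (QL); [exact: (hx Q Q0 QL QP) | exact: (hy Q Q0 QL QP)].
split; [split=> // x y hx hy|].
  by rewrite -(scale1r x); apply: hl.
by move=> a x hx; rewrite -(addr0 (a *: x)); apply: hl.
Qed.
HB.instance Definition _ := GRing.isSubmodClosed.Build F V spanP spanP_closed.
Record spanT := SpanT { sp_val : V; sp_valP : sp_val \in spanP }.
HB.instance Definition _ := [isSub for sp_val].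
HB.instance Definition _ := [Choice of spanT by <:].
HB.instance Definition _ := [SubChoice_isSubLmodule of spanT by <:].
End Span.


Record subgrp (G : zmodType) := SubGrp {
  sg_pred : pred G;
  sg0 : 0 \in sg_pred;
  sgB : forall x y, x \in sg_pred -> y \in sg_pred -> x - y \in sg_pred }.

(* the quotient group G/H, elements are chosen coset representatives *)
Section Quotient.
Variables (G : zmodType) (H : subgrp G).
Local Notation Hp := (sg_pred H).
Lemma sgN x : x \in Hp -> - x \in Hp.
Proof. by move=> hx; rewrite -sub0r; apply: sgB => //; apply: sg0. Qed.
Lemma sgD x y : x \in Hp -> y \in Hp -> x + y \in Hp.
Proof. by move=> hx hy; rewrite -(opprK y); apply: sgB => //; apply: sgN. Qed.
Lemma qrep_ex x : exists y, x - y \in Hp.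
Proof. by exists x; rewrite subrr sg0. Qed.
Definition qrep (x : G) : G := xchoose (qrep_ex x).
Lemma qrepP x : x - qrep x \in Hp.
Proof. exact: (xchooseP (qrep_ex x)). Qed.
Lemma qrep_eq x y : x - y \in Hp -> qrep x = qrep y.
Proof.
move=> hxy; apply: eq_xchoose => z; apply/idP/idP => h.
  have -> : y - z = (x - z) - (x - y) by rewrite [RHS]addrC opprB addrA subrK.
  exact: sgB.
have -> : x - z = (x - y) + (y - z) by rewrite addrA subrK.
exact: sgD.
Qed.
Lemma qrepK x : qrep (qrep x) = qrep x.
Proof. by apply: qrep_eq; rewrite -opprB; apply: sgN; apply: qrepP. Qed.
Record quot := Quot { q_val : G; q_valP : qrep q_val == q_val }.
HB.instance Definition _ := [isSub for q_val].
HB.instance Definition _ := [Choice of quot by <:].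
Definition qproj (x : G) : quot := @Quot (qrep x) (introT eqP (qrepK x)).
Lemma qproj_val (a : quot) : qproj (q_val a) = a.
Proof. by case: a => v hv; apply: val_inj => /=; apply/eqP. Qed.
Lemma qproj_eq x y : x - y \in Hp -> qproj x = qproj y.
Proof. by move=> h; apply: val_inj => /=; apply: qrep_eq. Qed.
Lemma qprojDl x y : qproj (qrep x + y) = qproj (x + y).
Proof.
apply: qproj_eq; rewrite opprD addrACA subrr addr0 -opprB.
by apply: sgN; apply: qrepP.
Qed.
Definition qzero : quot := qproj 0.
Definition qopp (a : quot) : quot := qproj (- q_val a).
Definition qadd (a b : quot) : quot := qproj (q_val a + q_val b).
Lemma qaddA : associative qadd.
Proof.
move=> a b c; rewrite /qadd /= qprojDl [q_val a + _]addrC qprojDl.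
by rewrite addrC addrA.
Qed.
Lemma qaddC : commutative qadd.
Proof. by move=> a b; rewrite /qadd addrC. Qed.
Lemma qadd0 : left_id qzero qadd.
Proof. by move=> a; rewrite /qadd /= qprojDl add0r qproj_val. Qed.
Lemma qaddN : left_inverse qzero qopp qadd.
Proof. by move=> a; rewrite /qadd /= qprojDl addNr. Qed.
HB.instance Definition _ := GRing.isZmodule.Build quot qaddA qaddC qadd0 qaddN.
End Quotient.

(* Graded (nonassociative, possibly infinite-dimensional) algebras.         *)
(* A G-graded algebra is given by its underlying F-vector space, its        *)
(* product, and the family (A_g)_g of homogeneous components; the algebra   *)
(* axioms (bilinearity, A = (+)_g A_g, A_g A_h <= A_{g+h}) are is_galg.     *)
(* Groups are abelian and written additively (e = 0, gh = g + h).          *)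
Record galg (F : fieldType) (G : Type) := GAlg {
  gcar : lmodType F;
  gmul : gcar -> gcar -> gcar;
  gcomp : G -> pred gcar }.
Arguments gcar {F G} g : rename.
Arguments gmul {F G} g _ _ : rename.
Arguments gcomp {F G} g _ : rename.

Section GradedNotions.
Local Unset Implicit Arguments.
Context {F : fieldType} {G : zmodType}.

Definition subspace {V : lmodType F} (P : pred V) : Prop :=
  0 \in P /\ forall a x y, x \in P -> y \in P -> a *: x + y \in P.

Definition bilinear_mul (A : galg F G) : Prop :=
  (forall a x y z, gmul A (a *: x + y) z = a *: gmul A x z + gmul A y z) /\
  (forall a x y z, gmul A z (a *: x + y) = a *: gmul A z x + gmul A z y).

Definition is_grading (A : galg F G) : Prop :=
  (forall g, subspace (gcomp A g)) /\
  (forall x : gcar A, exists (s : seq G) (f : G -> gcar A),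
      (forall g, f g \in gcomp A g) /\ x = \sum_(g <- s) f g) /\
  (forall (s : seq G) (f : G -> gcar A), uniq s -> (forall g, f g \in gcomp A g) ->
      \sum_(g <- s) f g = 0 -> forall g, g \in s -> f g = 0) /\
  (forall g h x y, x \in gcomp A g -> y \in gcomp A h -> gmul A x y \in gcomp A (g + h)).

Definition is_galg (A : galg F G) : Prop := bilinear_mul A /\ is_grading A.

Definition is_ideal (A : galg F G) (I : pred (gcar A)) : Prop :=
  subspace I /\ forall x y, x \in I -> gmul A x y \in I /\ gmul A y x \in I.
Definition is_graded_subspace (A : galg F G) (I : pred (gcar A)) : Prop :=
  forall x, x \in I -> exists (s : seq G) (f : G -> gcar A),
    (forall g, f g \in gcomp A g /\ f g \in I) /\ x = \sum_(g <- s) f g.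

Definition sq_full (A : galg F G) : Prop :=
  forall x : gcar A, exists s : seq (F * gcar A * gcar A),
    x = \sum_(p <- s) p.1.1 *: gmul A p.1.2 p.2.
Definition nonzero (A : galg F G) : Prop := exists x : gcar A, x != 0.

Definition simple (A : galg F G) : Prop :=
  nonzero A /\ sq_full A /\
  forall I : pred (gcar A), is_ideal A I -> (forall x, x \in I -> x = 0) \/ (forall x, x \in I).
Definition graded_simple (A : galg F G) : Prop :=
  nonzero A /\ sq_full A /\
  forall I : pred (gcar A), is_ideal A I -> is_graded_subspace A I ->
    (forall x, x \in I -> x = 0) \/ (forall x, x \in I).

Definition is_centroid (A : galg F G) (c : gcar A -> gcar A) : Prop :=
  (forall a x y, c (a *: x + y) = a *: c x + c y) /\
  (forall x y, c (gmul A x y) = gmul A (c x) y /\ c (gmul A x y) = gmul A x (c y)).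
Definition centroid_deg (A : galg F G) (g : G) (c : gcar A -> gcar A) : Prop :=
  forall g' x, x \in gcomp A g' -> c x \in gcomp A (g + g').

Definition central (A : galg F G) : Prop :=
  forall c : gcar A -> gcar A, is_centroid A c -> exists a : F, forall x, c x = a *: x.
Definition graded_central (A : galg F G) : Prop :=
  forall c : gcar A -> gcar A, is_centroid A c -> centroid_deg A 0 c -> exists a : F, forall x, c x = a *: x.

Definition central_simple (A : galg F G) : Prop := simple A /\ central A.
Definition graded_central_simple (A : galg F G) : Prop :=
  graded_simple A /\ graded_central A.

Definition giso (A B : galg F G) : Prop :=
  exists phi : gcar A -> gcar B,
    (forall a x y, phi (a *: x + y) = a *: phi x + phi y) /\ bijective phi /\
    (forall x y, phi (gmul A x y) = gmul B (phi x) (phi y)) /\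
    (forall g x, x \in gcomp A g -> phi x \in gcomp B g) /\
    (forall g y, y \in gcomp B g -> exists2 x, x \in gcomp A g & phi x = y).

Definition sym2cocycle (t : G -> G -> F) : Prop :=
  (forall a b, t a b != 0) /\
  (forall a b c, t a b * t (a + b) c = t a (b + c) * t b c) /\
  (forall a b, t a b = t b a).
Definition cohomologous (t1 t2 : G -> G -> F) : Prop :=
  exists gam : G -> F, (forall a, gam a != 0) /\
    forall a b, t1 a b = t2 a b * (gam a * gam b / gam (a + b)).

(* the tau-twist A^tau: x * y = tau(g1,g2) xy on homogeneous elements, *)
(* extended bilinearly via (a chosen) homogeneous decomposition         *)
Definition gdec {A : galg F G} (x : gcar A) : seq G * (G -> gcar A) :=
  match excluded_middle_informative
    (exists p : seq G * (G -> gcar A), uniq p.1 /\ (forall g, p.2 g \in gcomp A g) /\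
        x = \sum_(g <- p.1) p.2 g) with
  | left h => proj1_sig (constructive_indefinite_description _ h)
  | right _ => ([::], fun _ => 0) end.
Definition twist (A : galg F G) (t : G -> G -> F) : galg F G :=
  @GAlg F G (gcar A)
    (fun x y => \sum_(g <- (gdec x).1) \sum_(h <- (gdec y).1)
                  t g h *: gmul A ((gdec x).2 g) ((gdec y).2 h))
    (gcomp A).

(* finitely supported functions G -> V model V (x) FG *)
Definition fsupp {V : lmodType F} (f : G -> V) : seq G :=
  match excluded_middle_informative (exists s : seq G, forall g, f g != 0 -> g \in s) with
  | left h => undup (proj1_sig (constructive_indefinite_description _ h))
  | right _ => [::] end.
Definition fdelta {V : lmodType F} (g : G) (v : V) : funT G V :=
  fun k => if k == g then v else 0.
Definition conv {V : lmodType F} (m : V -> V -> V) (f f' : funT G V) : funT G V :=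
  fun k => \sum_(g <- fsupp f) \sum_(h <- fsupp f')
             (if g + h == k then m (f g) (f' h) else 0).

(* loop algebra L_pi(A) = (+)_g A_{pi g} (x) g  inside  A (x) FG *)
Section Loop.
Context {Gb : zmodType}.
Variables (pi : G -> Gb) (A : galg F Gb).
Definition loop_gen : pred (funT G (gcar A)) :=
  fun f => asbool (exists g v, v \in gcomp A (pi g) /\ f = fdelta g v).
Definition loop_car : lmodType F := spanT loop_gen.
Definition loop_mul (x y : loop_car) : loop_car :=
  insubd 0 (conv (gmul A) (sp_val x) (sp_val y)).
Definition loop_comp (g : G) : pred loop_car :=
  fun x => asbool ((forall k, k != g -> sp_val x k = 0) /\ sp_val x g \in gcomp A (pi g)).
Definition loop : galg F G := @GAlg F G loop_car loop_mul loop_comp.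
End Loop.
Definition tloop {Gb : zmodType} (pi : G -> Gb) (A : galg F Gb) (t : G -> G -> F) :=
  twist (loop pi A) t.

Section GroupAlg.
Variable H : subgrp G.
Definition grp_gen : pred (funT G F^o) :=
  fun f => asbool (exists g (a : F^o), g \in sg_pred H /\ f = fdelta g a).
Definition grp_car : lmodType F := spanT grp_gen.
Definition grp_mul (x y : grp_car) : grp_car :=
  insubd 0 (conv *%R (sp_val x) (sp_val y)).
Definition grp_comp (g : G) : pred grp_car :=
  fun x => asbool ((forall k, k != g -> sp_val x k = 0) /\
                   (g \in sg_pred H \/ sp_val x g = 0)).
Definition grpalg : galg F G := @GAlg F G grp_car grp_mul grp_comp.
End GroupAlg.
(* restriction tau' = tau|_{H x H} (extended by 1, values outside H x H are never used) *)
Definition restr (H : subgrp G) (t : G -> G -> F) : G -> G -> F :=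
  fun a b => if (a \in sg_pred H) && (b \in sg_pred H) then t a b else 1.
Definition tgrpalg (H : subgrp G) (t' : G -> G -> F) : galg F G := twist (grpalg H) t'.

Section CentroidAlg.
Variable A : galg F G.
Definition cent_gen : pred (funT (gcar A) (gcar A)) := fun c => asbool (is_centroid A c).
Definition cent_car : lmodType F := spanT cent_gen.
Definition cent_mul (c d : cent_car) : cent_car :=
  insubd 0 ((sp_val c \o sp_val d) : funT (gcar A) (gcar A)).
Definition cent_comp (g : G) : pred cent_car :=
  fun c => asbool (centroid_deg A g (sp_val c)).
Definition centroid_alg : galg F G := @GAlg F G cent_car cent_mul cent_comp.
End CentroidAlg.

End GradedNotions.

(* Main.v *)
Require Import Defs.
From HB Require Import structures.
From mathcomp Require Import all_boot all_order all_algebra.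
From mathcomp Require Import ring.
From mathcomp Require classical_sets.
From Stdlib Require Import IndefiniteDescription ClassicalDescription FunctionalExtensionality.
Import GRing.Theory.
Local Open Scope ring_scope.
Set Implicit Arguments. Unset Strict Implicit. Unset Printing Implicit Defensive.

(* Let [B] be graded-central-simple. The nonzero homogeneous elements of its centroid are
   invertible and [C(B)_0 = F], so the components of [C(B)] have dimension at most one and [C(B)]
   is a twisted group algebra of its support [H], for a symmetric 2-cocycle on [H]. That cocycle
   extends to [G] because Ext^2 vanishes for abelian groups. Twisting [B] by the inverse of the
   extension turns [C(B)] into the group algebra [FH]; identifying through [FH] the components of
   [B] whose degrees agree modulo [H] yields a [G/H]-graded algebra [A] with loop algebra the twist
   of [B]. A homogeneous element of [C(A)] lifts to [C(L(A))], hence [A] is central, and a central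
   graded-simple algebra is simple: an element of minimal support in an ideal [I] spreads to a
   centroid element, and the latter is scalar, which puts every homogeneous element in [I].

   Conversely, a centroid element of [L(A)] commutes with the shifts [v (x) g |-> v (x) (h + g)],
   [h] in [H], so it descends along [v (x) g |-> v] to [C(A) = F] and is a multiple of a shift.
   Likewise an isomorphism [L^t1(A1) ~ L^t2(A2)] carries shifts to multiples of shifts. The
   multipliers trivialize [t1 / t2] on [H], which makes it cohomologous to a cocycle [mu] inflated
   from [G/H]; after rescaling, the isomorphism commutes with the shifts and descends to
   [A1^mu ~ A2]. *)

Section FiniteSums.
Variables (I : eqType) (V : zmodType).
Implicit Types (s : seq I) (f : I -> V).

Lemma big_uniq_support s s' f : uniq s -> uniq s' ->
  (forall i, f i != 0 -> i \in s) -> (forall i, f i != 0 -> i \in s') ->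
  \sum_(i <- s) f i = \sum_(i <- s') f i.
Proof.
move=> us us' fs fs'; rewrite (bigID (fun i => f i != 0)) [RHS](bigID (fun i => f i != 0)) /=.
rewrite [X in _ + X]big1 ?[X in _ = _ + X]big1 => [|i /negbNE/eqP //|i /negbNE/eqP //].
rewrite !addr0 -big_filter -[RHS]big_filter; apply/perm_big/uniq_perm; rewrite ?filter_uniq //.
by move=> i; rewrite !mem_filter; case: eqP => //= /eqP fi; rewrite fs ?fs'.
Qed.

Lemma big_pred1_uniq s i f : uniq s -> (f i != 0 -> i \in s) ->
  \sum_(j <- s) (if j == i then f j else 0) = f i.
Proof.
move=> us fi; rewrite (@big_uniq_support s [:: i]) // ?big_seq1 ?eqxx // => j.
  by case: (j =P i) => [->|_]; rewrite ?eqxx.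
by rewrite inE; case: (j =P i) => //; rewrite eqxx.
Qed.
End FiniteSums.

Definition linear_pack (F : fieldType) (U V : lmodType F) (f : U -> V) (fL : linear f) :
  {linear U -> V} := HB.pack f (GRing.isLinear.Build F U V *:%R f fL).

Section LincombClosed.
Variables (F : fieldType) (V : lmodType F) (Q : V -> Prop).

Definition lincomb_closed := forall a x y, Q x -> Q y -> Q (a *: x + y).
Hypothesis linQ : lincomb_closed.

Lemma lincomb_closed0 x : Q x -> Q 0.
Proof. by move=> Qx; have := linQ (-1) Qx Qx; rewrite scaleN1r addNr. Qed.

Lemma lincomb_closedD x y : Q x -> Q y -> Q (x + y).
Proof. by rewrite -{2}[x]scale1r; apply: linQ. Qed.

Lemma lincomb_closedZ a x : Q x -> Q (a *: x).
Proof. by move=> Qx; rewrite -[_ *: _]addr0; apply: linQ (lincomb_closed0 Qx). Qed.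
End LincombClosed.

Section QuotientMap.
Variables (G : zmodType) (H : subgrp G).

Lemma qproj_is_zmod_morphism : zmod_morphism (qproj H).
Proof.
have piD : {morph qproj H : x y / x + y}.
  move=> x y; rewrite -[RHS]/(qproj H (qrep H x + qrep H y)) qprojDl [x + qrep H y]addrC qprojDl.
  by rewrite addrC.
by move=> x y; apply: (addIr (qproj H y)); rewrite -piD !subrK.
Qed.
HB.instance Definition _ :=
  GRing.isZmodMorphism.Build G (quot H) (qproj H) qproj_is_zmod_morphism.

Lemma qproj_eq0 x : (qproj H x == 0) = (x \in sg_pred H).
Proof.
rewrite -[0](raddf0 (qproj H)); apply/eqP/idP => [[e]|xH]; last first.
  by apply: qproj_eq; rewrite subr0.
have -> : x = x - qrep H x - (0 - qrep H 0) by rewrite e opprB subr0 subrK.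
by apply: sgB; apply: qrepP.
Qed.

Lemma qproj_eqE x y : (qproj H x == qproj H y) = (x - y \in sg_pred H).
Proof. by rewrite -qproj_eq0 raddfB subr_eq0. Qed.
End QuotientMap.

(** * Divisible groups and symmetric 2-cocycles *)

Lemma int_subgroup_principal (S : int -> Prop) :
  S 0 -> (forall m n, S m -> S n -> S (m - n)) ->
  exists N : nat, forall n : int, S n <-> (N %| n)%Z.
Proof.
move=> S0 SB; have SN n : S n -> S (- n) by rewrite -sub0r; apply: SB.
have SMn n k : S n -> S (n *+ k).
  by move=> Sn; elim: k => // k IH; rewrite mulrSr -[X in _ + X]opprK; apply/SB/SN.
have SM n k : S n -> S (k * n).
  rewrite mulrC -mulrzz => /SMn Sn; case: k => k; rewrite ?NegzE ?mulrNz -pmulrn //.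
  exact: SN.
have [[m [Sm m0]]|none] := asboolP (exists n : int, S n /\ n != 0); last first.
  exists 0%N => n; rewrite dvd0z; split=> [Sn|/eqP -> //].
  by apply: contraT => n0; case: none; exists n.
have exN : exists N, asbool (S (Posz N)) && (0 < N)%N.
  exists `|m|%N; rewrite absz_gt0 m0 andbT; apply/asboolP.
  by case: m Sm {m0} => // k; rewrite NegzE abszN absz_nat => /SN; rewrite opprK.
case: (ex_minnP exN) => N /andP [/asboolP SNN N0] Nmin; exists N => n.
split=> [Sn|/dvdzP [k ->]]; last exact: SM.
have Nz : (N : int) != 0 by rewrite -lt0n.
apply/dvdz_mod0P; have Sr : S (n %% N)%Z by apply/SB/SM.
have := modz_ge0 n Nz; have := ltz_mod n Nz; case: (n %% N)%Z Sr => // r Sr rN _.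
apply/eqP; rewrite eqz_nat; apply: contraLR rN; rewrite -lt0n => r0.
by rewrite ltz_nat -leqNgt; apply: Nmin; rewrite r0 andbT; apply/asboolP.
Qed.

Definition divisible (D : zmodType) := forall (d : D) n, (0 < n)%N -> exists e, e *+ n = d.

Section DivisibleInjective.
Variables G D : zmodType.
Implicit Types R : G -> D -> Prop.

Definition partial_hom R := [/\ R 0 0,
  forall x y x' y', R x y -> R x' y' -> R (x - x') (y - y') & forall d, R 0 d -> d = 0].

Lemma partial_hom_ext R R' : (forall x y, R x y <-> R' x y) -> partial_hom R -> partial_hom R'.
Proof.
move=> RR' [R0 RB Rfun]; split=> [|x y x' y' /RR' Rx /RR' Rx'|d /RR' /Rfun //]; apply/RR' => //.
exact: RB.
Qed.

Section PartialHom.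
Variable R : G -> D -> Prop.
Hypothesis homR : partial_hom R.

Lemma partial_hom_inj x y y' : R x y -> R x y' -> y = y'.
Proof.
case: homR => _ RB R0 Rxy Rxy'; apply/subr0_eq/R0.
by have := RB _ _ _ _ Rxy Rxy'; rewrite subrr.
Qed.

Lemma partial_homMz x y n : R x y -> R (x *~ n) (y *~ n).
Proof.
case: homR => R0 RB _ Rxy.
have RN u v : R u v -> R (- u) (- v) by rewrite -(sub0r u) -(sub0r v); apply: RB.
have RMn k : R (x *+ k) (y *+ k).
  elim: k => // k IH; rewrite !mulrSr -[X in _ + X]opprK -[X in R _ (_ + X)]opprK.
  by apply: RB => //; apply: RN.
by case: n => k; rewrite ?NegzE ?mulrNz -!pmulrn //; apply: RN.
Qed.

Lemma partial_hom_adjoin g : divisible D -> exists R',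
  [/\ partial_hom R', forall x y, R x y -> R' x y & exists d, R' g d].
Proof.
move=> divD; have [R0 RB Rfun] := homR.
have [||N domN] := @int_subgroup_principal (fun n => exists y, R (g *~ n) y).
- by exists 0.
- by move=> m n [y Ry] [z Rz]; exists (y - z); rewrite mulrzBr; apply: RB.
have /domN [y0 Ry0] : (N %| Posz N)%Z by [].
have [d dN] : exists d, d *~ N = y0.
  case: N Ry0 {domN} => [/Rfun ->|N _]; first by exists 0.
  by have [d] := divD y0 N.+1 isT; exists d.
exists (fun x y => exists n, R (x - g *~ n) (y - d *~ n)); split.
- split=> [|x y x' y' [m Rm] [n Rn]|z [n]]; first by exists 0; rewrite !subr0.
    exists (m - n); rewrite !mulrzBr; have := RB _ _ _ _ Rm Rn.
    by rewrite !opprD addrACA [in X in R _ X -> _]addrACA.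
  rewrite !sub0r => /(RB _ _ _ _ R0); rewrite !sub0r !opprK => Rn.
  have /dvdzP [q nE] : (N %| n)%Z by apply/domN; exists (- (z - d *~ n)).
  have := partial_homMz q Ry0; rewrite -mulrzA mulrC -nE => /(partial_hom_inj Rn).
  rewrite -dN -mulrzA mulrC -nE opprB => /eqP.
  by rewrite -subr_eq0 addrAC subrr sub0r oppr_eq0 => /eqP.
- by move=> x y Rxy; exists 0; rewrite !subr0.
- by exists d, 1; rewrite !subrr.
Qed.
End PartialHom.

Lemma partial_hom_chain (R0 : G -> D -> Prop) (C : (G * D -> Prop) -> Prop) :
  (forall S, C S -> partial_hom (fun x y => R0 x y \/ S (x, y))) ->
  (forall S S', C S -> C S' -> (forall p, S p -> S' p) \/ (forall p, S' p -> S p)) ->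
  partial_hom R0 -> partial_hom (fun x y => R0 x y \/ exists2 S, C S & S (x, y)).
Proof.
move=> homC totC hom0; split; first by left; case: hom0.
  have CB S x y x' y' : C S -> R0 x y \/ S (x, y) -> R0 x' y' \/ S (x', y') ->
      R0 (x - x') (y - y') \/ exists2 S, C S & S (x - x', y - y').
    by move=> CS; have [_ SB _] := homC S CS; move=> /SB h /h [?|?]; [left|right; exists S].
  move=> x y x' y' [R0x|[S CS Sx]] [R0x'|[S' CS' Sx']].
  - by left; case: hom0 => _ RB _; apply: RB.
  - by apply: (CB S'); [|left|right].
  - by apply: (CB S); [|right|left].
  by have [SS'|S'S] := totC _ _ CS CS'; [apply: (CB S')|apply: (CB S)]; auto.
by move=> d [|[S /homC [_ _ Sfun] Sd]]; [case: hom0 => _ _; apply|apply: Sfun; right].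
Qed.

(* Baer's criterion for [Z]: a maximal additive partial function is total. *)
Lemma divisible_injective (K : subgrp G) (f : G -> D) : divisible D ->
  {in sg_pred K &, {morph f : x y / x - y}} ->
  exists h : {additive G -> D}, {in sg_pred K, h =1 f}.
Proof.
move=> divD fB; pose R0 x y := x \in sg_pred K /\ y = f x.
have f0 : f 0 = 0 by rewrite -(subrr 0) fB ?sg0 // subrr.
have hom0 : partial_hom R0.
  split=> [|x y x' y' [xK ->] [x'K ->]|d [_ ->] //]; first by split; rewrite ?sg0.
  by split; [apply: sgB|rewrite fB].
have [|M [homM maxM]] := @classical_sets.Zorn_bigcup _
    (fun M => partial_hom (fun x y => R0 x y \/ M (x, y))).
  by move=> C homC totC; apply: partial_hom_chain.
pose R x y := R0 x y \/ M (x, y).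
have /functional_choice [h hR] x : exists y, R x y.
  have [//|noR] := asboolP (exists y, R x y).
  have [R' [homR' RR' [d R'd]]] := partial_hom_adjoin homM x divD.
  case: (maxM (fun p => R' p.1 p.2)).
    split=> [[y z] Myz|R'M]; first by apply: RR'; right.
    by apply: noR; exists d; right; apply: (R'M (x, d)).
  apply: partial_hom_ext homR' => y z; split=> [|[R0yz|//]]; first by right.
  by apply: RR'; left.
have hB : zmod_morphism h.
  move=> x y; have [_ RB _] := homM.
  exact: (partial_hom_inj homM (hR _) (RB _ _ _ _ (hR x) (hR y))).
pose h_additive : {additive G -> D} := HB.pack h (GRing.isZmodMorphism.Build G D h hB).
exists h_additive => x xK.
by apply: (partial_hom_inj homM (hR x)); left.
Qed.
End DivisibleInjective.

(* [M] embeds into [Q^M / R], where [R] is the group of integral relations of [M]. *)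
Section DivisibleHull.
Variable M : zmodType.

Definition integral_relation : pred (funT M rat^o) := fun f => asbool (exists s (c : M -> int),
  [/\ uniq s, forall x, c x != 0 -> x \in s, forall x, f x = (c x)%:~R &
      \sum_(x <- s) x *~ c x = 0]).

Let relation0 : 0 \in integral_relation.
Proof. by apply/asboolP; exists [::], (fun=> 0); split=> //; rewrite big_nil. Qed.

Let relationB f g : f \in integral_relation -> g \in integral_relation ->
  f - g \in integral_relation.
Proof.
move=> /asboolP [s [c [us sc fc c0]]] /asboolP [s' [c' [us' sc' gc' c'0]]]; apply/asboolP.
exists (undup (s ++ s')), (fun x => c x - c' x); split; first exact: undup_uniq.
- move=> x; rewrite mem_undup mem_cat; apply: contraNT; rewrite negb_or => /andP [xs xs'].
  by rewrite (contraNeq (sc x) xs) (contraNeq (sc' x) xs') subrr.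
- by move=> x; rewrite intrB -fc -gc'.
rewrite (eq_bigr _ (fun x _ => mulrzBr x (c x) (c' x))) sumrB.
have supp r (k : M -> int) : uniq r -> (forall x, k x != 0 -> x \in r) -> {subset r <= s ++ s'} ->
    \sum_(x <- undup (s ++ s')) x *~ k x = \sum_(x <- r) x *~ k x.
  move=> ur rk rs; apply: big_uniq_support; rewrite ?undup_uniq // => x kx; last first.
    by apply: rk; apply: contraNneq kx => ->.
  by rewrite mem_undup; apply/rs/rk; apply: contraNneq kx => ->.
by rewrite (supp s) // 1?(supp s') // ?c0 ?c'0 ?subrr // => x; rewrite mem_cat => ->; rewrite ?orbT.
Qed.

Definition divisible_hull := quot (SubGrp relation0 relationB).
Definition hull_in (x : M) : divisible_hull := qproj _ (fdelta x (1 : rat^o)).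

Lemma divisible_hull_divisible : divisible divisible_hull.
Proof.
move=> d n n0; exists (qproj _ (n%:R^-1 *: (q_val d : funT M rat^o))).
rewrite -raddfMn -scaler_nat scalerA divff ?scale1r; first exact: qproj_val.
by rewrite Num.Theory.pnatr_eq0 -lt0n.
Qed.

Lemma hull_in_is_zmod_morphism : zmod_morphism hull_in.
Proof.
move=> a b; apply/eqP; rewrite /hull_in -raddfB qproj_eqE; apply/asboolP.
pose c x : int := (x == a - b)%:R - ((x == a)%:R - (x == b)%:R).
exists (undup [:: a - b; a; b]), c; split; first exact: undup_uniq.
- move=> x; rewrite mem_undup !inE; apply: contraNT; rewrite !negb_or => /and3P [xab xa xb].
  by rewrite /c (negbTE xab) (negbTE xa) (negbTE xb) !subr0.
- move=> x; pose delta y : rat := fdelta y (1 : rat^o) x.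
  rewrite -[LHS]/(delta (a - b) - (delta a - delta b)).
  by rewrite /c /delta /fdelta; do 3 case: (x == _).
have pick y : y \in [:: a - b; a; b] ->
    \sum_(x <- undup [:: a - b; a; b]) x *~ (x == y)%:R = y.
  move=> ys; rewrite -[RHS](@big_pred1_uniq _ _ (undup [:: a - b; a; b]) y id) ?undup_uniq //.
    by apply: eq_bigr => x _; case: eqP.
  by rewrite mem_undup.
rewrite (eq_bigr (fun x => x *~ (x == a - b)%:R - (x *~ (x == a)%:R - x *~ (x == b)%:R))).
  by rewrite !sumrB !pick ?subrr // !inE eqxx ?orbT.
by move=> x _; rewrite !mulrzBr.
Qed.
HB.instance Definition _ :=
  GRing.isZmodMorphism.Build M divisible_hull hull_in hull_in_is_zmod_morphism.

Lemma hull_in_inj : injective hull_in.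
Proof.
apply/raddf_inj => m /eqP; rewrite qproj_eq0 => /asboolP [s [c [us sc mc <-]]].
have cE x : c x = (x == m)%:R.
  by apply/eqP; rewrite -(eqr_int rat) -mc /fdelta; case: (x == m).
rewrite -[LHS](@big_pred1_uniq _ _ s m id) //; last by rewrite sc // cE eqxx.
by apply: eq_bigr => x _; rewrite cE; case: eqP.
Qed.
End DivisibleHull.

Section CocycleExtension.
Variables (G : zmodType) (H : subgrp G).

Definition add_cocycle_on (M : zmodType) (P : pred G) (t : G -> G -> M) :=
  (forall a b c, a \in P -> b \in P -> c \in P -> t a b + t (a + b) c = t a (b + c) + t b c) /\
  (forall a b, a \in P -> b \in P -> t a b = t b a).

(* The abelian extension of [H] by [D] defined by [t]. *)
Section ExtensionGroup.
Variables (D : zmodType) (t : G -> G -> D).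
Hypothesis tC : add_cocycle_on (sg_pred H) t.

Definition cocycle_ext of add_cocycle_on (sg_pred H) t := {p : (G * D)%type | p.1 \in sg_pred H}.
Local Notation E := (cocycle_ext tC).
HB.instance Definition _ := Choice.on E.

Let t0r a : a \in sg_pred H -> t a 0 = t 0 0.
Proof.
move=> aH; have [tA _] := tC; have := tA a 0 0 aH (sg0 H) (sg0 H).
by rewrite !addr0 => /addrI.
Qed.

Definition cocycle_ext_elt a x (aH : a \in sg_pred H) : E := exist _ (a, x) aH.
Definition cocycle_ext_zero : E := cocycle_ext_elt (- t 0 0) (sg0 H).
Definition cocycle_ext_opp (p : E) : E :=
  cocycle_ext_elt (- (val p).2 - t 0 0 - t (- (val p).1) (val p).1) (sgN (valP p)).
Definition cocycle_ext_add (p q : E) : E :=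
  cocycle_ext_elt ((val p).2 + (val q).2 + t (val p).1 (val q).1) (sgD (valP p) (valP q)).

Lemma cocycle_ext_addA : associative cocycle_ext_add.
Proof.
move=> [[a x] aH] [[b y] bH] [[c z] cH]; apply: val_inj => /=; congr (_, _); first exact: addrA.
have [tA _] := tC.
by rewrite [LHS](AC (1*3*1) (1*2*3*(5*4))) [RHS](ACl (1*2*4*(3*5))) /= tA.
Qed.

Lemma cocycle_ext_addC : commutative cocycle_ext_add.
Proof.
move=> [[a x] aH] [[b y] bH]; apply: val_inj; rewrite /= addrC [x + y]addrC.
by have [_ ->] := tC.
Qed.

Lemma cocycle_ext_add0 : left_id cocycle_ext_zero cocycle_ext_add.
Proof.
move=> [[a x] aH]; apply: val_inj; rewrite /= add0r; have [_ ->] := tC; rewrite ?sg0 // t0r //.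
by rewrite addrAC addNr add0r.
Qed.

Lemma cocycle_ext_addN : left_inverse cocycle_ext_zero cocycle_ext_opp cocycle_ext_add.
Proof.
move=> [[a x] aH]; apply: val_inj; rewrite /= addNr; congr (_, _).
by rewrite addrAC subrK addrAC addNr add0r.
Qed.
HB.instance Definition _ := GRing.isZmodule.Build E
  cocycle_ext_addA cocycle_ext_addC cocycle_ext_add0 cocycle_ext_addN.
End ExtensionGroup.

Section DivisibleValues.
Variable D : zmodType.
Hypothesis divD : divisible D.

Lemma divisible_cocycle_trivial (t : G -> G -> D) : add_cocycle_on (sg_pred H) t ->
  exists gam : G -> D, forall a b, a \in sg_pred H -> b \in sg_pred H ->
    gam a + gam b - gam (a + b) = t a b.
Proof.
move=> tC.
pose fib : pred (cocycle_ext tC) := fun p => (val p).1 == 0.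
have fibB : forall p q, p \in fib -> q \in fib -> p - q \in fib.
  by move=> p q; rewrite !unfold_in /= => /eqP -> /eqP ->; rewrite addrN.
have fib0 : 0 \in fib by rewrite unfold_in /=.
pose f (p : cocycle_ext tC) := (val p).2 + t 0 0.
have [p q /eqP p0 /eqP q0|h hE] := @divisible_injective _ _ (SubGrp fib0 fibB) f divD.
  by rewrite /f /= p0 q0 oppr0 !addrA !subrK opprD addrACA subrr addr0.
pose gam g := if (g \in sg_pred H) =P true is ReflectT gH then h (cocycle_ext_elt tC 0 gH) else 0.
have gamE g (gH : g \in sg_pred H) : gam g = h (cocycle_ext_elt tC 0 gH).
  by rewrite /gam; case: eqP => // gH'; rewrite (bool_irrelevance gH' gH).
exists gam => a b aH bH; have abH := sgD aH bH.
rewrite !gamE -raddfD -raddfB hE /f /=.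
  by rewrite addr0 add0r oppr0 sub0r addrA (proj2 tC _ _ abH) ?sgN // !subrK.
by rewrite unfold_in /= addrN.
Qed.

Lemma divisible_hom_mod_extend (L : subgrp D) (gam : G -> D) :
  (forall a b, a \in sg_pred H -> b \in sg_pred H -> gam a + gam b - gam (a + b) \in sg_pred L) ->
  exists gam' : G -> D, {in sg_pred H, gam' =1 gam} /\
    forall a b, gam' a + gam' b - gam' (a + b) \in sg_pred L.
Proof.
move=> gamD; have [||h hE] := @divisible_injective G (quot L) H (qproj L \o gam).
- move=> d n n0; have [e en] := divD (q_val d) n0; exists (qproj L e).
  by rewrite -raddfMn en /= qproj_val.
- move=> x y xH yH; apply/(addIr (qproj L (gam y)))/eqP; rewrite /= subrK -raddfD qproj_eqE.
  by have := gamD _ _ (sgB xH yH) yH; rewrite subrK.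
pose gam' g := if g \in sg_pred H then gam g else q_val (h g).
have gam'E g : qproj L (gam' g) = h g.
  by rewrite /gam'; case: ifP => [gH|_]; [rewrite hE|exact: qproj_val].
exists gam'; split=> [g gH|a b]; first by rewrite /gam' gH.
by rewrite -qproj_eq0 raddfB raddfD /= !gam'E raddfD subrr.
Qed.
End DivisibleValues.

(* Ext^2 vanishes for abelian groups: over a divisible hull of [M] the cocycle is a coboundary
   [d gam], and [gam] modulo [M] is a homomorphism on [H], which extends to [G]. *)
Lemma add_cocycle_extend (M : zmodType) (t : G -> G -> M) : add_cocycle_on (sg_pred H) t ->
  exists t' : G -> G -> M, add_cocycle_on predT t' /\
    forall a b, a \in sg_pred H -> b \in sg_pred H -> t' a b = t a b.
Proof.
move=> [tA tS]; have divD := @divisible_hull_divisible M.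
have [|gam gamE] := @divisible_cocycle_trivial _ divD (fun a b => hull_in (t a b)).
  by split=> [a b c aH bH cH|a b aH bH]; rewrite -?raddfD ?tA // tS.
pose im : pred (divisible_hull M) := fun d => asbool (exists m, hull_in m = d).
have im0 : 0 \in im by apply/asboolP; exists 0; rewrite raddf0.
have imB d e : d \in im -> e \in im -> d - e \in im.
  by move=> /asboolP [m <-] /asboolP [n <-]; apply/asboolP; exists (m - n); rewrite raddfB.
have [|gam' [gam'E gam'D]] := @divisible_hom_mod_extend _ divD (SubGrp im0 imB) gam.
  by move=> a b aH bH; apply/asboolP; exists (t a b); rewrite gamE.
have /functional_choice [t' t'E] ab : exists m,
    hull_in m = gam' ab.1 + gam' ab.2 - gam' (ab.1 + ab.2).
  exact/asboolP/gam'D.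
exists (fun a b => t' (a, b)); split; first split=> [a b c _ _ _|a b _ _].
- apply: (@hull_in_inj M); rewrite !raddfD /= !t'E /= !addrA.
  by rewrite subrK [RHS](ACl (1*4*5*3*2*6)) /= addrK.
- by apply: (@hull_in_inj M); rewrite !t'E /= [b + a]addrC [gam' b + _]addrC.
by move=> a b aH bH; apply: (@hull_in_inj M); rewrite t'E -gamE //= !gam'E ?sgD.
Qed.
End CocycleExtension.

Section MulGroup.
Variable F : fieldType.

Definition nonzero_elt := {x : F | x != 0}.
HB.instance Definition _ := Choice.on nonzero_elt.

Definition nz_one : nonzero_elt := exist _ 1 (oner_neq0 F).
Definition nz_mul (x y : nonzero_elt) : nonzero_elt :=
  exist _ (val x * val y) (mulf_neq0 (valP x) (valP y)).
Definition nz_inv (x : nonzero_elt) : nonzero_elt :=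
  exist _ (val x)^-1 (invr_neq0 (valP x)).

Lemma nz_mulA : associative nz_mul. Proof. by move=> x y z; apply/val_inj/mulrA. Qed.
Lemma nz_mulC : commutative nz_mul. Proof. by move=> x y; apply/val_inj/mulrC. Qed.
Lemma nz_mul1 : left_id nz_one nz_mul. Proof. by move=> x; apply/val_inj/mul1r. Qed.
Lemma nz_mulV : left_inverse nz_one nz_inv nz_mul.
Proof. by move=> [x x0]; apply/val_inj/mulVf. Qed.

(* [F^*] written additively, so that [add_cocycle_extend] applies to it. *)
HB.instance Definition _ :=
  GRing.isZmodule.Build nonzero_elt nz_mulA nz_mulC nz_mul1 nz_mulV.
End MulGroup.

Section Sym2Cocycles.
Variables (F : fieldType) (G : zmodType).
Implicit Types t : G -> G -> F.

Definition sym2cocycle_on (P : pred G) t := [/\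
  forall a b, a \in P -> b \in P -> t a b != 0,
  forall a b c, a \in P -> b \in P -> c \in P -> t a b * t (a + b) c = t a (b + c) * t b c &
  forall a b, a \in P -> b \in P -> t a b = t b a].

Lemma sym2cocycle_extend (H : subgrp G) t : sym2cocycle_on (sg_pred H) t ->
  exists t', sym2cocycle t' /\
    forall a b, a \in sg_pred H -> b \in sg_pred H -> t' a b = t a b.
Proof.
move=> [t0 tA tS]; pose m a b : nonzero_elt F := insubd (nz_one F) (t a b).
have mE a b : a \in sg_pred H -> b \in sg_pred H -> val (m a b) = t a b.
  by move=> aH bH; apply: insubdK; apply: t0.
have [|m' [[m'A m'S] m'E]] := @add_cocycle_extend _ H _ m.
  split=> [a b c aH bH cH|a b aH bH]; apply: val_inj; rewrite /= !mE ?sgD //; first exact: tA.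
  exact: tS.
exists (fun a b => val (m' a b)); split=> [|a b aH bH]; last by rewrite m'E ?mE.
split=> [a b|]; first by case: (m' a b).
by split=> [a b c|a b]; [have /(congr1 val) := m'A a b c isT isT isT|rewrite m'S].
Qed.

Lemma sym2cocycle_neq0 t a b : sym2cocycle t -> t a b != 0. Proof. by case. Qed.
Lemma sym2cocycleA t a b c : sym2cocycle t -> t a b * t (a + b) c = t a (b + c) * t b c.
Proof. by move=> [_ [tA _]]. Qed.
Lemma sym2cocycleC t a b : sym2cocycle t -> t a b = t b a.
Proof. by move=> [_ [_ tC]]. Qed.

Lemma sym2cocycleCA t a b c : sym2cocycle t -> t a c * t b (a + c) = t b c * t a (b + c).
Proof.
move=> tZ; rewrite mulrC -sym2cocycleA // [RHS]mulrC -sym2cocycleA //.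
by rewrite [a + b]addrC (sym2cocycleC a b tZ).
Qed.

Lemma sym2cocycle0r t a : sym2cocycle t -> t a 0 = t 0 0.
Proof.
move=> tZ; have := sym2cocycleA a 0 0 tZ; rewrite !addr0.
exact/mulfI/(sym2cocycle_neq0 _ _ tZ).
Qed.

Lemma sym2cocycle_mul t1 t2 : sym2cocycle t1 -> sym2cocycle t2 ->
  sym2cocycle (fun a b => t1 a b * t2 a b).
Proof.
move=> [n1 [A1 C1]] [n2 [A2 C2]]; split=> [a b|]; first exact: mulf_neq0.
by split=> [a b c|a b]; [rewrite mulrACA A1 A2 mulrACA|rewrite C1 C2].
Qed.

Lemma sym2cocycle_inv t : sym2cocycle t -> sym2cocycle (fun a b => (t a b)^-1).
Proof.
move=> [n [A C]]; split=> [a b|]; first by rewrite invr_eq0.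
by split=> [a b c|a b]; [rewrite -!invfM A|rewrite C].
Qed.

Lemma sym2cocycle_coboundary (gam : G -> F) : (forall a, gam a != 0) ->
  sym2cocycle (fun a b => gam a * gam b / gam (a + b)).
Proof.
move=> gam0; split=> [a b|]; first by rewrite !mulf_neq0 ?invr_eq0.
split=> [a b c|a b]; last by rewrite addrC [gam a * _]mulrC.
by rewrite addrA; field; rewrite !gam0.
Qed.
End Sym2Cocycles.

Section CocycleInflation.
Variables (F : fieldType) (G Gb : zmodType) (pi : {additive G -> Gb}).
Variables (s : Gb -> G) (sK : cancel s pi).
Implicit Types t : G -> G -> F.

Let ker_sec g : pi (g - s (pi g)) = 0. Proof. by rewrite raddfB /= sK subrr. Qed.

Lemma sym2cocycle_inflate t : sym2cocycle t -> (forall h g, pi h = 0 -> t h g = t 0 0) ->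
  exists mu : Gb -> Gb -> F, sym2cocycle mu /\ forall a b, t a b = mu (pi a) (pi b).
Proof.
move=> tZ t_ker; have t_kerl h g k : pi h = 0 -> t (h + g) k = t g k.
  move=> h0; apply: (mulfI (sym2cocycle_neq0 h g tZ)).
  by rewrite sym2cocycleA // (t_ker _ (g + k) h0) (t_ker _ g h0).
have tE g k : t g k = t (s (pi g)) (s (pi k)).
  rewrite -{1}(subrK (s (pi g)) g) t_kerl // (sym2cocycleC _ _ tZ).
  by rewrite -{1}(subrK (s (pi k)) k) t_kerl // (sym2cocycleC _ _ tZ).
exists (fun a b => t (s a) (s b)); split=> //; split=> [a b|]; first exact: sym2cocycle_neq0.
have sD a b c : t (s (a + b)) (s c) = t (s a + s b) (s c) by rewrite [RHS]tE raddfD /= !sK.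
split=> [a b c|a b]; last exact: sym2cocycleC.
by rewrite sD [t _ (s (b + c))](sym2cocycleC _ _ tZ) sD (sym2cocycleC _ (s a) tZ) sym2cocycleA.
Qed.

(* [gam] extends [lam], using the section [s], so that [t / d gam] becomes trivial against the
   kernel of [pi]. *)
Lemma sym2cocycle_descend t (lam : G -> F) : sym2cocycle t ->
  (forall h, pi h = 0 -> lam h != 0) ->
  (forall h k, pi h = 0 -> pi k = 0 -> t h k * lam (h + k) = lam h * lam k) ->
  exists (gam : G -> F) (mu : Gb -> Gb -> F), [/\ forall g, gam g != 0, sym2cocycle mu,
    forall h g, pi h = 0 -> t h g * gam (h + g) = lam h * gam g &
    forall a b, t a b = mu (pi a) (pi b) * (gam a * gam b / gam (a + b))].
Proof.
move=> tZ lam0 lamM; have t0 a b := sym2cocycle_neq0 a b tZ.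
pose gam g := lam (g - s (pi g)) / t (g - s (pi g)) (s (pi g)).
have gam0 g : gam g != 0 by rewrite mulf_neq0 ?invr_eq0 ?lam0.
have gamM h g : pi h = 0 -> t h g * gam (h + g) = lam h * gam g.
  move=> h0; rewrite /gam [pi (h + g)]raddfD /= h0 add0r -addrA.
  set r := s (pi g); set k := g - r; rewrite -{1}(subrK r g) -/k.
  have -> : t h (k + r) = t h k * t (h + k) r / t k r by rewrite sym2cocycleA // mulfK.
  by rewrite [RHS]mulrA -lamM ?ker_sec //; field; rewrite !t0.
pose t' a b := t a b / (gam a * gam b / gam (a + b)).
have t'Z : sym2cocycle t' := sym2cocycle_mul tZ (sym2cocycle_inv (sym2cocycle_coboundary gam0)).
have t'_ker h g : pi h = 0 -> t' h g = lam h / gam h.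
  by move=> h0; rewrite /t' -[t h g](mulfK (gam0 (h + g))) gamM //; field; rewrite !gam0.
have [|mu [muZ muE]] := sym2cocycle_inflate t'Z.
  by move=> h g h0; rewrite (t'_ker h g h0) -(t'_ker h 0 h0) sym2cocycle0r.
exists gam, mu; split=> // a b.
by rewrite -muE /t'; field; rewrite !gam0.
Qed.
End CocycleInflation.

(** * Graded algebras *)

Record galgebra (F : fieldType) (G : zmodType) := GAlgebra {
  galg_of :> galg F G;
  galgP : is_galg galg_of }.

Section GradedAlgebra.
Variables (F : fieldType) (G : zmodType) (A : galgebra F G).
Implicit Types (x y : gcar A) (g h : G).

Let grA : is_grading A. Proof. by case: (galgP A). Qed.
Let bA : bilinear_mul A. Proof. by case: (galgP A). Qed.

Lemma gcomp_submod_closed g : submod_closed (gcomp A g).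
Proof. by case: grA => compS _; case: (compS g). Qed.
HB.instance Definition _ g := GRing.isSubmodClosed.Build F (gcar A) (gcomp A g)
  (GRing.submod_closed_semi (gcomp_submod_closed g)).

Definition gmulr y x := gmul A x y.

Lemma gmul_is_linear x : linear (gmul A x). Proof. by move=> a y z; apply: bA.2. Qed.
Lemma gmulr_is_linear y : linear (gmulr y). Proof. by move=> a x z; apply: bA.1. Qed.
HB.instance Definition _ x :=
  GRing.isLinear.Build F (gcar A) (gcar A) *:%R (gmul A x) (gmul_is_linear x).
HB.instance Definition _ y :=
  GRing.isLinear.Build F (gcar A) (gcar A) *:%R (gmulr y) (gmulr_is_linear y).

Lemma gmul0l y : gmul A 0 y = 0. Proof. exact: (linear0 (gmulr y)). Qed.
Lemma gmul0r x : gmul A x 0 = 0. Proof. exact: linear0. Qed.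
Lemma gmulZl a x y : gmul A (a *: x) y = a *: gmul A x y. Proof. exact: (linearZZ (gmulr y)). Qed.
Lemma gmulZr a x y : gmul A x (a *: y) = a *: gmul A x y. Proof. exact: linearZZ. Qed.
Lemma gmulZZ a b x y : gmul A (a *: x) (b *: y) = (a * b) *: gmul A x y.
Proof. by rewrite gmulZl gmulZr scalerA. Qed.
Lemma gmulDl x x' y : gmul A (x + x') y = gmul A x y + gmul A x' y.
Proof. exact: (linearD (gmulr y)). Qed.
Lemma gmulDr x y y' : gmul A x (y + y') = gmul A x y + gmul A x y'.
Proof. exact: linearD. Qed.

Lemma mem_gmul g h x y :
  x \in gcomp A g -> y \in gcomp A h -> gmul A x y \in gcomp A (g + h).
Proof. by case: grA => _ [_ [_]]; apply. Qed.

Lemma gdecP x : [/\ uniq (gdec x).1, forall g, (gdec x).2 g \in gcomp A g &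
  x = \sum_(g <- (gdec x).1) (gdec x).2 g].
Proof.
rewrite /gdec; case: excluded_middle_informative => [dec|[]].
  by case: constructive_indefinite_description => p [? [? ?]].
case: grA => _ [/(_ x) [s [f [fA ->]]] _].
exists (undup s, fun g => f g *+ count_mem g s); split; first exact: undup_uniq.
split=> [g|]; first exact: rpredMn.
by rewrite -(big_undup_iterop_count _ s).
Qed.

Definition proj g x := if g \in (gdec x).1 then (gdec x).2 g else 0.

Lemma mem_proj g x : proj g x \in gcomp A g.
Proof. by rewrite /proj; case: ifP => _; [case: (gdecP x)|apply: rpred0]. Qed.

Lemma gdec_uniq x : uniq (gdec x).1. Proof. by case: (gdecP x). Qed.

Lemma proj_neq0_gdec g x : proj g x != 0 -> g \in (gdec x).1.
Proof. by rewrite /proj; case: ifP => //; rewrite eqxx. Qed.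

Lemma sum_proj s x : uniq s -> (forall g, proj g x != 0 -> g \in s) -> \sum_(g <- s) proj g x = x.
Proof.
move=> us sx; have [ud _ e] := gdecP x; rewrite [RHS]e.
rewrite (big_uniq_support us ud sx (fun g => @proj_neq0_gdec g x)).
by apply: eq_big_seq => g gx; rewrite /proj gx.
Qed.

Definition gsupp x := [seq g <- (gdec x).1 | proj g x != 0].

Lemma gsupp_uniq x : uniq (gsupp x). Proof. exact/filter_uniq/gdec_uniq. Qed.

Lemma mem_gsupp g x : (g \in gsupp x) = (proj g x != 0).
Proof. by rewrite mem_filter; case: eqVneq => //= /proj_neq0_gdec. Qed.

Lemma sum_gsupp x : \sum_(g <- gsupp x) proj g x = x.
Proof. by apply: sum_proj (gsupp_uniq x) _ => g; rewrite mem_gsupp. Qed.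

Lemma proj_sum s (f : G -> gcar A) g : uniq s -> (forall h, f h \in gcomp A h) ->
  (forall h, f h != 0 -> h \in s) -> proj g (\sum_(h <- s) f h) = f g.
Proof.
move=> us fA fs; set x := \sum_(h <- s) f h; pose S := undup (s ++ gsupp x).
have fS h : f h != 0 -> h \in S by move=> /fs hs; rewrite mem_undup mem_cat hs.
have xS h : proj h x != 0 -> h \in S by rewrite mem_undup mem_cat mem_gsupp orbC => ->.
apply/subr0_eq; have [gS|gS] := boolP (g \in S); last first.
  by rewrite (contraNeq (xS g) gS) (contraNeq (fS g) gS) subrr.
case: grA => _ [_ [direct _]]; have uS : uniq S := undup_uniq _.
apply: (direct S (fun h => proj h x - f h) uS) gS => [h|]; first by rewrite rpredB ?mem_proj.
by rewrite sumrB sum_proj // (big_uniq_support uS us fS fs) subrr.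
Qed.

Lemma proj_is_linear g : linear (proj g).
Proof.
move=> a x y; pose S := undup (gsupp x ++ gsupp y).
have Sx h : proj h x != 0 -> h \in S by rewrite mem_undup mem_cat !mem_gsupp => ->.
have Sy h : proj h y != 0 -> h \in S by rewrite mem_undup mem_cat !mem_gsupp orbC => ->.
have uS : uniq S := undup_uniq _; rewrite -[in LHS](sum_proj uS Sx) -[in LHS](sum_proj uS Sy).
rewrite scaler_sumr -big_split (proj_sum _ uS) //= => h.
  by rewrite rpredD ?rpredZ ?mem_proj.
by have [->|/Sx //] := eqVneq (proj h x) 0; rewrite scaler0 add0r; apply: Sy.
Qed.
HB.instance Definition _ g :=
  GRing.isLinear.Build F (gcar A) (gcar A) *:%R (proj g) (proj_is_linear g).

Lemma proj_homog g h x : x \in gcomp A h -> proj g x = if h == g then x else 0.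
Proof.
move=> xh; rewrite -[in LHS](_ : \sum_(k <- [:: h]) (if h == k then x else 0) = x).
  apply: proj_sum => // k; first by case: eqP => [<-|_]; rewrite ?rpred0.
  by rewrite inE; case: (h =P k) => [->|_]; rewrite !eqxx.
by rewrite big_seq1 eqxx.
Qed.

Lemma proj_id g x : x \in gcomp A g -> proj g x = x.
Proof. by move=> /proj_homog ->; rewrite eqxx. Qed.

Lemma proj_neq g h x : x \in gcomp A h -> h != g -> proj g x = 0.
Proof. by move=> /proj_homog -> /negbTE ->. Qed.

Lemma proj_inj x y : (forall g, proj g x = proj g y) -> x = y.
Proof.
move=> xy; apply/subr0_eq; rewrite -(sum_gsupp (x - y)) big1 // => g _.
by rewrite linearB /= xy subrr.
Qed.

Lemma proj_neq0 x : x != 0 -> exists g, proj g x != 0.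
Proof.
move=> x0; have [//|none] := asboolP (exists g, proj g x != 0).
case/eqP: x0; apply: proj_inj => g; rewrite linear0.
by apply/eqP; apply: contraT => gx; case: none; exists g.
Qed.

Lemma gcomp_disjoint g h x : x \in gcomp A g -> x \in gcomp A h -> g != h -> x = 0.
Proof. by move=> xg xh gh; rewrite -(proj_id xg) (proj_neq xh) // eq_sym. Qed.

Lemma homog_ind (Q : gcar A -> Prop) : Q 0 -> (forall x y, Q x -> Q y -> Q (x + y)) ->
  (forall g x, x \in gcomp A g -> Q x) -> forall x, Q x.
Proof.
move=> Q0 QD Qhom x; rewrite -(sum_gsupp x).
by elim/big_ind: _ => // g _; apply/Qhom/mem_proj.
Qed.

Section IntoModule.
Variable V : lmodType F.

Lemma linear_homog_ext (f1 f2 : {linear gcar A -> V}) :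
  (forall g x, x \in gcomp A g -> f1 x = f2 x) -> f1 =1 f2.
Proof.
by move=> f12; apply: homog_ind => [|x y e1 e2|//]; rewrite ?linear0 // !linearD e1 e2.
Qed.

Lemma bilinear_homog_ext (f1 f2 : gcar A -> gcar A -> V) :
  (forall y, linear (f1^~ y)) -> (forall x, linear (f1 x)) ->
  (forall y, linear (f2^~ y)) -> (forall x, linear (f2 x)) ->
  (forall g h x y, x \in gcomp A g -> y \in gcomp A h -> f1 x y = f2 x y) ->
  forall x y, f1 x y = f2 x y.
Proof.
move=> l1 r1 l2 r2 f12 x y.
apply: (linear_homog_ext (f1 := linear_pack (l1 y)) (f2 := linear_pack (l2 y))) => g {}x xg /=.
apply: (linear_homog_ext (f1 := linear_pack (r1 x)) (f2 := linear_pack (r2 x))) => h {}y yh /=.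
exact: (f12 g h).
Qed.

Definition glue (phi : G -> {linear gcar A -> V}) x := \sum_(g <- gsupp x) phi g (proj g x).

Variable phi : G -> {linear gcar A -> V}.

Lemma glue_sum s x : uniq s -> (forall g, proj g x != 0 -> g \in s) ->
  glue phi x = \sum_(g <- s) phi g (proj g x).
Proof.
move=> us sx; have phi_supp g : phi g (proj g x) != 0 -> proj g x != 0.
  by apply: contraNneq => ->; rewrite linear0.
apply: big_uniq_support; rewrite ?gsupp_uniq // => g /phi_supp; first by rewrite mem_gsupp.
exact: sx.
Qed.

Lemma glue_gdec x : glue phi x = \sum_(g <- (gdec x).1) phi g ((gdec x).2 g).
Proof.
rewrite (@glue_sum (gdec x).1) ?gdec_uniq // => [|g]; last exact: proj_neq0_gdec.
by apply: eq_big_seq => g gx; rewrite /proj gx.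
Qed.

Lemma glue_is_linear : linear (glue phi).
Proof.
move=> a x y; pose S := undup (gsupp (a *: x + y) ++ gsupp x ++ gsupp y).
have glueS z : {subset gsupp z <= S} -> glue phi z = \sum_(g <- S) phi g (proj g z).
  move=> zS; apply: glue_sum => [|g gz]; first exact: undup_uniq.
  by apply: zS; rewrite mem_gsupp.
rewrite !glueS => [|g gs|g gs|g gs]; try by rewrite mem_undup !mem_cat gs ?orbT.
by rewrite scaler_sumr -big_split; apply: eq_bigr => g _; rewrite !linearP.
Qed.
HB.instance Definition _ := GRing.isLinear.Build F (gcar A) V *:%R (glue phi) glue_is_linear.

Lemma glue_homog g x : x \in gcomp A g -> glue phi x = phi g x.
Proof.
move=> xg; rewrite (@glue_sum [:: g]) ?big_seq1 ?proj_id // => h.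
by rewrite (proj_homog h xg) inE; case: (g =P h) => [->|_]; rewrite eqxx.
Qed.
End IntoModule.

Lemma proj_gmulr g h x y : y \in gcomp A h -> proj (g + h) (gmul A x y) = gmul A (proj g x) y.
Proof.
move=> yh; rewrite -[LHS]/((proj (g + h) \o gmulr y) x) -[RHS]/((gmulr y \o proj g) x).
move: x; apply: linear_homog_ext => k x xk /=.
rewrite /gmulr (proj_homog _ xk) (proj_homog _ (mem_gmul xk yh)) (inj_eq (addIr h)).
by case: ifP => //; rewrite gmul0l.
Qed.

Lemma proj_gmull g h x y : x \in gcomp A g -> proj (g + h) (gmul A x y) = gmul A x (proj h y).
Proof.
move=> xg; rewrite -[LHS]/((proj (g + h) \o gmul A x) y) -[RHS]/((gmul A x \o proj h) y).
move: y; apply: linear_homog_ext => k y yk /=.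
rewrite (proj_homog _ yk) (proj_homog _ (mem_gmul xg yk)) (inj_eq (addrI g)).
by case: ifP => //; rewrite gmul0r.
Qed.
End GradedAlgebra.

Arguments proj {F G} A g x : rename.

Section Perfect.
Variables (F : fieldType) (G : zmodType).
Implicit Types A : galgebra F G.

Lemma sq_full_ind A : sq_full A -> forall Q : gcar A -> Prop, lincomb_closed Q ->
  (forall g h x y, x \in gcomp A g -> y \in gcomp A h -> Q (gmul A x y)) -> forall x, Q x.
Proof.
move=> sqA Q Qlin Qmul.
have Q0 : Q 0 by have := Qmul 0 0 0 0 (rpred0 _) (rpred0 _); rewrite gmul0l.
have QD := lincomb_closedD Qlin; have {}Qmul x y : Q (gmul A x y).
  elim/homog_ind: x => [|x x' Qx Qx'|g x xg]; rewrite ?gmul0l ?gmulDl //; first exact: QD.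
  elim/homog_ind: y => [|y y' Qy Qy'|h y yh]; rewrite ?gmul0r ?gmulDr //; first exact: QD.
  exact: (Qmul g h).
move=> x; have [s ->] := sqA x; elim: s => [|p s IH]; first by rewrite big_nil.
by rewrite big_cons; apply: Qlin.
Qed.

Lemma sq_full_intro A : (forall Q : gcar A -> Prop, lincomb_closed Q ->
    (forall x y, Q (gmul A x y)) -> forall x, Q x) -> sq_full A.
Proof.
apply=> [a x y [s ->] [s' ->]|x y]; last by exists [:: (1, x, y)]; rewrite big_seq1 scale1r.
exists ([seq (a * p.1.1, p.1.2, p.2) | p <- s] ++ s').
rewrite big_cat big_map scaler_sumr; congr (_ + _).
by apply: eq_bigr => p _; rewrite scalerA.
Qed.

Lemma sq_full_image (G' : zmodType) A (B : galgebra F G') (f : {linear gcar A -> gcar B}) :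
  (forall x y, f (gmul A x y) = gmul B (f x) (f y)) -> (forall y, exists x, f x = y) ->
  sq_full A -> sq_full B.
Proof.
move=> fM f_surj sqA y; have [x <-] := f_surj y; have [s ->] := sqA x.
exists [seq (p.1.1, f p.1.2, f p.2) | p <- s]; rewrite linear_sum big_map.
by apply: eq_bigr => p _; rewrite linearZZ fM.
Qed.
End Perfect.

Section GradedIdeals.
Variables (F : fieldType) (G : zmodType) (A : galgebra F G).

Lemma graded_subspace_proj (I : pred (gcar A)) g x : subspace I -> is_graded_subspace A I ->
  x \in I -> proj A g x \in I.
Proof.
move=> [I0 Ilin] grI /grI [s [f [fI ->]]]; rewrite linear_sum /=.
elim/big_ind: _ => [//|u v|h _]; first exact: (lincomb_closedD Ilin).
by have [fA fhI] := fI h; rewrite (proj_homog g fA); case: ifP.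
Qed.

(* A graded ideal of a graded-simple algebra containing [x0 != 0] is the whole algebra. *)
Lemma graded_simple_ind (Q : gcar A -> Prop) x0 : graded_simple A ->
  lincomb_closed Q -> (forall g x, Q x -> Q (proj A g x)) ->
  (forall g h x y, x \in gcomp A g -> Q x -> y \in gcomp A h ->
     Q (gmul A x y) /\ Q (gmul A y x)) ->
  Q x0 -> x0 != 0 -> forall x, Q x.
Proof.
move=> [_ [_ idealA]] Qlin Qproj Qmul Qx0 x0n.
have [Q0 QD] := (lincomb_closed0 Qlin Qx0, lincomb_closedD Qlin).
have {}Qmul x y : Q x -> Q (gmul A x y) /\ Q (gmul A y x).
  move=> Qx; elim/homog_ind: y => [|y y' [? ?] [? ?]|h y yh].
  - by rewrite gmul0l gmul0r.
  - by rewrite gmulDl gmulDr; split; apply: QD.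
  rewrite -[x]sum_gsupp; elim/big_ind: _ => [|u v [? ?] [? ?]|g _].
  - by rewrite gmul0l gmul0r.
  - by rewrite gmulDl gmulDr; split; apply: QD.
  exact: (Qmul g h _ _ (mem_proj _ _) (Qproj _ _ Qx) yh).
pose I : pred (gcar A) := fun x => asbool (Q x).
have inI x : reflect (Q x) (x \in I) by exact: asboolP.
have idI : is_ideal A I.
  split=> [|x y /inI Qx]; last by have [? ?] := Qmul x y Qx; split; apply/inI.
  by split=> [|a x y /inI Qx /inI Qy]; apply/inI => //; apply: Qlin.
have grI : is_graded_subspace A I.
  move=> x /inI Qx; exists (gsupp x), (fun g => proj A g x); rewrite sum_gsupp; split=> // g.
  by split; [apply: mem_proj|apply/inI/Qproj].
have [I0 x|IT x] := idealA I idI grI; last exact/inI.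
by case/eqP: x0n; apply/I0/inI.
Qed.

Lemma graded_simple_intro : nonzero A -> sq_full A ->
  (forall I : pred (gcar A), is_ideal A I -> (forall g x, x \in I -> proj A g x \in I) ->
     forall x0, x0 \in I -> x0 != 0 -> forall x, x \in I) ->
  graded_simple A.
Proof.
move=> nzA sqA idealA; split=> //; split=> // I idI grI.
have [[x0 [x0I x0n]]|noI] := asboolP (exists x, x \in I /\ x != 0).
  right=> x; apply: (idealA I idI _ x0) => // g y.
  exact: graded_subspace_proj idI.1 grI.
by left=> x xI; apply/eqP/contraT => x0; case: noI; exists x.
Qed.

Lemma simple_graded_simple : simple A -> graded_simple A.
Proof. by move=> [nzA [sqA idealA]]; do 2 split=> //; move=> I /idealA. Qed.

Lemma graded_simple_nondegenerate x : graded_simple A ->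
  (forall g y, y \in gcomp A g -> gmul A x y = 0 /\ gmul A y x = 0) -> x = 0.
Proof.
move=> sA annx; apply/eqP; apply: contraT => x0.
pose Q x := forall g y, y \in gcomp A g -> gmul A x y = 0 /\ gmul A y x = 0.
have annA : forall x, Q x.
  apply: (graded_simple_ind sA) annx x0 => [a u v Qu Qv g y yg|g u Qu h y yh|g h u v _ Qu vh].
  - have [u1 u2] := Qu g y yg; have [v1 v2] := Qv g y yg.
    by rewrite gmulDl gmulDr gmulZl gmulZr u1 u2 v1 v2 scaler0 addr0.
  - have [u1 u2] := Qu h y yh.
    by rewrite -(proj_gmulr g _ yh) -(proj_gmull g _ yh) u1 u2 !linear0.
  have [-> ->] := Qu h v vh.
  by split=> k y _; rewrite gmul0l gmul0r.
case/eqP: x0; have [_ [sqA _]] := sA; move: x {annx}; apply: (sq_full_ind sqA).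
  by move=> a u v -> ->; rewrite scaler0 addr0.
by move=> g h u v _ /(annA u) [].
Qed.
End GradedIdeals.

(** * Centroids *)

Section Centroid.
Variables (F : fieldType) (G : zmodType) (A : galgebra F G).
Local Notation C := (centroid_alg A).

Lemma is_centroid_homog (c : {linear gcar A -> gcar A}) :
  (forall g h x y, x \in gcomp A g -> y \in gcomp A h ->
     c (gmul A x y) = gmul A (c x) y /\ c (gmul A x y) = gmul A x (c y)) ->
  is_centroid A c.
Proof.
move=> cM; split=> [a x y|x y]; first exact: linearP.
split; move: x y; apply: bilinear_homog_ext => [y|x|y|x|g h x y xg yh].
- exact: (linearP (c \o gmulr y)).
- exact: (linearP (c \o gmul A x)).
- exact: (linearP (gmulr y \o c)).
- exact: (linearP (gmul A (c x))).
- by case: (cM g h x y).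
- exact: (linearP (c \o gmulr y)).
- exact: (linearP (c \o gmul A x)).
- exact: (linearP (gmulr (c y))).
- exact: (linearP (gmul A x \o c)).
- by case: (cM g h x y).
Qed.

Lemma centroid_id : is_centroid A id. Proof. by split. Qed.

Lemma centroid_lincomb a c d : is_centroid A c -> is_centroid A d ->
  is_centroid A (fun x => a *: c x + d x).
Proof.
move=> [cL cM] [dL dM]; split=> [b x y|x y].
  by rewrite cL dL !scalerDr !scalerA [a * b]mulrC addrACA.
rewrite gmulDl gmulDr gmulZl gmulZr.
by rewrite -!(cM x y).1 -!(cM x y).2 -!(dM x y).1 -!(dM x y).2.
Qed.

Lemma centroid_comp c d : is_centroid A c -> is_centroid A d -> is_centroid A (c \o d).
Proof.
move=> [cL cM] [dL dM]; split=> [a x y|x y] /=; first by rewrite dL cL.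
by rewrite {1}(dM x y).1 (cM _ _).1 (dM x y).2 (cM _ _).2.
Qed.

Definition cval (c : gcar C) : gcar A -> gcar A := sp_val (c : spanT (cent_gen A)).

Lemma cval_is_centroid c : is_centroid A (cval c).
Proof.
have := sp_valP (c : spanT (cent_gen A)); rewrite unfold_in => /asboolP spanc.
suff : sp_val (c : spanT (cent_gen A)) \in cent_gen A by move=> /asboolP.
apply: spanc => [|a x y /asboolP cx /asboolP cy|//]; apply/asboolP.
  by split=> [a x y|x y]; rewrite ?scaler0 ?addr0 // gmul0l gmul0r.
exact: centroid_lincomb.
Qed.

Lemma cval_is_linear c : linear (cval c). Proof. by case: (cval_is_centroid c). Qed.
HB.instance Definition _ c :=
  GRing.isLinear.Build F (gcar A) (gcar A) *:%R (cval c) (cval_is_linear c).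

Lemma cval_mull c x y : cval c (gmul A x y) = gmul A (cval c x) y.
Proof. by case: (cval_is_centroid c) => _ /(_ x y) []. Qed.

Lemma cval_mulr c x y : cval c (gmul A x y) = gmul A x (cval c y).
Proof. by case: (cval_is_centroid c) => _ /(_ x y) []. Qed.

Lemma mem_span_cent f : is_centroid A f -> (f : funT _ _) \in spanP (cent_gen A).
Proof. by move=> fC; apply/asboolP => Q _ _; apply; apply/asboolP. Qed.

Definition centroid_of f (fC : is_centroid A f) : gcar C := SpanT (mem_span_cent fC).

Lemma centroid_ofE f (fC : is_centroid A f) : cval (centroid_of fC) = f. Proof. by []. Qed.

Lemma cval_inj c d : cval c =1 cval d -> c = d.
Proof. by move=> cd; apply/val_inj/functional_extensionality. Qed.

Lemma cvalZD a c d x : cval (a *: c + d) x = a *: cval c x + cval d x. Proof. by []. Qed.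
Lemma cval0 x : cval 0 x = 0. Proof. by []. Qed.
Lemma cvalZ a c x : cval (a *: c) x = a *: cval c x. Proof. by []. Qed.

Lemma cval_sum (I : Type) (r : seq I) (c : I -> gcar C) x :
  cval (\sum_(i <- r) c i) x = \sum_(i <- r) cval (c i) x.
Proof. by elim: r => [|i r IH]; rewrite ?big_nil ?big_cons //= -IH. Qed.

Lemma cval_neq0 c : c != 0 -> exists x, cval c x != 0.
Proof.
move=> c0; have [//|none] := asboolP (exists x, cval c x != 0).
case/eqP: c0; apply: cval_inj => x; apply/eqP/contraT => cx.
by case: none; exists x.
Qed.

Lemma cval_gmul c d x : cval (gmul C c d) x = cval c (cval d x).
Proof.
have cdC := centroid_comp (cval_is_centroid c) (cval_is_centroid d).
rewrite -[LHS]/(sp_val (insubd (0 : spanT (cent_gen A)) (cval c \o cval d : funT _ _)) x).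
by rewrite [sp_val _](insubdK (0 : spanT (cent_gen A))) //; apply: mem_span_cent.
Qed.

Lemma centroid_gmulA c d e : gmul C (gmul C c d) e = gmul C c (gmul C d e).
Proof. by apply: cval_inj => x; rewrite !cval_gmul. Qed.

Lemma centroid_gmulC c d : sq_full A -> gmul C c d = gmul C d c.
Proof.
move=> sqA; apply: cval_inj; apply: (sq_full_ind sqA) => [a x y cx cy|g h x y _ _].
  by rewrite !linearP /= cx cy.
by rewrite !cval_gmul (cval_mulr d) !(cval_mull c) (cval_mulr d).
Qed.

Lemma centroid_degP c k : reflect (centroid_deg A k (cval c)) (c \in gcomp C k).
Proof. exact: asboolP. Qed.

Lemma mem_cval c k g x : c \in gcomp C k -> x \in gcomp A g -> cval c x \in gcomp A (k + g).
Proof. by move=> /centroid_degP; apply. Qed.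

Lemma mem_centroid_gmul c d k l : c \in gcomp C k -> d \in gcomp C l ->
  gmul C c d \in gcomp C (k + l).
Proof. by move=> ck dl; apply/centroid_degP => g x xg; rewrite cval_gmul -addrA !mem_cval. Qed.

Lemma proj_cval c k g x : c \in gcomp C k -> proj A (k + g) (cval c x) = cval c (proj A g x).
Proof.
move=> ck; rewrite -[LHS]/((proj A (k + g) \o cval c) x) -[RHS]/((cval c \o proj A g) x).
move: x; apply: linear_homog_ext => h x xh /=.
rewrite (proj_homog _ xh) (proj_homog _ (mem_cval ck xh)) (inj_eq (addrI k)).
by case: ifP; rewrite ?linear0.
Qed.

Lemma mem_centroid_of k f (fC : is_centroid A f) : centroid_deg A k f ->
  centroid_of fC \in gcomp C k.
Proof. by move=> fk; apply/centroid_degP. Qed.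

Definition centroid_proj_fun k (c : gcar C) : gcar A -> gcar A :=
  glue (fun g => proj A (k + g) \o cval c).

Lemma centroid_proj_is_centroid k c : is_centroid A (centroid_proj_fun k c).
Proof.
apply: is_centroid_homog => g h x y xg yh.
rewrite /= /centroid_proj_fun !(glue_homog _ xg, glue_homog _ yh, glue_homog _ (mem_gmul xg yh)) /=.
split; first by rewrite cval_mull addrA (proj_gmulr _ _ yh).
by rewrite cval_mulr addrCA (proj_gmull _ _ xg).
Qed.

Definition centroid_proj k c : gcar C := centroid_of (centroid_proj_is_centroid k c).

Lemma centroid_projE k c g x : x \in gcomp A g ->
  cval (centroid_proj k c) x = proj A (k + g) (cval c x).
Proof. exact: glue_homog. Qed.

Lemma mem_centroid_proj k c : centroid_proj k c \in gcomp C k.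
Proof.
by apply/centroid_degP => g x xg; rewrite (centroid_projE _ _ xg); apply: mem_proj.
Qed.

Section GradedSimple.
Hypothesis sA : graded_simple A.

Lemma centroid_homog_inj c k : c \in gcomp C k -> c != 0 -> injective (cval c).
Proof.
move=> ck c0; apply/raddf_inj => x cx; apply/eqP/contraT => x0.
have [y /eqP] := cval_neq0 c0; case; move: y.
apply: (graded_simple_ind sA) cx x0 => [a y z cy cz|g y cy|g h y z _ cy _].
- by rewrite linearP /= cy cz scaler0 addr0.
- by rewrite -(proj_cval _ _ ck) cy linear0.
by rewrite cval_mull cval_mulr cy gmul0l gmul0r.
Qed.

Lemma centroid_homog_surj c k y : c \in gcomp C k -> c != 0 -> exists x, cval c x = y.
Proof.
move=> ck /cval_neq0 [x0 cx0]; move: y; apply: (graded_simple_ind sA) cx0; last by exists x0.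
- by move=> a _ _ [x <-] [x' <-]; exists (a *: x + x'); rewrite linearP.
- by move=> g _ [x <-]; exists (proj A (- k + g) x); rewrite -(proj_cval _ _ ck) addNKr.
move=> _ h _ y _ [x <-] _; split; last by exists (gmul A y x); rewrite cval_mulr.
by exists (gmul A x y); rewrite cval_mull.
Qed.

Lemma centroid_homog_inv c k : c \in gcomp C k -> c != 0 ->
  exists d, [/\ d \in gcomp C (- k), cancel (cval c) (cval d) & cancel (cval d) (cval c)].
Proof.
move=> ck c0; have cI := centroid_homog_inj ck c0.
have [f fK] := functional_choice _ (fun y => centroid_homog_surj y ck c0).
have fC : is_centroid A f.
  split=> [a x y|x y]; first by apply: cI; rewrite linearP /= !fK.
  by split; apply: cI; [rewrite cval_mull !fK|rewrite cval_mulr !fK].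
exists (centroid_of fC); split=> // [|x]; last by apply: cI; rewrite fK.
apply: mem_centroid_of => g x xg; suff -> : f x = proj A (- k + g) (f x) by apply: mem_proj.
by apply: cI; rewrite -(proj_cval _ _ ck) !fK addNKr proj_id.
Qed.

Lemma centroid_bilinear : bilinear_mul C.
Proof.
split=> a c d e; apply: cval_inj => x; rewrite cvalZD !cval_gmul ?cvalZD //.
by rewrite linearP.
Qed.

(* All components of [c] are determined by their value at one nonzero homogeneous [x0]. *)
Lemma centroid_sum_proj c : exists s, uniq s /\ c = \sum_(k <- s) centroid_proj k c.
Proof.
have [[x /proj_neq0 [g0 gx]] _] := sA; set x0 := proj A g0 x in gx.
have x0g : x0 \in gcomp A g0 by apply: mem_proj.
pose s := [seq h - g0 | h <- gsupp (cval c x0)].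
have us : uniq s by rewrite map_inj_uniq ?gsupp_uniq //; apply: addIr.
exists s; split=> //; apply: cval_inj; apply: linear_homog_ext => g y yg /=.
rewrite cval_sum (eq_bigr (fun k => proj A (k + g) (cval c y))); last first.
  by move=> k _; apply: centroid_projE.
rewrite -(big_map (+%R^~ g) predT (fun h => proj A h (cval c y))).
rewrite sum_proj // => [|h hy]; first by rewrite map_inj_uniq //; apply: addIr.
apply/mapP; exists (h - g); last by rewrite subrK.
apply/mapP; exists (h - g + g0); last by rewrite addrK.
rewrite mem_gsupp -(centroid_projE _ _ x0g).
rewrite -(linear0 (cval (centroid_proj (h - g) c))) (inj_eq _) //.
apply: (centroid_homog_inj (mem_centroid_proj _ _)); apply: contraNneq hy => e.
by rewrite -(subrK g h) -(centroid_projE _ _ yg) e.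
Qed.

Lemma centroid_alg_galg : is_galg C.
Proof.
split; first exact: centroid_bilinear.
split=> [k|]; first split=> [|a c d ck dk]; first by apply/centroid_degP => g x _; apply: rpred0.
  by apply/centroid_degP => g x xg; rewrite cvalZD rpredD ?rpredZ ?mem_cval.
split=> [c|].
  have [s [_ ->]] := centroid_sum_proj c.
  by exists s, (fun k => centroid_proj k c); split=> // k; apply: mem_centroid_proj.
split=> [s c us cC c0 k ks|k l c d]; last exact: mem_centroid_gmul.
apply: cval_inj; apply: linear_homog_ext => g x xg.
have := congr1 (fun d => proj A (k + g) (cval d x)) c0.
rewrite cval_sum cval0 !linear_sum linear0 /=.
rewrite (eq_bigr (fun l => if l == k then cval (c l) x else 0)) => [|l _].
  by rewrite big_pred1_uniq.
by rewrite (proj_homog _ (mem_cval (cC l) xg)) (inj_eq (addIr g)).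
Qed.
End GradedSimple.
End Centroid.

Arguments cval {F G A} c x : simpl never.

Lemma scalev_inj (F : fieldType) (V : lmodType F) (v : V) :
  v != 0 -> injective (fun a : F => a *: v).
Proof.
move=> v0 a b /eqP; rewrite -subr_eq0 -scalerBl scaler_eq0 (negbTE v0) orbF subr_eq0.
by move/eqP.
Qed.

Definition gsupport (F : fieldType) (G : zmodType) (A : galg F G) (g : G) : Prop :=
  exists2 x, x \in gcomp A g & x != 0.

Section CentroidSupport.
Variables (F : fieldType) (G : zmodType) (A : galgebra F G).
Hypothesis gcsA : graded_central_simple A.
Local Notation C := (centroid_alg A).

Let sA : graded_simple A := proj1 gcsA.
Let CA : galgebra F G := GAlgebra (centroid_alg_galg sA).

Lemma centroid_comp_dim1 c d k : c \in gcomp C k -> d \in gcomp C k -> c != 0 ->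
  exists a : F, d = a *: c.
Proof.
move=> ck dk c0; have [e [ek cK eK]] := centroid_homog_inv sA ck c0.
have : gmul C e d \in gcomp C 0 by rewrite -(addNr k); apply: mem_centroid_gmul.
move=> /centroid_degP /(proj2 gcsA _ (cval_is_centroid _)) [a aE]; exists a.
by apply: cval_inj => x; rewrite -[LHS]eK -(cval_gmul e) aE linearZZ.
Qed.

Lemma centroid_gmul_neq0 c d k l : c \in gcomp C k -> d \in gcomp C l ->
  c != 0 -> d != 0 -> gmul C c d != 0.
Proof.
move=> ck dl c0 d0; have [x dx] := cval_neq0 d0; apply: contraNneq dx => cd0.
by apply/eqP/(centroid_homog_inj sA ck c0); rewrite -cval_gmul cd0 linear0.
Qed.

Let supp : pred G := fun k => asbool (gsupport C k).

Let supp0 : 0 \in supp.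
Proof.
apply/asboolP; exists (centroid_of (centroid_id A)).
  by apply: mem_centroid_of => g x; rewrite add0r.
have [[x x0] _] := sA; apply: contraNneq x0 => id0.
by rewrite -[x]/(cval (centroid_of (centroid_id A)) x) id0.
Qed.

Let suppB k l : k \in supp -> l \in supp -> k - l \in supp.
Proof.
move=> /asboolP [c ck c0] /asboolP [d dl d0]; apply/asboolP.
have [e [el _ eK]] := centroid_homog_inv sA dl d0; exists (gmul C c e).
  exact: mem_centroid_gmul.
apply: (centroid_gmul_neq0 ck el c0); have [x dx] := cval_neq0 d0.
by apply: contraNneq dx => e0; rewrite -[cval d x]eK e0 cval0 linear0.
Qed.

Definition centroid_support : subgrp G := SubGrp supp0 suppB.

Lemma centroid_supportP k : reflect (gsupport C k) (k \in sg_pred centroid_support).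
Proof. exact: asboolP. Qed.

Lemma centroid_basis : exists (u : G -> gcar C) (t : G -> G -> F), [/\ sym2cocycle t,
  forall h, h \in sg_pred centroid_support -> u h \in gcomp C h /\ u h != 0 &
  forall h k, h \in sg_pred centroid_support -> k \in sg_pred centroid_support ->
    gmul C (u h) (u k) = t h k *: u (h + k)].
Proof.
set H := centroid_support.
have /functional_choice [u uC] h : exists c, h \in sg_pred H -> c \in gcomp C h /\ c != 0.
  have [[c ch c0]|noc] := centroid_supportP h; first by exists c.
  by exists 0.
have /functional_choice [t0 t0E] hk : exists a : F, hk.1 \in sg_pred H -> hk.2 \in sg_pred H ->
    gmul C (u hk.1) (u hk.2) = a *: u (hk.1 + hk.2).
  have [hH|] := boolP (hk.1 \in sg_pred H); last by exists 0.
  have [kH|] := boolP (hk.2 \in sg_pred H); last by exists 0.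
  have [[[uh _] [uk _]] [uhk uhk0]] := (uC _ hH, uC _ kH, uC _ (sgD hH kH)).
  by have [a aE] := centroid_comp_dim1 uhk (mem_centroid_gmul uh uk) uhk0; exists a.
have uM h k : h \in sg_pred H -> k \in sg_pred H -> gmul C (u h) (u k) = t0 (h, k) *: u (h + k).
  by move=> hH kH; rewrite (t0E (h, k)).
have [|t [tZ tE]] := @sym2cocycle_extend F G H (fun h k => t0 (h, k)).
  have u0 h : h \in sg_pred H -> u h != 0 by move=> /uC [].
  split=> [a b aH bH|a b c aH bH cH|a b aH bH].
  - have [[ua ua0] [ub ub0]] := (uC a aH, uC b bH).
    apply: contraNneq (centroid_gmul_neq0 ua ub ua0 ub0) => t00.
    by rewrite uM // t00 scale0r.
  - have := centroid_gmulA (u a) (u b) (u c); rewrite !uM ?sgD //.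
    rewrite (gmulZl (A := CA)) (gmulZr (A := CA)) !uM ?sgD // !scalerA addrA.
    by move=> /(scalev_inj (u0 _ (sgD (sgD aH bH) cH))) ->; apply: mulrC.
  have := centroid_gmulC (u a) (u b) (proj1 (proj2 sA)); rewrite !uM // [b + a]addrC.
  by move=> /(scalev_inj (u0 _ (sgD aH bH))).
exists u, t; split=> // h k hH kH.
by rewrite uM // tE.
Qed.
End CentroidSupport.

Section CentralIsSimple.
Variables (F : fieldType) (G : zmodType) (A : galgebra F G).
Implicit Types (x y w : gcar A) (g h : G).

Section MinimalSupport.
Variables (I : pred (gcar A)) (x0 : gcar A) (a : G).
Hypotheses (idI : is_ideal A I) (x0I : x0 \in I) (x0a : proj A a x0 != 0).
Hypothesis x0_min : forall w, w \in I -> (size (gsupp w) < size (gsupp x0))%N -> w = 0.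

(* [w] completes [y] of degree [g] to an element of [I] whose support is that of [x0], translated
   so as to send [a] to [g]. *)
Definition ideal_lift g y w := [/\ w \in I,
  forall h, h \in gsupp w -> h - g + a \in gsupp x0 & proj A g w = y].

Lemma ideal_lift_linear g c y w y' w' : ideal_lift g y w -> ideal_lift g y' w' ->
  ideal_lift g (c *: y + y') (c *: w + w').
Proof.
move=> [wI ws <-] [wI' ws' <-]; split; [exact: idI.1.2| |by rewrite linearP].
move=> h; have [/ws //|] := boolP (h \in gsupp w); rewrite !mem_gsupp => /negbNE/eqP w0.
by rewrite linearP /= w0 scaler0 add0r -mem_gsupp => /ws'; rewrite mem_gsupp.
Qed.

Lemma ideal_lift0 g w : ideal_lift g 0 w -> w = 0.
Proof.
move=> [wI ws w0]; apply: x0_min => //.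
rewrite -(size_map (fun h => h - g + a)).
apply: (@uniq_leq_size _ (a :: _)) => [|_ /[!inE] /orP [/eqP ->|/mapP [h /ws hx0 ->]] //].
  rewrite cons_uniq map_inj_uniq ?gsupp_uniq ?andbT => [|h k /addIr /addIr //].
  apply/mapP => -[h hw /eqP]; rewrite -subr_eq0 opprD addrCA subrr addr0 oppr_eq0 subr_eq0.
  move=> /eqP hg.
  by move: hw; rewrite hg mem_gsupp w0 eqxx.
by rewrite mem_gsupp.
Qed.

Lemma ideal_lift_uniq g y w w' : ideal_lift g y w -> ideal_lift g y w' -> w = w'.
Proof.
move=> yw yw'; have := ideal_lift_linear (-1) yw yw'.
by rewrite !scaleN1r !addNr addrC => /ideal_lift0 /subr0_eq.
Qed.

Lemma ideal_lift_gmulr g h y w z : z \in gcomp A h ->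
  ideal_lift g y w -> ideal_lift (g + h) (gmul A y z) (gmul A w z).
Proof.
move=> zh [wI ws <-]; split; [exact: (idI.2 _ z wI).1| |exact: proj_gmulr].
move=> k; rewrite mem_gsupp -{1}(subrK h k) (proj_gmulr _ _ zh) => wz.
rewrite [g + h]addrC opprD addrA; apply: ws; rewrite mem_gsupp.
by apply: contraNneq wz => ->; rewrite gmul0l.
Qed.

Lemma ideal_lift_gmull g h y w z : z \in gcomp A h ->
  ideal_lift g y w -> ideal_lift (h + g) (gmul A z y) (gmul A z w).
Proof.
move=> zh [wI ws <-]; split; [exact: (idI.2 _ z wI).2| |exact: proj_gmull].
move=> k; rewrite mem_gsupp -{1}(subrKC h k) (proj_gmull _ _ zh) => zw.
rewrite opprD addrA; apply: ws; rewrite mem_gsupp.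
by apply: contraNneq zw => ->; rewrite gmul0r.
Qed.

Lemma ideal_lift_total : graded_simple A -> forall y g, exists w, ideal_lift g (proj A g y) w.
Proof.
move=> sA; have lift0 g : ideal_lift g 0 0.
  by split; rewrite ?linear0 //; [case: idI.1|move=> h; rewrite mem_gsupp linear0 eqxx].
apply: (graded_simple_ind (x0 := proj A a x0) sA) => //.
- move=> c y y' yw y'w g; have [[w yw'] [w' y'w']] := (yw g, y'w g).
  by exists (c *: w + w'); rewrite linearP; apply: ideal_lift_linear.
- move=> g y yw h; rewrite (proj_homog h (mem_proj g y)).
  by case: eqP => [<-|_]; [apply: yw|exists 0].
- move=> g h y z _ yw zh; split=> k.
    have [w yw'] := yw (k - h); exists (gmul A w z).
    by rewrite -{2}(subrK h k) (proj_gmulr _ _ zh) -{1}(subrK h k); apply: ideal_lift_gmulr.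
  have [w yw'] := yw (k - h); exists (gmul A z w).
  by rewrite -{2}(subrKC h k) (proj_gmull _ _ zh) -{1}(subrKC h k); apply: ideal_lift_gmull.
move=> g; rewrite (proj_homog g (mem_proj a x0)); case: eqP => [<-|_]; last by exists 0.
by exists x0; split=> // h hx0; rewrite subrK.
Qed.

(* Completing homogeneous elements is centroidal, hence scalar, hence the identity. *)
Lemma minimal_support_ideal_full : graded_simple A -> central A -> forall y, y \in I.
Proof.
move=> sA cA; have /functional_choice [f fE] : forall gy : G * gcar A, exists w,
    ideal_lift gy.1 (proj A gy.1 gy.2) w.
  by move=> [g y]; apply: ideal_lift_total.
have f_linear g : linear (fun y => f (g, y)).
  move=> c y y'; apply: (ideal_lift_uniq (fE (g, _))) => /=.
  by rewrite linearP; apply: ideal_lift_linear; apply: fE.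
pose phi g := linear_pack (f_linear g).
have phiE g y : y \in gcomp A g -> ideal_lift g y (glue phi y).
  by move=> yg; rewrite (glue_homog _ yg); have := fE (g, y); rewrite /= proj_id.
have [|c cE] := cA (glue phi).
  apply: is_centroid_homog => g h y z yg zh; have yzE := phiE _ _ (mem_gmul yg zh).
  by split; apply: (ideal_lift_uniq yzE); [apply: ideal_lift_gmulr|apply: ideal_lift_gmull]; auto.
have c1 : c = 1.
  have [_ _] := phiE a _ (mem_proj a x0); rewrite cE linearZZ /= (proj_id (mem_proj _ _)) => x0E.
  by apply: (scalev_inj x0a); rewrite x0E scale1r.
apply: homog_ind => [|y z|g y /phiE []]; last by rewrite cE c1 scale1r.
  exact: idI.1.1.
exact: (lincomb_closedD idI.1.2).
Qed.
End MinimalSupport.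

Lemma graded_simple_central_simple : graded_simple A -> central A -> simple A.
Proof.
move=> sA cA; split; first exact: sA.1; split=> [|I idI]; first exact: sA.2.1.
have [[x [xI x0]]|noI] := asboolP (exists x, x \in I /\ x != 0); last first.
  by left=> x xI; apply/eqP/contraT => x0; case: noI; exists x.
right; pose sizes n := asbool (exists x, [/\ x \in I, x != 0 & size (gsupp x) = n]).
have [|n /asboolP [x1 [x1I x1n sz]] nmin] := @ex_minnP sizes.
  by exists (size (gsupp x)); apply/asboolP; exists x.
have [a x1a] := proj_neq0 x1n; apply: (minimal_support_ideal_full idI x1I x1a) sA cA => w wI.
rewrite sz => lt_wn; apply/eqP; apply: contraLR lt_wn => w0; rewrite -leqNgt.
by apply: nmin; apply/asboolP; exists w.
Qed.
End CentralIsSimple.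

(** * Graded isomorphisms and twists *)

Section GradedMaps.
Variables (F : fieldType) (G : zmodType).

Definition graded_hom (A B : galg F G) (f : gcar A -> gcar B) := [/\ linear f,
  forall x y, f (gmul A x y) = gmul B (f x) (f y) &
  forall g x, x \in gcomp A g -> f x \in gcomp B g].

Definition graded_inverses (A B : galg F G) (f : gcar A -> gcar B) (f' : gcar B -> gcar A) :=
  [/\ graded_hom f, graded_hom f', cancel f f' & cancel f' f].

Lemma graded_inverses_sym (A B : galg F G) (f : gcar A -> gcar B) (f' : gcar B -> gcar A) :
  graded_inverses f f' -> graded_inverses f' f.
Proof. by case. Qed.

Lemma graded_inverses_giso (A B : galg F G) (f : gcar A -> gcar B) (f' : gcar B -> gcar A) :
  graded_inverses f f' -> giso A B.
Proof.
move=> [[fL fM fA] [_ _ f'A] fK f'K]; exists f; split=> //; split; first by exists f'.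
by do 2 split=> //; move=> g y /f'A f'y; exists (f' y).
Qed.

Lemma graded_hom_inverse (A B : galg F G) (f : gcar A -> gcar B) (f' : gcar B -> gcar A) :
  graded_hom f -> cancel f f' -> cancel f' f ->
  (forall g y, y \in gcomp B g -> exists2 x, x \in gcomp A g & f x = y) -> graded_hom f'.
Proof.
move=> [fL fM _] fK f'K fB; split=> [a x y|x y|g y /fB [x xg <-]]; last by rewrite fK.
- by apply: (can_inj fK); rewrite fL !f'K.
- by apply: (can_inj fK); rewrite fM !f'K.
Qed.

Lemma giso_graded_inverses (A B : galg F G) : giso A B ->
  exists (f : {linear gcar A -> gcar B}) (f' : {linear gcar B -> gcar A}), graded_inverses f f'.
Proof.
move=> [f [fL [[f' fK f'K] [fM [fA fB]]]]]; have homf : graded_hom f by [].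
have homf' := graded_hom_inverse homf fK f'K fB; have [f'L _ _] := homf'.
by exists (linear_pack fL), (linear_pack f'L).
Qed.

Lemma graded_hom_comp (A B C : galg F G) (f : gcar A -> gcar B) (f' : gcar B -> gcar C) :
  graded_hom f -> graded_hom f' -> graded_hom (f' \o f).
Proof.
move=> [fL fM fA] [f'L f'M f'A]; split=> [a x y|x y|g x xg] /=.
- by rewrite fL f'L.
- by rewrite fM f'M.
- exact/f'A/fA.
Qed.

Lemma giso_sym (A B : galg F G) : giso A B -> giso B A.
Proof.
by move=> /giso_graded_inverses [f [f' /graded_inverses_sym]]; apply: graded_inverses_giso.
Qed.

Lemma giso_trans (A B C : galg F G) : giso A B -> giso B C -> giso A C.
Proof.
move=> /giso_graded_inverses [f [f' [homf homf' fK f'K]]].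
move=> /giso_graded_inverses [p [p' [homp homp' pK p'K]]].
apply: (@graded_inverses_giso _ _ (p \o f) (f' \o p')); split; try exact: can_comp.
  exact: graded_hom_comp homf homp.
exact: graded_hom_comp homp' homf'.
Qed.

Lemma giso_gsupport (A B : galg F G) k : giso A B -> gsupport A k -> gsupport B k.
Proof.
move=> /giso_graded_inverses [f [f' [[_ _ fA] _ fK _]]] [x xk x0]; exists (f x); first exact: fA.
by rewrite raddf_eq0 //; apply: can_inj fK.
Qed.

Section Bundled.
Variables A B : galgebra F G.

Lemma graded_hom_homog (f : {linear gcar A -> gcar B}) :
  (forall g x, x \in gcomp A g -> f x \in gcomp B g) ->
  (forall g h x y, x \in gcomp A g -> y \in gcomp A h ->
     f (gmul A x y) = gmul B (f x) (f y)) -> graded_hom f.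
Proof.
move=> fA fM; split=> //; first exact: linearP.
apply: bilinear_homog_ext => // [y|x|y|x].
- exact: (linearP (f \o gmulr y)).
- exact: (linearP (f \o gmul A x)).
- exact: (linearP (gmulr (f y) \o f)).
- exact: (linearP (gmul B (f x) \o f)).
Qed.

Lemma proj_graded_linear (f : {linear gcar A -> gcar B}) g x :
  (forall g x, x \in gcomp A g -> f x \in gcomp B g) -> proj B g (f x) = f (proj A g x).
Proof.
move=> fA; rewrite -[LHS]/((proj B g \o f) x) -[RHS]/((f \o proj A g) x).
move: x; apply: linear_homog_ext => h x xh /=.
by rewrite (proj_homog _ xh) (proj_homog _ (fA _ _ xh)); case: ifP; rewrite ?linear0.
Qed.

Section Glue.
Variable phi : G -> {linear gcar A -> gcar B}.
Hypothesis mem_phi : forall g x, x \in gcomp A g -> phi g x \in gcomp B g.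
Hypothesis phi_eq0 : forall g x, x \in gcomp A g -> phi g x = 0 -> x = 0.
Hypothesis phi_surj : forall g y, y \in gcomp B g -> exists2 x, x \in gcomp A g & phi g x = y.
Hypothesis phi_gmul : forall g h x y, x \in gcomp A g -> y \in gcomp A h ->
  phi (g + h) (gmul A x y) = gmul B (phi g x) (phi h y).

Lemma glue_graded_inverses :
  exists f' : {linear gcar B -> gcar A}, graded_inverses (glue phi) f'.
Proof.
pose f : {linear gcar A -> gcar B} := glue phi.
have fE g x : x \in gcomp A g -> f x = phi g x by exact: glue_homog.
have fA g x : x \in gcomp A g -> f x \in gcomp B g by move=> xg; rewrite (fE _ _ xg) mem_phi.
have homf : graded_hom f.
  apply: graded_hom_homog => // g h x y xg yh.
  by rewrite (fE _ _ xg) (fE _ _ yh) (fE _ _ (mem_gmul xg yh)) phi_gmul.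
have f_inj : injective f.
  apply: raddf_inj => x fx0; apply: (@proj_inj _ _ A) => g; rewrite linear0.
  apply: (phi_eq0 (mem_proj g x)); rewrite -(fE _ _ (mem_proj g x)).
  by rewrite -(proj_graded_linear _ _ fA) fx0 linear0.
have fB g y : y \in gcomp B g -> exists2 x, x \in gcomp A g & f x = y.
  by move=> /phi_surj [x xg <-]; exists x => //; apply: fE.
have [|f' f'K] := functional_choice (fun y x => f x = y).
  apply: homog_ind => [|_ _ [x <-] [x' <-]|g y /fB [x _ <-]].
  - by exists 0; rewrite linear0.
  - by exists (x + x'); rewrite linearD.
  - by exists x.
have fK : cancel f f' by move=> x; apply: f_inj; rewrite f'K.
have homf' := graded_hom_inverse homf fK f'K fB; have [f'L _ _] := homf'.
by exists (linear_pack f'L).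
Qed.

Lemma giso_intro : giso A B.
Proof. by have [f' /graded_inverses_giso] := glue_graded_inverses. Qed.
End Glue.
End Bundled.

Lemma giso_rescale (V : lmodType F) (P : G -> pred V) (m1 m2 : V -> V -> V) (gam : G -> F) :
  is_galg (GAlg m1 P) -> is_galg (GAlg m2 P) -> (forall g, gam g != 0) ->
  (forall g h x y, x \in P g -> y \in P h ->
     gam (g + h) *: m1 x y = (gam g * gam h) *: m2 x y) ->
  giso (GAlg m1 P) (GAlg m2 P).
Proof.
move=> galg1 galg2 gam0 gamM; pose A1 := GAlgebra galg1; pose A2 := GAlgebra galg2.
have scaleP g a (x : gcar A1) : x \in gcomp A1 g -> a *: x \in gcomp A1 g by exact: rpredZ.
apply: (@giso_intro A1 A2 (fun g => gam g \*: idfun)) => [g x xg|g x xg|g y yg|g h x y xg yh] /=.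
- exact: scaleP.
- by move/eqP; rewrite scaler_eq0 (negbTE (gam0 g)) => /eqP.
- exists ((gam g)^-1 *: (y : V)); first exact: scaleP.
  by rewrite scalerA divff // scale1r.
by rewrite gamM //; apply/esym/(gmulZZ (A := A2)).
Qed.

Lemma giso_eq_gmul (V : lmodType F) (P : G -> pred V) (m1 m2 : V -> V -> V) :
  is_galg (GAlg m1 P) -> is_galg (GAlg m2 P) ->
  (forall g h x y, x \in P g -> y \in P h -> m1 x y = m2 x y) ->
  giso (GAlg m1 P) (GAlg m2 P).
Proof.
move=> galg1 galg2 m12; apply: (giso_rescale galg1 galg2 (fun=> oner_neq0 F)) => g h x y xg yh.
by rewrite mulr1 !scale1r; apply: m12 xg yh.
Qed.
End GradedMaps.

Section GisoTransport.
Variables (F : fieldType) (G : zmodType).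

Section Conjugation.
Variables (A B : galgebra F G).
Variables (f : {linear gcar A -> gcar B}) (f' : {linear gcar B -> gcar A}).
Hypothesis ff' : graded_inverses f f'.

Definition conj_fun (c : gcar A -> gcar A) : gcar B -> gcar B := f \o c \o f'.

Lemma conj_is_centroid c : is_centroid A c -> is_centroid B (conj_fun c).
Proof.
case: ff' => [[_ fM _] [_ f'M _] _ f'K] [cL cM].
split=> [a x y|x y]; rewrite /conj_fun /=; first by rewrite linearP cL linearP.
by rewrite f'M {1}(cM _ _).1 (cM _ _).2 !fM !f'K.
Qed.

Lemma conj_deg c k : centroid_deg A k c -> centroid_deg B k (conj_fun c).
Proof.
by case: ff' => [[_ _ fA] [_ _ f'A] _ _] ck g x /f'A /ck /fA.
Qed.

Definition centroid_conj (c : gcar (centroid_alg A)) : gcar (centroid_alg B) :=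
  centroid_of (conj_is_centroid (cval_is_centroid c)).

Lemma centroid_conjE c y : cval (centroid_conj c) y = f (cval c (f' y)). Proof. by []. Qed.

Lemma centroid_conj_hom : graded_hom centroid_conj.
Proof.
have [_ _ fK _] := ff'; split=> [a c d|c d|k c ck].
- by apply: cval_inj => x; apply: linearP.
- by apply: cval_inj => x; rewrite !(cval_gmul, centroid_conjE) fK.
by apply/centroid_degP/conj_deg/centroid_degP.
Qed.

Lemma graded_inverses_graded_simple : graded_simple A -> graded_simple B.
Proof.
have [[_ fM fA] _ fK f'K] := ff'; move=> sA; have [[x x0] [sqA _]] := sA.
apply: graded_simple_intro.
- by exists (f x); rewrite raddf_eq0 //; apply: can_inj fK.
- by apply: (sq_full_image fM) sqA => y; exists (f' y); apply: f'K.
move=> I [[_ Ilin] Imul] Iproj y0 y0I y0n y; rewrite -(f'K y); move: (f' y).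
apply: (graded_simple_ind (Q := fun x => f x \in I) (x0 := f' y0) sA).
- by move=> a u v uI vI; rewrite linearP; apply: Ilin.
- by move=> g u uI; rewrite -(proj_graded_linear _ _ fA); apply: Iproj.
- by move=> g h u v _ uI _; rewrite !fM; apply: Imul.
- by rewrite f'K.
by rewrite raddf_eq0 //; apply: can_inj f'K.
Qed.
End Conjugation.

Lemma giso_centroid_alg (A B : galgebra F G) : giso A B -> giso (centroid_alg A) (centroid_alg B).
Proof.
move=> /giso_graded_inverses [f [f' ff']]; have f'f := graded_inverses_sym ff'.
have [_ _ fK f'K] := ff'.
apply: (@graded_inverses_giso _ _ _ _ (centroid_conj ff') (centroid_conj f'f)).
split; [exact: centroid_conj_hom|exact: centroid_conj_hom| |].
  by move=> c; apply: cval_inj => x; rewrite !centroid_conjE !fK.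
by move=> c; apply: cval_inj => x; rewrite !centroid_conjE !f'K.
Qed.

Lemma giso_graded_central_simple (A B : galgebra F G) :
  giso A B -> graded_central_simple A -> graded_central_simple B.
Proof.
move=> /giso_graded_inverses [f [f' ff']] [sA cA].
split; first exact: graded_inverses_graded_simple ff' sA.
move=> c cC c0; have f'f := graded_inverses_sym ff'; have [_ _ _ f'K] := ff'.
have [a aE] := cA _ (conj_is_centroid f'f cC) (conj_deg f'f c0).
exists a => x; rewrite -[LHS]f'K -{1}[x]f'K -[f' _]/(conj_fun f' f c (f' x)) aE linearZZ.
by rewrite f'K.
Qed.
End GisoTransport.

Section Twist.
Variables (F : fieldType) (G : zmodType) (A : galgebra F G).
Implicit Types t : G -> G -> F.

Section AnyCochain.
Variable t : G -> G -> F.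

Let twist_row g x : gcar A -> gcar A := glue (fun h => t g h \*: gmul A x).

Let twist_row_linear g y : linear (fun x => twist_row g x y).
Proof.
move=> a x x'; rewrite /twist_row /glue scaler_sumr -big_split; apply: eq_bigr => h _ /=.
by rewrite gmulDl gmulZl scalerDr !scalerA mulrC.
Qed.

Let twist_phi y g := linear_pack (twist_row_linear g y).

Let twistE x y : gmul (twist A t) x y = glue (twist_phi y) x.
Proof. by rewrite glue_gdec; apply: eq_bigr => g _; rewrite /= /twist_row glue_gdec. Qed.

Lemma twist_gmul g h x y : x \in gcomp A g -> y \in gcomp A h ->
  gmul (twist A t) x y = t g h *: gmul A x y.
Proof.
by move=> xg yh; rewrite twistE (glue_homog _ xg) /= /twist_row (glue_homog _ yh).
Qed.

Lemma twist_galg : is_galg (twist A t).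
Proof.
have [_ grA] := galgP A; split.
  split=> a x y z; rewrite !twistE; first exact: linearP.
  rewrite /glue scaler_sumr -big_split; apply: eq_bigr => g _ /=; exact: linearP.
case: grA => [sub [sum [direct mul]]]; do 3 split=> //.
by move=> g h x y xg yh; rewrite (twist_gmul xg yh) rpredZ ?mem_gmul.
Qed.
Canonical twist_galgebra := GAlgebra twist_galg.
End AnyCochain.

Lemma twist_homog_ext t (V : lmodType F) (f1 f2 : {linear gcar (twist A t) -> V}) :
  (forall g x, x \in gcomp A g -> f1 x = f2 x) -> f1 =1 f2.
Proof. exact: (@linear_homog_ext _ _ (twist_galgebra t)). Qed.

Section NonzeroCochain.
Variable t : G -> G -> F.
Hypothesis t0 : forall a b, t a b != 0.

Lemma gmul_twist g h x y : x \in gcomp A g -> y \in gcomp A h ->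
  gmul A x y = (t g h)^-1 *: gmul (twist A t) x y.
Proof. by move=> xg yh; rewrite (twist_gmul _ xg yh) scalerA mulVf ?scale1r. Qed.

Lemma twist_graded_simple : graded_simple A -> graded_simple (twist A t).
Proof.
move=> sA; have [nzA [sqA _]] := sA; apply: (@graded_simple_intro _ _ (twist_galgebra t)) => //.
  apply: (@sq_full_intro _ _ (twist_galgebra t)) => Q Qlin Qmul; apply: (sq_full_ind sqA) => //.
  move=> g h x y xg yh; rewrite (gmul_twist xg yh).
  exact: (lincomb_closedZ Qlin) (Qmul x y).
move=> I [[_ Ilin] Imul] Iproj x0 x0I x0n.
apply: (@graded_simple_ind _ _ A (fun x => x \in I) x0 sA) => // g h x y xg xI yh.
rewrite (gmul_twist xg yh) (gmul_twist yh xg).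
by have [xyI yxI] := Imul x y xI; split; apply: (lincomb_closedZ Ilin).
Qed.

Lemma twist_graded_central : graded_central A -> graded_central (twist A t).
Proof.
move=> cA c [cL cM] c0; apply: cA => //.
pose lc : {linear gcar A -> gcar A} := linear_pack cL.
apply: (is_centroid_homog (c := lc)) => g h x y xg yh /=.
have cxg : c x \in gcomp A g by rewrite -[g]add0r c0.
have cyh : c y \in gcomp A h by rewrite -[h]add0r c0.
have cZ a z : c (a *: z) = a *: c z by exact: (linearZZ lc).
rewrite (gmul_twist xg yh) cZ (gmul_twist cxg yh) (gmul_twist xg cyh).
by rewrite {1}(cM x y).1 (cM x y).2.
Qed.
End NonzeroCochain.

Section Cocycle.
Variable t : G -> G -> F.
Hypothesis tZ : sym2cocycle t.

Lemma twist_graded_central_simple : graded_central_simple A -> graded_central_simple (twist A t).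
Proof.
have t0 a b := sym2cocycle_neq0 a b tZ.
by move=> [sA cA]; split; [apply: twist_graded_simple|apply: twist_graded_central].
Qed.

Lemma is_centroid_twist k (c c' : {linear gcar A -> gcar A}) :
  (forall g x, x \in gcomp A g -> c x \in gcomp A (k + g)) ->
  (forall g x, x \in gcomp A g -> c' x = t k g *: c x) ->
  is_centroid A c <-> is_centroid (twist A t) c'.
Proof.
move=> ck c'E; have c'k g x : x \in gcomp A g -> c' x \in gcomp A (k + g).
  by move=> xg; rewrite (c'E _ _ xg) rpredZ ?ck.
have c'M g h x y : x \in gcomp A g -> y \in gcomp A h ->
    let a := t g h * t k (g + h) in [/\ c' (gmul (twist A t) x y) = a *: c (gmul A x y),
      gmul (twist A t) (c' x) y = a *: gmul A (c x) y &
      gmul (twist A t) x (c' y) = a *: gmul A x (c y)].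
  move=> xg yh a; rewrite (twist_gmul t xg yh) (twist_gmul t (c'k _ _ xg) yh).
  rewrite (twist_gmul t xg (c'k _ _ yh)) linearZZ (c'E _ _ (mem_gmul xg yh)).
  rewrite (c'E _ _ xg) (c'E _ _ yh) gmulZl gmulZr !scalerA; split=> //; congr (_ *: _).
    by rewrite mulrC (sym2cocycleA _ _ _ tZ) mulrC.
  by rewrite mulrC (sym2cocycleCA _ _ _ tZ).
split=> [[_ cM]|[_ cM]].
  apply: (@is_centroid_homog _ _ (twist_galgebra t)).
  move=> g h x y xg yh; have [-> -> ->] := c'M g h x y xg yh.
  by have [e1 e2] := cM x y; rewrite {1}e1 e2.
apply: is_centroid_homog => g h x y xg yh.
have [e e1 e2] := c'M g h x y xg yh; have [c1 c2] := cM x y.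
have a0 : t g h * t k (g + h) != 0 by rewrite mulf_neq0 ?sym2cocycle_neq0.
by split; apply: (scalerI a0); rewrite -e -?e1 -?e2.
Qed.

Definition centroid_twist_fun k (c : gcar (centroid_alg A)) : gcar A -> gcar A :=
  glue (fun g => t k g \*: cval (centroid_proj k c)).

Lemma centroid_twist_subproof k c : is_centroid (twist A t) (centroid_twist_fun k c).
Proof.
have ck := mem_centroid_proj k c.
apply/(is_centroid_twist (k := k) (c := cval (centroid_proj k c))); last exact: cval_is_centroid.
  by move=> g x xg; apply: mem_cval.
by move=> g x xg; rewrite /= /centroid_twist_fun (glue_homog _ xg).
Qed.

(* A degree [k] element [c] of [C(A)] gives [x |-> t k g *: c x] on [A_g], in [C(A^t)]. *)
Definition centroid_twist k c : gcar (centroid_alg (twist A t)) :=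
  centroid_of (centroid_twist_subproof k c).

Lemma centroid_twist_proj k c g x : x \in gcomp A g ->
  cval (centroid_twist k c) x = t k g *: cval (centroid_proj k c) x.
Proof.
move=> xg; rewrite -[LHS]/(centroid_twist_fun k c x).
by rewrite /centroid_twist_fun (glue_homog _ xg).
Qed.

Lemma centroid_twistE k c g x : c \in gcomp (centroid_alg A) k -> x \in gcomp A g ->
  cval (centroid_twist k c) x = t k g *: cval c x.
Proof.
by move=> ck xg; rewrite (centroid_twist_proj _ _ xg) (centroid_projE _ _ xg) proj_id ?mem_cval.
Qed.

Lemma mem_centroid_twist k c : centroid_twist k c \in gcomp (centroid_alg (twist A t)) k.
Proof.
apply/centroid_degP => g x xg; rewrite (@centroid_twist_proj k c g x xg).
exact: rpredZ (mem_cval (mem_centroid_proj k c) _).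
Qed.

Lemma centroid_twist_is_linear k : linear (centroid_twist k).
Proof.
move=> a c d; apply: cval_inj; apply: twist_homog_ext => g x xg.
rewrite /= cvalZD !(centroid_twist_proj _ _ xg) !(centroid_projE _ _ xg) cvalZD linearP.
by rewrite scalerDr !scalerA mulrC.
Qed.
HB.instance Definition _ k := GRing.isLinear.Build F (gcar (centroid_alg A))
  (gcar (centroid_alg (twist A t))) *:%R (centroid_twist k) (centroid_twist_is_linear k).

Lemma centroid_twist_gmul c d k l :
  c \in gcomp (centroid_alg A) k -> d \in gcomp (centroid_alg A) l ->
  gmul (centroid_alg (twist A t)) (centroid_twist k c) (centroid_twist l d) =
    t k l *: centroid_twist (k + l) (gmul (centroid_alg A) c d).
Proof.
move=> ck dl; apply: cval_inj; apply: twist_homog_ext => g x xg /=.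
rewrite cval_gmul cvalZ (centroid_twistE dl xg) linearZZ /= (centroid_twistE ck (mem_cval dl xg)).
rewrite (centroid_twistE (mem_centroid_gmul ck dl) xg) cval_gmul !scalerA; congr (_ *: _).
by rewrite mulrC -(sym2cocycleA _ _ _ tZ).
Qed.

Lemma centroid_twist_inj k c : c \in gcomp (centroid_alg A) k -> centroid_twist k c = 0 -> c = 0.
Proof.
move=> ck c0; apply: cval_inj; apply: linear_homog_ext => g x xg.
apply: (scalerI (sym2cocycle_neq0 k g tZ)); rewrite /= -(centroid_twistE ck xg) c0.
by rewrite scaler0.
Qed.

Lemma centroid_twist_surj k d : d \in gcomp (centroid_alg (twist A t)) k ->
  exists2 c, c \in gcomp (centroid_alg A) k & centroid_twist k c = d.
Proof.
move=> dk; pose T := twist_galgebra t.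
pose c : {linear gcar A -> gcar A} :=
  (glue (fun g => (t k g)^-1 \*: cval d) : {linear gcar T -> gcar T}).
have cE g x : x \in gcomp A g -> c x = (t k g)^-1 *: cval d x by exact: (@glue_homog _ _ T).
have dE g x : x \in gcomp A g -> cval d x = t k g *: c x.
  by move=> xg; rewrite (cE _ _ xg) scalerA divff ?scale1r ?sym2cocycle_neq0.
have c_deg g x : x \in gcomp A g -> c x \in gcomp A (k + g).
  by move=> xg; rewrite (cE _ _ xg) rpredZ ?(mem_cval dk).
have [_ /(_ (cval_is_centroid d)) cC] :=
  @is_centroid_twist k c (cval d : {linear gcar T -> gcar T}) c_deg dE.
have ck := mem_centroid_of cC c_deg; exists (centroid_of cC) => //.
apply: cval_inj; apply: twist_homog_ext => g x xg.
by rewrite /= (centroid_twistE ck xg) (dE _ _ xg).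
Qed.
End Cocycle.
End Twist.

Section TwistIso.
Variables (F : fieldType) (G : zmodType).
Implicit Types (A B : galgebra F G) (t : G -> G -> F).

Lemma giso_centroid_twist A t : sym2cocycle t -> graded_simple A ->
  giso (twist (centroid_alg A) t) (centroid_alg (twist A t)).
Proof.
move=> tZ sA; have t0 a b := sym2cocycle_neq0 a b tZ.
pose CA := GAlgebra (centroid_alg_galg sA).
pose CT := GAlgebra (@centroid_alg_galg _ _ (twist_galgebra A t) (twist_graded_simple t0 sA)).
apply: (@giso_intro _ _ (twist_galgebra CA t) CT (fun k => centroid_twist tZ k)).
- by move=> k c _; apply: mem_centroid_twist.
- by move=> k c; apply: centroid_twist_inj.
- by move=> k d; apply: centroid_twist_surj.
move=> k l c d ck dl; rewrite (twist_gmul (A := CA) _ ck dl) linearZZ /=.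
exact/esym/centroid_twist_gmul.
Qed.

Lemma giso_cohomologous A t1 t2 : cohomologous t1 t2 -> giso (twist A t1) (twist A t2).
Proof.
move=> [gam [gam0 t12]]; suff gamM g h x y : x \in gcomp A g -> y \in gcomp A h ->
    gam (g + h) *: gmul (twist A t1) x y = (gam g * gam h) *: gmul (twist A t2) x y.
  exact: (giso_rescale (twist_galg A t1) (twist_galg A t2) gam0 gamM).
move=> xg yh; rewrite !(twist_gmul _ xg yh) t12 !scalerA; congr (_ *: _); field.
exact: gam0.
Qed.

Lemma giso_twist_twist A t1 t2 :
  giso (twist (twist A t1) t2) (twist A (fun a b => t1 a b * t2 a b)).
Proof.
pose A1 := twist_galgebra A t1; pose t12 a b := t1 a b * t2 a b.
suff eqM g h x y : x \in gcomp A g -> y \in gcomp A h ->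
    gmul (twist A1 t2) x y = gmul (twist A t12) x y.
  exact: (giso_eq_gmul (twist_galg A1 t2) (twist_galg A t12) eqM).
move=> xg yh; rewrite (twist_gmul (A := A1) _ xg yh) !(twist_gmul _ xg yh).
by rewrite scalerA mulrC.
Qed.

Lemma giso_twist1 A : giso (twist A (fun _ _ => 1)) A.
Proof.
case: A => [[V m P] galgA]; pose A := GAlgebra galgA.
suff eqM g h x y : x \in gcomp A g -> y \in gcomp A h ->
    gmul (twist A (fun _ _ => 1)) x y = gmul A x y.
  exact: (giso_eq_gmul (twist_galg A _) galgA eqM).
by move=> xg yh; rewrite (twist_gmul _ xg yh) scale1r.
Qed.

Lemma giso_twistV A t : (forall a b, t a b != 0) ->
  giso (twist (twist A t) (fun a b => (t a b)^-1)) A.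
Proof.
move=> t0; apply: giso_trans (giso_twist_twist A t _) _; apply: giso_trans (giso_twist1 A).
apply: giso_cohomologous; exists (fun=> 1); split=> [a|a b]; first exact: oner_neq0.
by rewrite divff // invr1 !mulr1.
Qed.

Lemma giso_twist A B t : giso A B -> giso (twist A t) (twist B t).
Proof.
have homT (X Y : galgebra F G) (f : {linear gcar X -> gcar Y}) :
    @graded_hom _ _ X Y f -> @graded_hom _ _ (twist X t) (twist Y t) f.
  move=> [_ fM fA]; apply: (@graded_hom_homog _ _ (twist_galgebra X t) (twist_galgebra Y t)) => //.
  move=> g h x y xg yh; rewrite (twist_gmul (A := X) _ xg yh).
  by rewrite (twist_gmul (A := Y) _ (fA _ _ xg) (fA _ _ yh)) linearZZ fM.
move=> /giso_graded_inverses [f [f' [homf homf' fK f'K]]].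
by apply: (@graded_inverses_giso _ _ (twist A t) (twist B t) f f'); split=> //; apply: homT.
Qed.
End TwistIso.

(* The subalgebra [(+)_g P_g (x) g] of [V (x) FG], for a product [m] mapping [P_g x P_h] to
   [P_(g+h)]. Both [loop] and [grpalg] have this form. *)
Section FinitelySupported.
Variables (F : fieldType) (G : zmodType) (V : lmodType F).
Variables (P : G -> pred V) (pr : G -> {linear V -> V}) (m : V -> V -> V).
Hypotheses (prP : forall g v, pr g v \in P g) (pr_id : forall g v, v \in P g -> pr g v = v).
Hypotheses (mL : forall w, linear (m^~ w)) (mR : forall v, linear (m v)).
Hypothesis mP : forall g h v w, v \in P g -> w \in P h -> m v w \in P (g + h).

Variables (gen : pred (funT G V)) (comp : G -> pred (spanT gen)).
Hypothesis genP : forall f, f \in gen <-> exists g v, v \in P g /\ f = fdelta g v.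
Hypothesis compP : forall g x, x \in comp g <->
  (forall k, k != g -> sp_val x k = 0) /\ sp_val x g \in P g.

Definition finsupp (f : funT G V) := exists s : seq G, forall g, f g != 0 -> g \in s.

Let P_submod g : submod_closed (P g).
Proof.
split=> [|a u v uP vP]; first by rewrite -(linear0 (pr g)) prP.
by rewrite -(pr_id uP) -(pr_id vP) -linearP prP.
Qed.
HB.instance Definition _ g :=
  GRing.isSubmodClosed.Build F V (P g) (GRing.submod_closed_semi (P_submod g)).

Let m0l w : m 0 w = 0. Proof. exact: (linear0 (linear_pack (mL w))). Qed.
Let m0r v : m v 0 = 0. Proof. exact: (linear0 (linear_pack (mR v))). Qed.

Let m_suml s (f : G -> V) w : m (\sum_(g <- s) f g) w = \sum_(g <- s) m (f g) w.
Proof. exact: (linear_sum (linear_pack (mL w))). Qed.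
Let m_sumr s (f : G -> V) v : m v (\sum_(g <- s) f g) = \sum_(g <- s) m v (f g).
Proof. exact: (linear_sum (linear_pack (mR v))). Qed.

Lemma fsuppP (f : funT G V) : finsupp f -> uniq (fsupp f) /\ forall g, f g != 0 -> g \in fsupp f.
Proof.
rewrite /fsupp => fin; case: excluded_middle_informative => // ex.
split=> [|g]; first exact: undup_uniq.
by rewrite mem_undup; case: constructive_indefinite_description => s; apply.
Qed.

Lemma funT_sumE (I : Type) (r : seq I) (f : I -> funT G V) k :
  (\sum_(i <- r) f i) k = \sum_(i <- r) f i k.
Proof. by elim: r => [|i r IH]; rewrite ?big_nil ?big_cons //= -IH. Qed.

Lemma fdeltaE (g k : G) (v : V) : fdelta g v k = if k == g then v else 0. Proof. by []. Qed.

Lemma mem_fun_span f : f \in spanP gen <-> finsupp f /\ forall g, f g \in P g.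
Proof.
split=> [|[[s fs] fP]].
  pose Q : pred (funT G V) := fun f => asbool (finsupp f /\ forall g, f g \in P g).
  rewrite unfold_in => /asboolP spanf; suff /asboolP : f \in Q by [].
  apply: spanf => [|a x y /asboolP [[s xs] xP] /asboolP [[s' ys'] yP]|f' /genP [g [v [vP ->]]]].
  - by apply/asboolP; split=> [|g]; [exists [::] => g; rewrite eqxx|apply: rpred0].
  - apply/asboolP; split=> [|g]; last exact: (P_submod g).2.
    exists (s ++ s') => g; rewrite mem_cat -[X in X != 0]/(a *: x g + y g).
    by have [->|/xs ->//] := eqVneq (x g) 0; rewrite scaler0 add0r orbC => /ys' ->.
  apply/asboolP; split=> [|k]; last by rewrite fdeltaE; case: eqP => [->|_] //; apply: rpred0.
  by exists [:: g] => k; rewrite fdeltaE inE; case: (k =P g) => //; rewrite eqxx.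
have -> : f = \sum_(g <- undup s) fdelta g (f g).
  apply: functional_extensionality => k; rewrite funT_sumE.
  rewrite (eq_bigr (fun g => if g == k then f g else 0)) => [|g _].
    by rewrite big_pred1_uniq ?undup_uniq // => /fs; rewrite mem_undup.
  by rewrite fdeltaE eq_sym.
apply: rpred_sum => g _; apply/asboolP => Q _ _; apply.
by apply/genP; exists g, (f g).
Qed.

Definition coef g (x : spanT gen) : V := sp_val x g.
Arguments coef : simpl never.

Lemma coef_is_linear g : linear (coef g). Proof. by []. Qed.
HB.instance Definition _ g :=
  GRing.isLinear.Build F (spanT gen) V *:%R (coef g) (coef_is_linear g).

Lemma coefZD g a x y : coef g (a *: x + y) = a *: coef g x + coef g y. Proof. by []. Qed.

Lemma coef_inj (x y : spanT gen) : (forall g, coef g x = coef g y) -> x = y.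
Proof. by move=> xy; apply/val_inj/functional_extensionality. Qed.

Lemma mem_coef g x : coef g x \in P g.
Proof. by have /mem_fun_span [_] := sp_valP x; apply. Qed.

Definition csupp (x : spanT gen) : seq G := fsupp (sp_val x).

Lemma csupp_uniq x : uniq (csupp x).
Proof. by have /mem_fun_span [/fsuppP []] := sp_valP x. Qed.

Lemma mem_csupp g x : coef g x != 0 -> g \in csupp x.
Proof. by have /mem_fun_span [/fsuppP [_ xs] _] := sp_valP x; apply: xs. Qed.

Lemma mem_single g v : fdelta g (pr g v) \in spanP gen.
Proof. by apply/asboolP => Q _ _; apply; apply/genP; exists g, (pr g v). Qed.

Definition single g v : spanT gen := SpanT (mem_single g v).

Lemma coef_single k g v : coef k (single g v) = if k == g then pr g v else 0.
Proof. by []. Qed.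

Lemma single_is_linear g : linear (single g).
Proof.
move=> a u v; apply: coef_inj => k; rewrite linearP /= !coef_single linearP.
by case: ifP => //; rewrite scaler0 addr0.
Qed.
HB.instance Definition _ g :=
  GRing.isLinear.Build F V (spanT gen) *:%R (single g) (single_is_linear g).

Definition aug x : V := \sum_(g <- csupp x) coef g x.

Lemma aug_sum s x : uniq s -> (forall g, coef g x != 0 -> g \in s) ->
  aug x = \sum_(g <- s) coef g x.
Proof.
by move=> us xs; apply: big_uniq_support; rewrite ?csupp_uniq // => g; apply: mem_csupp.
Qed.

Lemma aug_is_linear : linear aug.
Proof.
move=> a x y; pose S := undup (csupp (a *: x + y) ++ csupp x ++ csupp y).
have augS z : {subset csupp z <= S} -> aug z = \sum_(g <- S) coef g z.
  by move=> zS; apply: aug_sum => [|g /mem_csupp /zS //]; apply: undup_uniq.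
rewrite !augS => [|g gs|g gs|g gs]; try by rewrite mem_undup !mem_cat gs ?orbT.
by rewrite scaler_sumr -big_split; apply: eq_bigr => g _; rewrite linearP.
Qed.
HB.instance Definition _ := GRing.isLinear.Build F (spanT gen) V *:%R aug aug_is_linear.

Lemma comp_single g x : x \in comp g -> x = single g (coef g x).
Proof.
move=> /compP [x0 _]; apply: coef_inj => k; rewrite coef_single (pr_id (mem_coef g x)).
by case: eqP => [->|/eqP /x0].
Qed.

Lemma aug_comp g x : x \in comp g -> aug x = coef g x.
Proof.
move=> /compP [x0 _]; rewrite (@aug_sum [:: g]) ?big_seq1 // => k.
by rewrite inE; apply: contraNT => /x0 /eqP.
Qed.

Lemma single_in_comp g v : single g v \in comp g.
Proof.
apply/compP; split=> [k /negbTE kg|]; last exact: (mem_coef g (single g v)).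
by rewrite -[LHS]/(coef k (single g v)) coef_single kg.
Qed.

Lemma single_aug g x : x \in comp g -> single g (aug x) = x.
Proof. by move=> xg; rewrite (aug_comp xg) -comp_single. Qed.

Lemma aug_single g v : v \in P g -> aug (single g v) = v.
Proof. by move=> vP; rewrite (aug_comp (single_in_comp g v)) coef_single eqxx pr_id. Qed.

Lemma mem_aug g x : x \in comp g -> aug x \in P g.
Proof. by move=> /aug_comp ->; apply: mem_coef. Qed.

Definition funalg : galg F G :=
  GAlg (fun x y => insubd 0 (conv m (sp_val x) (sp_val y))) comp.

Lemma conv_eq (x y : spanT gen) s k : uniq s -> (forall g, coef g x != 0 -> g \in s) ->
  conv m (sp_val x) (sp_val y) k = \sum_(g <- s) m (coef g x) (coef (k - g) y).
Proof.
move=> us xs; rewrite /conv -!/(csupp _).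
transitivity (\sum_(g <- csupp x) m (coef g x) (coef (k - g) y)); last first.
  apply: big_uniq_support => // [|g|g]; first exact: csupp_uniq.
    by have [e|/mem_csupp //] := eqVneq (coef g x) 0; rewrite e m0l eqxx.
  by have [e|/xs //] := eqVneq (coef g x) 0; rewrite e m0l eqxx.
apply: eq_bigr => g _.
rewrite -[RHS](@big_pred1_uniq _ _ (csupp y) (k - g) (fun h => m (coef g x) (coef h y))).
- by apply: eq_bigr => h _; rewrite -(inj_eq (addrI g)) addrCA subrr addr0.
- exact: csupp_uniq.
by have [->|/mem_csupp //] := eqVneq (coef (k - g) y) 0; rewrite m0r eqxx.
Qed.

Lemma conv_supp (x y : spanT gen) k : conv m (sp_val x) (sp_val y) k != 0 ->
  k \in [seq g + h | g <- csupp x, h <- csupp y].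
Proof.
rewrite (conv_eq _ _ (csupp_uniq x) (fun g => @mem_csupp g x)); apply: contraNT => kxy.
rewrite big_seq big1 // => g gx; have [->|/mem_csupp hy] := eqVneq (coef (k - g) y) 0.
  by rewrite m0r.
by case/negP: kxy; apply/allpairsP; exists (g, k - g); rewrite subrKC.
Qed.

Lemma conv_in_span (x y : spanT gen) : conv m (sp_val x) (sp_val y) \in spanP gen.
Proof.
apply/mem_fun_span; split=> [|k].
  by exists [seq g + h | g <- csupp x, h <- csupp y] => k; apply: conv_supp.
rewrite (conv_eq _ _ (csupp_uniq x) (fun g => @mem_csupp g x)); apply: rpred_sum => g _.
by have := mP (mem_coef g x) (mem_coef (k - g) y); rewrite subrKC.
Qed.

Lemma sp_val_gmul (x y : gcar funalg) : sp_val (gmul funalg x y) = conv m (sp_val x) (sp_val y).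
Proof. exact: (insubdK (0 : spanT gen) (conv_in_span x y)). Qed.

Lemma coef_gmul (x y : gcar funalg) s k : uniq s -> (forall g, coef g x != 0 -> g \in s) ->
  coef k (gmul funalg x y) = \sum_(g <- s) m (coef g x) (coef (k - g) y).
Proof. by move=> us xs; rewrite /coef sp_val_gmul (conv_eq _ _ us xs). Qed.

Lemma aug_gmul (x y : gcar funalg) : aug (gmul funalg x y) = m (aug x) (aug y).
Proof.
pose S := undup [seq g + h | g <- csupp x, h <- csupp y].
rewrite (@aug_sum S) ?undup_uniq => [|//|k]; last first.
  by rewrite /coef sp_val_gmul mem_undup; apply: conv_supp.
rewrite (eq_bigr _ (fun k _ => coef_gmul y k (csupp_uniq x) (fun g => @mem_csupp g x))).
rewrite exchange_big [aug x]/aug m_suml; apply: eq_big_seq => g gx /=.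
rewrite [aug y](@aug_sum [seq k - g | k <- S]) => [||h hy].
- by rewrite big_map m_sumr.
- by rewrite map_inj_uniq ?undup_uniq //; apply: addIr.
apply/mapP; exists (g + h); last by rewrite addrC addKr.
by rewrite mem_undup; apply: allpairs_f => //; apply: mem_csupp.
Qed.

Lemma funalg_bilinear : bilinear_mul funalg.
Proof.
split=> a x y z; apply: coef_inj => k; rewrite coefZD.
  pose S := undup (csupp (a *: x + y) ++ csupp x ++ csupp y).
  have gmulS u : {subset csupp u <= S} ->
      coef k (gmul funalg u z) = \sum_(g <- S) m (coef g u) (coef (k - g) z).
    by move=> uS; apply: coef_gmul => [|g /mem_csupp /uS //]; apply: undup_uniq.
  rewrite !gmulS => [|g gs|g gs|g gs]; try by rewrite mem_undup !mem_cat gs ?orbT.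
  by rewrite scaler_sumr -big_split; apply: eq_bigr => g _; rewrite linearP /= mL.
rewrite !(coef_gmul _ _ (csupp_uniq z) (fun g => @mem_csupp g z)) scaler_sumr -big_split.
by apply: eq_bigr => g _; rewrite linearP /= mR.
Qed.

Lemma funalg_grading : is_grading funalg.
Proof.
split=> [g|]; first split=> [|a x y /compP [x0 xg] /compP [y0 yg]].
- by apply/compP; split=> [k _|] //; apply: (P_submod g).1.
- apply/compP; split=> [k kg|]; last exact: (P_submod g).2.
  by rewrite -[LHS]/(a *: sp_val x k + sp_val y k) x0 // y0 // scaler0 addr0.
split=> [x|].
  exists (csupp x), (fun g => single g (coef g x)); split=> [g|]; first exact: single_in_comp.
  apply: coef_inj => k; rewrite linear_sum /=.
  rewrite (eq_bigr (fun g => if g == k then coef g x else 0)) => [|g _].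
    by rewrite big_pred1_uniq ?csupp_uniq //; apply: mem_csupp.
  by rewrite coef_single eq_sym (pr_id (mem_coef g x)).
split=> [s f us fA f0 g gs|g h x y xg yh].
  rewrite (comp_single (fA g)); have := congr1 (coef g) f0; rewrite linear_sum linear0 /=.
  rewrite (eq_bigr (fun k => if k == g then coef k (f k) else 0)) => [|k _].
    by rewrite big_pred1_uniq // => ->; rewrite linear0.
  have /compP [fk0 _] := fA k; case: eqP => [->|/eqP kg] //.
  by apply: fk0; rewrite eq_sym.
have coefxy k : coef k (gmul funalg x y) = m (coef g x) (coef (k - g) y).
  rewrite (@coef_gmul _ _ [:: g]) ?big_seq1 // => l.
  by rewrite inE; apply: contraNT; have /compP [x0 _] := xg => /x0 /eqP.
have /compP [y0 yP] := yh; apply/compP; split=> [k kgh|].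
  rewrite -[LHS]/(coef k (gmul funalg x y)) coefxy [coef _ y]y0 ?m0r //.
  by apply: contraNneq kgh => <-; rewrite subrKC.
rewrite -[X in X \in _]/(coef (g + h) (gmul funalg x y)) coefxy.
by rewrite (_ : g + h - g = h) ?mP ?mem_coef // addrC addKr.
Qed.

Lemma funalg_galg : is_galg funalg.
Proof. by split; [apply: funalg_bilinear|apply: funalg_grading]. Qed.
End FinitelySupported.

(** * Loop algebras *)

Section LoopAlgebra.
Variables (F : fieldType) (G Gb : zmodType) (pi : {additive G -> Gb}) (A : galgebra F Gb).
Local Notation L := (loop pi A).

Let P (g : G) : pred (gcar A) := gcomp A (pi g).
Let pr (g : G) : {linear gcar A -> gcar A} := proj A (pi g).
Let prP g v : pr g v \in P g. Proof. exact: mem_proj. Qed.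
Let pr_id g v : v \in P g -> pr g v = v. Proof. exact: proj_id. Qed.
Let mL w : linear ((gmul A)^~ w). Proof. exact: (linearP (gmulr w)). Qed.
Let mR v : linear (gmul A v). Proof. exact: linearP. Qed.
Let mP g h v w : v \in P g -> w \in P h -> gmul A v w \in P (g + h).
Proof. by rewrite /P raddfD; apply: mem_gmul. Qed.
Let genP f : f \in loop_gen pi A <-> exists g v, v \in P g /\ f = fdelta g v.
Proof. by split=> [/asboolP|?] //; apply/asboolP. Qed.
Let compP g (x : loop_car pi A) : x \in loop_comp pi A g <->
  (forall k, k != g -> sp_val x k = 0) /\ sp_val x g \in P g.
Proof. by split=> [/asboolP|?] //; apply/asboolP. Qed.

Lemma loop_galg : is_galg L.
Proof. exact: (funalg_galg prP pr_id mL mR mP genP compP). Qed.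
Canonical loop_galgebra := GAlgebra loop_galg.

(* [v (x) g], after projecting [v] to [A_(pi g)]. *)
Definition loop_elt g : gcar A -> gcar L := single prP genP g.
HB.instance Definition _ g := GRing.Linear.on (loop_elt g).

(* The algebra homomorphism [v (x) g |-> v]. *)
Definition loop_aug : gcar L -> gcar A := @aug F G (gcar A) (loop_gen pi A).
HB.instance Definition _ :=
  GRing.isLinear.Build F (gcar L) (gcar A) *:%R loop_aug (aug_is_linear prP pr_id genP).

Lemma mem_loop_elt g v : loop_elt g v \in gcomp L g. Proof. exact: single_in_comp. Qed.

Lemma mem_loop_aug g x : x \in gcomp L g -> loop_aug x \in gcomp A (pi g).
Proof. exact: (mem_aug prP pr_id genP compP). Qed.

Lemma loop_elt_aug g x : x \in gcomp L g -> loop_elt g (loop_aug x) = x.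
Proof. exact: (single_aug prP pr_id genP compP). Qed.

Lemma loop_aug_elt g v : v \in gcomp A (pi g) -> loop_aug (loop_elt g v) = v.
Proof. exact: (aug_single prP pr_id genP compP). Qed.

Lemma loop_aug_gmul x y : loop_aug (gmul L x y) = gmul A (loop_aug x) (loop_aug y).
Proof. exact: (aug_gmul prP pr_id mL mR mP (comp := loop_comp pi A) genP). Qed.

Lemma loop_elt_proj g v : loop_elt g (proj A (pi g) v) = loop_elt g v.
Proof. by apply/val_inj; rewrite /= /pr (proj_id (mem_proj _ _)). Qed.

Lemma loop_elt_out g a v : v \in gcomp A a -> a != pi g -> loop_elt g v = 0.
Proof. by move=> va ag; rewrite -loop_elt_proj (proj_neq va ag) linear0. Qed.

Lemma loop_aug_inj g x y : x \in gcomp L g -> y \in gcomp L g -> loop_aug x = loop_aug y -> x = y.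
Proof. by move=> /loop_elt_aug {2}<- /loop_elt_aug {2}<- ->. Qed.

Lemma loop_elt_gmul g h v w : v \in gcomp A (pi g) -> w \in gcomp A (pi h) ->
  loop_elt (g + h) (gmul A v w) = gmul L (loop_elt g v) (loop_elt h w).
Proof.
move=> vg wh; have vwL := mem_gmul (mem_loop_elt g v) (mem_loop_elt h w).
by rewrite -(loop_elt_aug vwL) loop_aug_gmul !loop_aug_elt.
Qed.

Lemma loop_elt_neq0 g v : v \in gcomp A (pi g) -> v != 0 -> loop_elt g v != 0.
Proof. by move=> vg; apply: contraNneq => e; rewrite -(loop_aug_elt vg) e linear0. Qed.

Definition loop_lift_fun k (d : gcar (centroid_alg A)) : gcar L -> gcar L :=
  glue (fun g => loop_elt (k + g) \o cval d \o loop_aug).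

Lemma loop_lift_fun_homog k d g x : x \in gcomp L g ->
  loop_lift_fun k d x \in gcomp L (k + g) /\
  loop_aug (loop_lift_fun k d x) = cval (centroid_proj (pi k) d) (loop_aug x).
Proof.
move=> xg; rewrite /loop_lift_fun (glue_homog _ xg) /=; split; first exact: mem_loop_elt.
rewrite -loop_elt_proj loop_aug_elt ?mem_proj // raddfD /=.
by rewrite (centroid_projE _ _ (mem_loop_aug xg)).
Qed.

Lemma loop_lift_is_centroid k d : is_centroid L (loop_lift_fun k d).
Proof.
apply: is_centroid_homog => g h x y xg yh /=.
have [xd xdE] := loop_lift_fun_homog k d xg; have [yd ydE] := loop_lift_fun_homog k d yh.
have [xyd xydE] := loop_lift_fun_homog k d (mem_gmul xg yh).
split; apply: (loop_aug_inj xyd).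
- by rewrite addrA mem_gmul.
- by rewrite xydE !loop_aug_gmul xdE cval_mull.
- by rewrite addrCA mem_gmul.
- by rewrite xydE !loop_aug_gmul ydE cval_mulr.
Qed.

(* The centroid element [v (x) g |-> d v (x) (k + g)] of degree [k], for [d] of degree [pi k]. *)
Definition loop_lift k d : gcar (centroid_alg L) := centroid_of (loop_lift_is_centroid k d).

Lemma mem_loop_lift k d : loop_lift k d \in gcomp (centroid_alg L) k.
Proof. by apply: mem_centroid_of => g x xg; have [] := loop_lift_fun_homog k d xg. Qed.

Lemma loop_aug_lift k d x : d \in gcomp (centroid_alg A) (pi k) ->
  loop_aug (cval (loop_lift k d) x) = cval d (loop_aug x).
Proof.
move=> dk; rewrite -[LHS]/((loop_aug \o cval (loop_lift k d)) x) -[RHS]/((cval d \o loop_aug) x).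
move: x; apply: linear_homog_ext => g x xg /=; have [_ liftE] := loop_lift_fun_homog k d xg.
by rewrite [LHS]liftE (centroid_projE _ _ (mem_loop_aug xg)) proj_id ?mem_cval ?mem_loop_aug.
Qed.

Definition loop_shift k := loop_lift k (centroid_of (centroid_id A)).

Lemma mem_loop_shift k : loop_shift k \in gcomp (centroid_alg L) k.
Proof. exact: mem_loop_lift. Qed.

Lemma loop_aug_shift k x : pi k = 0 -> loop_aug (cval (loop_shift k) x) = loop_aug x.
Proof. by move=> k0; apply: loop_aug_lift; apply: mem_centroid_of => g v; rewrite k0 add0r. Qed.

Lemma loop_shift_out k : pi k != 0 -> loop_shift k = 0.
Proof.
move=> k0; apply: cval_inj; apply: linear_homog_ext => g x xg; rewrite [RHS]cval0 /=.
have xk : cval (loop_shift k) x \in gcomp L (k + g) by apply: mem_cval xg; apply: mem_loop_shift.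
apply: (loop_aug_inj xk (rpred0 _)); rewrite linear0.
have [_ ->] := loop_lift_fun_homog k (centroid_of (centroid_id A)) xg.
rewrite (centroid_projE _ _ (mem_loop_aug xg)) centroid_ofE (proj_neq (mem_loop_aug xg)) //.
by rewrite eq_sym -subr_eq0 addrK.
Qed.

Lemma loop_shift0 x : cval (loop_shift 0) x = x.
Proof.
move: x; apply: (linear_homog_ext (f2 := idfun)) => g x xg /=; apply: (loop_aug_inj _ xg).
  by rewrite -[g]add0r mem_cval ?mem_loop_shift.
by rewrite loop_aug_shift ?raddf0.
Qed.

Lemma loop_shift_gmul k l : pi k = 0 -> pi l = 0 ->
  gmul (centroid_alg L) (loop_shift k) (loop_shift l) = loop_shift (k + l).
Proof.
move=> k0 l0; apply: cval_inj; apply: linear_homog_ext => g x xg /=; rewrite cval_gmul.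
apply: (@loop_aug_inj (k + (l + g))).
- by do 2 apply: mem_cval (mem_loop_shift _) _.
- by rewrite addrA; apply: mem_cval xg; apply: mem_loop_shift.
by rewrite !loop_aug_shift // raddfD k0 l0 addr0.
Qed.
End LoopAlgebra.

Section LoopSection.
Variables (F : fieldType) (G Gb : zmodType) (pi : {additive G -> Gb}).
Variables (s : Gb -> G) (sK : cancel s pi).
Implicit Types A : galgebra F Gb.

Definition loop_sec A : gcar A -> gcar (loop pi A) := glue (fun a => @loop_elt _ _ _ pi A (s a)).
HB.instance Definition _ A := GRing.Linear.on (@loop_sec A).

Lemma loop_sec_homog A a v : v \in gcomp A a -> loop_sec v = loop_elt pi (s a) v.
Proof. exact: glue_homog. Qed.

Lemma loop_secK A : cancel (@loop_sec A) (@loop_aug _ _ _ pi A).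
Proof.
move=> v; rewrite -[LHS]/((loop_aug (A := A) \o @loop_sec A) v) -[RHS]/(idfun v).
move: v; apply: linear_homog_ext => a v va /=.
by rewrite (loop_sec_homog va) loop_aug_elt ?sK.
Qed.

Lemma loop_sec_aug A g x : x \in gcomp (loop pi A) g ->
  loop_sec (loop_aug x) = cval (loop_shift pi A (s (pi g) - g)) x.
Proof.
move=> xg; rewrite (loop_sec_homog (mem_loop_aug xg)).
apply: (@loop_aug_inj _ _ _ pi A (s (pi g))); first exact: mem_loop_elt.
  by rewrite -[X in gcomp _ X](subrK g); apply: mem_cval (mem_loop_shift _ _ _) xg.
rewrite loop_aug_shift ?raddfB /= ?sK ?subrr // loop_aug_elt // sK.
exact: mem_loop_aug.
Qed.

Lemma loop_lift_inj A k d : d \in gcomp (centroid_alg A) (pi k) -> loop_lift pi k d = 0 -> d = 0.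
Proof.
move=> dk d0; apply: cval_inj => v; rewrite -(loop_secK v) -(loop_aug_lift _ dk) d0.
by rewrite !cval0 linear0.
Qed.

Lemma loop_shift_neq0 A k : nonzero A -> pi k = 0 -> loop_shift pi A k != 0.
Proof.
move=> [v v0] k0; apply: contraNneq v0 => e.
by rewrite -(loop_secK v) -(loop_aug_shift _ k0) e cval0 linear0.
Qed.

Definition shift_equivariant A1 A2 (f : gcar (loop pi A1) -> gcar (loop pi A2)) := forall k x,
  pi k = 0 -> f (cval (loop_shift pi A1 k) x) = cval (loop_shift pi A2 k) (f x).

Section Descent.
Variables (A1 A2 : galgebra F Gb) (f : {linear gcar (loop pi A1) -> gcar (loop pi A2)}).
Hypothesis f_shift : shift_equivariant f.

Definition loop_descent : gcar A1 -> gcar A2 := @loop_aug _ _ _ pi A2 \o f \o @loop_sec A1.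
HB.instance Definition _ := GRing.Linear.on loop_descent.

Lemma loop_descent_aug x : loop_descent (loop_aug x) = loop_aug (f x).
Proof.
rewrite -[LHS]/((loop_descent \o @loop_aug _ _ _ pi A1) x) -[RHS]/((@loop_aug _ _ _ pi A2 \o f) x).
move: x; apply: linear_homog_ext => g x xg /=.
have k0 : pi (s (pi g) - g) = 0 by rewrite raddfB /= sK subrr.
by rewrite /loop_descent /= (loop_sec_aug xg) f_shift // loop_aug_shift.
Qed.

Lemma loop_descent_hom : graded_hom f -> graded_hom loop_descent.
Proof.
move=> [_ fM fA]; split=> [|u v|a v va]; first exact: linearP.
  by rewrite -(loop_secK u) -(loop_secK v) -loop_aug_gmul !loop_descent_aug fM loop_aug_gmul.
rewrite /loop_descent /= (loop_sec_homog va) -[X in gcomp _ X]sK.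
exact/mem_loop_aug/fA/mem_loop_elt.
Qed.
End Descent.

Lemma giso_loop_descent A1 A2 (f : {linear gcar (loop pi A1) -> gcar (loop pi A2)})
    (f' : {linear gcar (loop pi A2) -> gcar (loop pi A1)}) :
  graded_inverses f f' -> shift_equivariant f -> giso A1 A2.
Proof.
move=> [homf homf' fK f'K] f_shift; have f'_shift : shift_equivariant f'.
  by move=> k x k0; rewrite -{1}(f'K x) -f_shift // fK.
apply: (@graded_inverses_giso _ _ _ _ (loop_descent f) (loop_descent f')).
split; [exact: loop_descent_hom|exact: loop_descent_hom| |] => v.
  by rewrite -(loop_secK v) !loop_descent_aug // fK.
by rewrite -(loop_secK v) !loop_descent_aug // f'K.
Qed.

Lemma loop_sq_full A : sq_full A -> sq_full (loop pi A).
Proof.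
move=> sqA; apply: sq_full_intro => Q Qlin Qmul.
have Q0 : Q 0 by rewrite -(gmul0l (A := loop_galgebra pi A) 0).
have Qelt g v : Q (loop_elt pi g v).
  move: v; apply: (sq_full_ind sqA) => [a u v Qu Qv|a b u v ua vb].
    by rewrite linearP; apply: Qlin.
  have [abg|abg] := eqVneq (a + b) (pi g); last by rewrite (loop_elt_out (mem_gmul ua vb) abg).
  have eb : pi (g - s a) = b by rewrite raddfB /= sK -abg addrC addKr.
  by rewrite -[g](subrKC (s a)) loop_elt_gmul ?sK ?eb.
apply: homog_ind => // [x y|g x xg]; last by rewrite -(loop_elt_aug xg).
exact: lincomb_closedD.
Qed.

Section LoopIdeal.
Variables (A : galgebra F Gb) (I : pred (gcar (loop pi A))).
Hypothesis idI : is_ideal (loop pi A) I.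
Let I0 : 0 \in I := idI.1.1.

Definition ideal_coefs (v : gcar A) := forall g, loop_elt pi g v \in I.

Lemma ideal_coefs_gmul g h u w : u \in gcomp A (pi g) -> w \in gcomp A h -> loop_elt pi g u \in I ->
  ideal_coefs (gmul A u w) /\ ideal_coefs (gmul A w u).
Proof.
move=> ug wh uI; split=> k.
  have [gh|gh] := eqVneq (pi g + h) (pi k); last by rewrite (loop_elt_out (mem_gmul ug wh) gh).
  have eh : pi (k - g) = h by rewrite raddfB /= -gh addrC addKr.
  by rewrite -(subrKC g k) loop_elt_gmul ?eh //; have [] := idI.2 _ (loop_elt pi (k - g) w) uI.
have [gh|gh] := eqVneq (h + pi g) (pi k); last by rewrite (loop_elt_out (mem_gmul wh ug) gh).
have eh : pi (k - g) = h by rewrite raddfB /= -gh addrK.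
by rewrite -(subrK g k) loop_elt_gmul ?eh //; have [] := idI.2 _ (loop_elt pi (k - g) w) uI.
Qed.

Lemma ideal_coefs_full v : graded_simple A -> ideal_coefs v -> v != 0 -> forall x, x \in I.
Proof.
move=> sA Iv v0; suff IA u : ideal_coefs u.
  apply: homog_ind => [//|x y|g x xg]; first exact: (lincomb_closedD idI.1.2).
  by rewrite -(loop_elt_aug xg); apply: IA.
move: u; apply: (graded_simple_ind sA _ _ _ Iv v0) => [a u w Iu Iw g|a u Iu g|a h u w ua Iu wh].
- by rewrite linearP; apply: idI.1.2; [apply: Iu|apply: Iw].
- have [<-|ag] := eqVneq (pi g) a; first by rewrite loop_elt_proj.
  by rewrite (loop_elt_out (mem_proj a u)) // eq_sym.
- by apply: (ideal_coefs_gmul (g := s a) (h := h)); rewrite ?sK.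
Qed.
End LoopIdeal.

Lemma loop_graded_simple A : graded_simple A -> graded_simple (loop pi A).
Proof.
move=> sA; have [[v0 v0n] [sqA _]] := sA; apply: graded_simple_intro.
- have [a va] := proj_neq0 v0n; exists (loop_elt pi (s a) (proj A a v0)).
  by rewrite loop_elt_neq0 // sK mem_proj.
- exact: loop_sq_full.
move=> I idI Iproj x0 x0I /proj_neq0 [g]; set y := proj _ g x0 => y0.
have [yI yg] : y \in I /\ y \in gcomp (loop pi A) g by split; [apply: Iproj|apply: mem_proj].
have [[v [Iv vn]]|noI] := asboolP (exists v, ideal_coefs I v /\ v != 0).
  exact: ideal_coefs_full Iv vn.
have I_eq0 v : ideal_coefs I v -> v = 0.
  by move=> Iv; apply/eqP/contraT => vn; case: noI; exists v.
case/eqP: y0; rewrite -(loop_elt_aug yg) [loop_aug y](_ : _ = 0) ?linear0 //.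
apply: (graded_simple_nondegenerate sA) => h w wh.
have [|Iyw Iwy] := ideal_coefs_gmul (u := loop_aug y) idI (mem_loop_aug yg) wh.
  by rewrite loop_elt_aug.
by split; apply: I_eq0.
Qed.
End LoopSection.

Section LoopCentroid.
Variables (F : fieldType) (G Gb : zmodType) (pi : {additive G -> Gb}).
Variables (s : Gb -> G) (sK : cancel s pi) (A : galgebra F Gb).
Local Notation L := (loop pi A).
Local Notation lsec := (@loop_sec _ _ _ pi s A).

Lemma loop_centroid_descent (c : gcar (centroid_alg L)) : sq_full A ->
  exists d : gcar (centroid_alg A), forall x, loop_aug (cval c x) = cval d (loop_aug x).
Proof.
move=> sqA; have sqL := loop_sq_full sK sqA.
have c_shift : shift_equivariant (cval c).
  by move=> k x _; rewrite -!cval_gmul (centroid_gmulC _ _ sqL).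
pose d := loop_descent s (cval c).
have dE x : d (loop_aug x) = loop_aug (cval c x) by apply: (loop_descent_aug sK c_shift).
have dC : is_centroid A d.
  split=> [a u v|u v]; first exact: linearP.
  rewrite -(loop_secK sK u) -(loop_secK sK v) -loop_aug_gmul !dE -!loop_aug_gmul.
  by rewrite {1}cval_mull cval_mulr.
by exists (centroid_of dC) => x; rewrite centroid_ofE dE.
Qed.

Lemma loop_centroid_scalar (c : gcar (centroid_alg L)) k : central A -> sq_full A ->
  c \in gcomp (centroid_alg L) k -> exists a : F, c = a *: loop_shift pi A k.
Proof.
move=> cA /(loop_centroid_descent c) [d dE] ck.
have [a aE] := cA _ (cval_is_centroid d); exists a; apply: cval_inj; apply: linear_homog_ext.
move=> g x xg /=; have cxE : loop_aug (cval c x) = a *: loop_aug x by rewrite dE aE.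
have cx := mem_cval ck xg; rewrite cvalZ; apply: (loop_aug_inj cx).
  by rewrite rpredZ // (mem_cval (mem_loop_shift _ _ _)).
have [k0|k0] := eqVneq (pi k) 0; first by rewrite linearZZ /= loop_aug_shift.
rewrite (loop_shift_out _ k0) cval0 scaler0 linear0.
apply: (gcomp_disjoint (mem_loop_aug cx) (h := pi g)); first by rewrite cxE rpredZ ?mem_loop_aug.
by rewrite raddfD -subr_eq0 /= addrK.
Qed.

Lemma loop_graded_central_simple : central_simple A -> graded_central_simple L.
Proof.
move=> [simA cA]; have sA := simple_graded_simple simA; have [_ [sqA _]] := sA.
split; first exact: (loop_graded_simple sK).
move=> c cC c0; have := loop_centroid_scalar cA sqA (mem_centroid_of cC c0).
by move=> [a cE]; exists a => x; rewrite -[c]/(cval (centroid_of cC)) cE cvalZ loop_shift0.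
Qed.

Lemma loop_base_graded_simple : graded_simple L -> graded_simple A.
Proof.
move=> sL; have [[x0 x0n] [sqL _]] := sL; apply: graded_simple_intro.
- have [g gx] := proj_neq0 x0n; exists (loop_aug (proj L g x0)); apply: contraNneq gx => e.
  by rewrite -(loop_elt_aug (mem_proj g x0)) e linear0.
- apply: (sq_full_image (f := @loop_aug _ _ _ pi A)) sqL => [x y|v]; first exact: loop_aug_gmul.
  by exists (lsec v); apply: loop_secK.
move=> I [[I0 Ilin] Imul] Iproj v0 v0I v0n.
have [a va] := proj_neq0 v0n; pose Q (x : gcar L) := forall g, loop_aug (proj L g x) \in I.
have QL : forall x, Q x.
  apply: (graded_simple_ind (x0 := loop_elt pi (s a) (proj A a v0)) sL).
  - by move=> b x y Qx Qy g; rewrite !linearP; apply: Ilin; [apply: Qx|apply: Qy].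
  - by move=> g x Qx h; rewrite (proj_homog h (mem_proj g x)); case: ifP; rewrite ?linear0.
  - move=> g h x y xg Qx yh; have := Qx g; rewrite proj_id // => xI.
    have [xyI yxI] := Imul _ (loop_aug y) xI.
    split=> k; [rewrite (proj_homog k (mem_gmul xg yh))|rewrite (proj_homog k (mem_gmul yh xg))].
      by case: ifP; rewrite ?linear0 ?loop_aug_gmul.
    by case: ifP; rewrite ?linear0 ?loop_aug_gmul.
  - move=> g; rewrite (proj_homog g (mem_loop_elt _ _ _)); case: ifP; rewrite ?linear0 //.
    by rewrite loop_aug_elt ?Iproj // sK mem_proj.
  by rewrite loop_elt_neq0 // sK mem_proj.
apply: homog_ind => [//|u v|b v vb]; first exact: (lincomb_closedD Ilin).
have vL := mem_loop_elt pi (s b) v; rewrite -(loop_aug_elt (pi := pi) (g := s b) (v := v)) ?sK //.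
by rewrite -(proj_id vL); apply: QL.
Qed.

Lemma loop_base_central : graded_central L ->
  (forall k, gsupport (centroid_alg L) k -> pi k = 0) -> central A.
Proof.
move=> cL suppL c cC; pose c' := centroid_of cC.
have proj_out a : a != 0 -> centroid_proj a c' = 0.
  rewrite -(sK a); set k := s a; have ck := mem_centroid_proj (pi k) c'; move=> k0.
  apply: (loop_lift_inj sK ck); apply/eqP; apply: contraNT k0 => lift0.
  by apply/eqP/suppL; exists (loop_lift pi k (centroid_proj (pi k) c')); rewrite ?mem_loop_lift.
pose l := loop_lift pi 0 (centroid_proj 0 c').
have [|a aE] := cL _ (cval_is_centroid l); first by apply/centroid_degP/mem_loop_lift.
exists a => v; rewrite -[c]/(cval c') -[RHS]/((a \*: idfun) v); move: v.
apply: linear_homog_ext => b v vb /=; apply: proj_inj => e.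
rewrite -(subrK b e) -(centroid_projE _ _ vb).
have [e0|e0] := eqVneq (e - b) 0; last first.
  by rewrite (proj_out _ e0) cval0 (proj_neq (rpredZ _ vb)) // eq_sym -subr_eq0 subrK.
have p0 : centroid_proj 0 c' \in gcomp (centroid_alg A) (pi 0).
  by rewrite raddf0 mem_centroid_proj.
rewrite e0 add0r (proj_id (rpredZ _ vb)) -{1}(loop_secK sK v) -(loop_aug_lift _ p0).
by rewrite aE linearZZ /= loop_secK.
Qed.

Lemma loop_base_central_simple : graded_central_simple L ->
  (forall k, gsupport (centroid_alg L) k -> pi k = 0) -> central_simple A.
Proof.
move=> [sL cL] suppL; have cA := loop_base_central cL suppL.
by split=> //; apply: graded_simple_central_simple => //; apply: loop_base_graded_simple.
Qed.
End LoopCentroid.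

Section GroupAlgebra.
Variables (F : fieldType) (G : zmodType) (H : subgrp G).
Local Notation K := (grpalg (F := F) H).

Let P (g : G) : pred F^o := fun a => (g \in sg_pred H) || (a == 0).
Let pr (g : G) : {linear F^o -> F^o} :=
  if g \in sg_pred H then (idfun : {linear F^o -> F^o}) else (\0 : {linear F^o -> F^o}).
Let PE g a : (a \in P g) = (g \in sg_pred H) || (a == 0). Proof. by []. Qed.
Let prP g a : pr g a \in P g.
Proof. by rewrite PE /pr; case: ifP => //= _; rewrite eqxx. Qed.
Let pr_id g a : a \in P g -> pr g a = a.
Proof. by rewrite PE /pr; case: ifP => //= _ /eqP. Qed.
Let mL (b : F^o) : linear (fun a : F^o => a * b : F^o).
Proof. by move=> c x y; rewrite mulrDl scalerAl. Qed.
Let mR (a : F^o) : linear (fun b : F^o => a * b : F^o).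
Proof. by move=> c x y; rewrite mulrDr scalerAr. Qed.
Let mP g h (a b : F^o) : a \in P g -> b \in P h -> a * b \in P (g + h).
Proof.
rewrite !PE => /orP [gH|/eqP ->]; last by rewrite mul0r eqxx orbT.
by case/orP => [hH|/eqP ->]; [rewrite sgD|rewrite mulr0 eqxx orbT].
Qed.

Let genP f : f \in grp_gen (F := F) H <-> exists g a, a \in P g /\ f = fdelta g a.
Proof.
split=> [/asboolP [g [a [gH fE]]]|[g [a [/orP [gH|/eqP ->] fE]]]].
- by exists g, a; rewrite PE gH.
- by apply/asboolP; exists g, a.
apply/asboolP; exists 0, 0; split; first exact: sg0.
by rewrite fE; apply: functional_extensionality => k; rewrite !fdeltaE !if_same.
Qed.

Let compP g (x : grp_car (F := F) H) : x \in grp_comp H g <->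
  (forall k, k != g -> sp_val x k = 0) /\ sp_val x g \in P g.
Proof.
split=> [/asboolP [x0 xg]|[x0 /orP xg]].
  by split=> //; rewrite PE; case: xg => ->; rewrite ?eqxx ?orbT.
by apply/asboolP; split=> //; case: xg => [?|/eqP]; [left|right].
Qed.

Lemma grpalg_galg : is_galg K.
Proof. exact: (funalg_galg prP pr_id mL mR mP genP compP). Qed.
Canonical grpalg_galgebra := GAlgebra grpalg_galg.

Definition grp_elt g : F^o -> gcar K := single prP genP g.

Definition grp_aug : gcar K -> F^o := @aug F G F^o (grp_gen H).
HB.instance Definition _ := GRing.isLinear.Build F (gcar K) F^o *:%R grp_aug
  (aug_is_linear prP pr_id genP).

Lemma mem_grp_elt g a : grp_elt g a \in gcomp K g. Proof. exact: single_in_comp. Qed.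

Lemma grp_elt_aug g x : x \in gcomp K g -> grp_elt g (grp_aug x) = x.
Proof. exact: (single_aug prP pr_id genP compP). Qed.

Lemma grp_aug_elt g a : g \in sg_pred H -> grp_aug (grp_elt g a) = a.
Proof. by move=> gH; apply: (aug_single prP pr_id genP compP); rewrite PE gH. Qed.

Lemma grp_aug_out g x : x \in gcomp K g -> g \notin sg_pred H -> grp_aug x = 0.
Proof. by move=> /(mem_aug prP pr_id genP compP); rewrite PE => /orP [-> //|/eqP]. Qed.

Lemma grp_aug_gmul x y : grp_aug (gmul K x y) = grp_aug x * grp_aug y.
Proof. exact: (aug_gmul prP pr_id mL mR mP (comp := grp_comp H) genP). Qed.

Lemma grp_aug_inj g x y : x \in gcomp K g -> y \in gcomp K g -> grp_aug x = grp_aug y -> x = y.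
Proof. by move=> /grp_elt_aug {2}<- /grp_elt_aug {2}<- ->. Qed.

Lemma gsupport_grpalg k : gsupport K k <-> k \in sg_pred H.
Proof.
split=> [[x xk]|kH].
  apply: contraR => kH; apply/eqP/(grp_aug_inj xk (rpred0 _)).
  by rewrite (grp_aug_out xk kH) linear0.
exists (grp_elt k 1); first exact: mem_grp_elt.
by apply: contraNneq (oner_neq0 F) => e; rewrite -(grp_aug_elt 1 kH) e linear0.
Qed.

Lemma giso_tgrpalg_restr (t : G -> G -> F) : giso (tgrpalg H t) (tgrpalg H (restr H t)).
Proof.
suff eqM g h x y : x \in gcomp K g -> y \in gcomp K h ->
    gmul (twist K t) x y = gmul (twist K (restr H t)) x y.
  exact: (giso_eq_gmul (twist_galg _ t) (twist_galg _ (restr H t)) eqM).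
move=> xg yh; rewrite !(twist_gmul _ xg yh) /restr.
have [gH|gH] := boolP (g \in sg_pred H); last first.
  by rewrite (grp_aug_inj xg (rpred0 _)) ?gmul0l ?scaler0 // (grp_aug_out xg gH) linear0.
have [//|hH] := boolP (h \in sg_pred H).
by rewrite (grp_aug_inj yh (rpred0 _)) ?gmul0r ?scaler0 // (grp_aug_out yh hH) linear0.
Qed.
End GroupAlgebra.

Section LoopCentroidAlgebra.
Variables (F : fieldType) (G : zmodType) (H : subgrp G) (A : galgebra F (quot H)).
Hypothesis csA : central_simple A.
Local Notation pi := (qproj H).
Local Notation L := (loop pi A).

Let sL : graded_simple L := proj1 (loop_graded_central_simple (@qproj_val G H) csA).
Let CL := GAlgebra (centroid_alg_galg sL).

Lemma giso_centroid_loop : giso (centroid_alg L) (grpalg H).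
Proof.
have [simA cA] := csA; have [nzA [sqA _]] := simA; apply: giso_sym.
have phi_linear g : linear (fun x : gcar (grpalg H) => grp_aug x *: loop_shift pi A g).
  by move=> a x y; rewrite linearP scalerDl scalerA.
have shiftZ g a : a *: (loop_shift pi A g : gcar CL) \in gcomp CL g.
  by rewrite rpredZ ?mem_loop_shift.
have shiftM g h a b : pi g = 0 -> pi h = 0 ->
    gmul CL (a *: (loop_shift pi A g : gcar CL)) (b *: (loop_shift pi A h : gcar CL)) =
      (a * b) *: (loop_shift pi A (g + h) : gcar CL).
  by move=> g0 h0; rewrite (gmulZZ (A := CL)) loop_shift_gmul.
apply: (@giso_intro _ _ _ CL (fun g => linear_pack (phi_linear g)))
  => [g x _|g x xg|g c cg|g h x y xg yh] /=.
- exact: shiftZ.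
- move=> /eqP; rewrite scaler_eq0 => /orP x0; apply: (grp_aug_inj xg (rpred0 _)); rewrite linear0.
  have [gH|gH] := boolP (g \in sg_pred H); last exact: grp_aug_out xg gH.
  case: x0 => [/eqP //|]; rewrite (negbTE (loop_shift_neq0 (@qproj_val G H) nzA _)) //.
  by apply/eqP; rewrite qproj_eq0.
- have [a ->] := loop_centroid_scalar (@qproj_val G H) cA sqA cg.
  exists (grp_elt H g a); first exact: mem_grp_elt.
  have [gH|gH] := boolP (g \in sg_pred H); first by rewrite grp_aug_elt.
  by rewrite loop_shift_out ?scaler0 //= qproj_eq0.
rewrite grp_aug_gmul.
have [gH|gH] := boolP (g \in sg_pred H); last first.
  rewrite (grp_aug_out xg gH) mul0r !scale0r; exact/esym/(gmul0l (A := CL)).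
have [hH|hH] := boolP (h \in sg_pred H); last first.
  rewrite (grp_aug_out yh hH) mulr0 !scale0r; exact/esym/(gmul0r (A := CL)).
by apply/esym/shiftM; apply/eqP; rewrite qproj_eq0.
Qed.

Lemma giso_centroid_tloop t : sym2cocycle t ->
  giso (centroid_alg (tloop pi A t)) (tgrpalg H (restr H t)).
Proof.
move=> tZ; apply: giso_trans (giso_sym (giso_centroid_twist tZ sL)) _.
apply: giso_trans (giso_tgrpalg_restr H t).
exact: (@giso_twist _ _ CL _ _ giso_centroid_loop).
Qed.
End LoopCentroidAlgebra.

(** * Classification of graded-central-simple algebras *)

Section LoopRecognition.
Variables (F : fieldType) (G Gb : zmodType) (pi : {additive G -> Gb}).
Variables (s : Gb -> G) (sK : cancel s pi) (B : galgebra F G).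
Variable v : G -> gcar (centroid_alg B).
Hypothesis mem_v : forall h, pi h = 0 -> v h \in gcomp (centroid_alg B) h.
Hypothesis vD : forall h k, pi h = 0 -> pi k = 0 -> gmul (centroid_alg B) (v h) (v k) = v (h + k).
Hypothesis v0 : forall x, cval (v 0) x = x.

(* Moves every component onto that of the representative of its degree modulo the kernel. *)
Definition retract : gcar B -> gcar B := glue (fun g => cval (v (s (pi g) - g))).
HB.instance Definition _ := GRing.Linear.on retract.

Let ker_sec g : pi (s (pi g) - g) = 0. Proof. by rewrite raddfB /= sK subrr. Qed.

Lemma retract_homog g x : x \in gcomp B g -> retract x = cval (v (s (pi g) - g)) x.
Proof. exact: glue_homog. Qed.

Lemma mem_retract g x : x \in gcomp B g -> retract x \in gcomp B (s (pi g)).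
Proof.
move=> xg; rewrite (retract_homog xg) -{2}[s _](subrK g).
exact: mem_cval (mem_v (ker_sec g)) xg.
Qed.

Lemma retract_id a x : x \in gcomp B (s a) -> retract x = x.
Proof. by move=> xa; rewrite (retract_homog xa) sK subrr v0. Qed.

Lemma retract_cval h x : pi h = 0 -> retract (cval (v h) x) = retract x.
Proof.
move=> h0; rewrite -[LHS]/((retract \o cval (v h)) x) -[RHS]/(retract x).
move: x; apply: linear_homog_ext => g x xg /=.
have hg : pi (h + g) = pi g by rewrite raddfD /= h0 add0r.
rewrite (retract_homog (mem_cval (mem_v h0) xg)) (retract_homog xg) -cval_gmul vD ?ker_sec //.
by rewrite hg [h + g]addrC opprD addrA subrK.
Qed.

Lemma retract_gmul x y : retract (gmul B (retract x) (retract y)) = retract (gmul B x y).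
Proof.
move: x y; apply: bilinear_homog_ext => [y|x|y|x|g h x y xg yh].
- exact: (linearP (retract \o gmulr (retract y) \o retract)).
- exact: (linearP (retract \o gmul B (retract x) \o retract)).
- exact: (linearP (retract \o gmulr y)).
- exact: (linearP (retract \o gmul B x)).
by rewrite (retract_homog xg) (retract_homog yh) -cval_mull -cval_mulr !retract_cval.
Qed.

Lemma retract_eq0 g x : x \in gcomp B g -> retract x = 0 -> x = 0.
Proof.
move=> xg; rewrite (retract_homog xg) => x0; set k := s (pi g) - g in x0.
have k0 : pi k = 0 by apply: ker_sec.
by rewrite -[x]v0 -(subrr k) addrC -vD ?raddfN /= ?k0 ?oppr0 // cval_gmul x0 linear0.
Qed.

Let P (a : Gb) : pred (gcar B) := gcomp B (s a).
Let m (x y : gcar B) := retract (gmul B x y).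
Let gen : pred (funT Gb (gcar B)) := fun f => asbool (exists a x, x \in P a /\ f = fdelta a x).
Let comp a : pred (spanT gen) := fun x =>
  asbool ((forall b, b != a -> sp_val x b = 0) /\ sp_val x a \in P a).
Let prP a x : proj B (s a) x \in P a. Proof. exact: mem_proj. Qed.
Let pr_id a x : x \in P a -> proj B (s a) x = x. Proof. exact: proj_id. Qed.
Let mL y : linear (m^~ y). Proof. exact: (linearP (retract \o gmulr y)). Qed.
Let mR x : linear (m x). Proof. exact: (linearP (retract \o gmul B x)). Qed.
Let mP a b x y : x \in P a -> y \in P b -> m x y \in P (a + b).
Proof. by move=> xa yb; have := mem_retract (mem_gmul xa yb); rewrite raddfD /= !sK. Qed.
Let genP f : f \in gen <-> exists a x, x \in P a /\ f = fdelta a x.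
Proof. by split=> [/asboolP|?] //; apply/asboolP. Qed.
Let compP a (x : spanT gen) : x \in comp a <->
  (forall b, b != a -> sp_val x b = 0) /\ sp_val x a \in P a.
Proof. by split=> [/asboolP|?] //; apply/asboolP. Qed.

(* The sum of the components [B_(s a)], multiplied in [B] and then retracted. *)
Definition loop_base : galgebra F Gb := GAlgebra (funalg_galg prP pr_id mL mR mP genP compP).

Let L := loop_galgebra pi loop_base.
Let to_loop g x : gcar L := @loop_elt _ _ _ pi loop_base g (single prP genP (pi g) (retract x)).
Let to_base (y : gcar L) : gcar B := aug (loop_aug y).

Let to_loop_linear g : linear (to_loop g).
Proof. exact: (linearP (@loop_elt _ _ _ pi loop_base g \o single prP genP (pi g) \o retract)). Qed.

Let mem_to_loop g x : to_loop g x \in gcomp L g.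
Proof. exact: mem_loop_elt. Qed.

Let to_loopK g x : x \in gcomp B g -> to_base (to_loop g x) = retract x.
Proof.
move=> xg; rewrite /to_base /to_loop (@loop_aug_elt _ _ _ pi loop_base); last exact: single_in_comp.
exact: (aug_single prP pr_id genP compP (mem_retract xg)).
Qed.

Let to_base0 : to_base 0 = 0.
Proof.
rewrite /to_base linear0.
exact: (linear0 (linear_pack (aug_is_linear prP pr_id genP))).
Qed.

Let mem_to_base g y : y \in gcomp L g -> to_base y \in gcomp B (s (pi g)).
Proof. by move=> /mem_loop_aug; apply: (mem_aug prP pr_id genP compP). Qed.

Let to_base_inj g y z : y \in gcomp L g -> z \in gcomp L g -> to_base y = to_base z -> y = z.
Proof.
move=> yg zg yz; apply: (loop_aug_inj yg zg).
by rewrite -[LHS](single_aug prP pr_id genP compP (mem_loop_aug yg)) [aug _]yz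
  (single_aug prP pr_id genP compP (mem_loop_aug zg)).
Qed.

Let to_base_gmul y z : to_base (gmul L y z) = retract (gmul B (to_base y) (to_base z)).
Proof. by rewrite /to_base loop_aug_gmul; apply: (aug_gmul prP pr_id mL mR mP genP). Qed.

Lemma giso_loop_base : giso B (loop pi loop_base).
Proof.
apply: (@giso_intro _ _ _ L (fun g => linear_pack (to_loop_linear g)))
  => [g x _|g x xg x0|g y yg|g h x y xg yh].
- exact: mem_to_loop.
- apply: (retract_eq0 xg); rewrite -(to_loopK xg) [to_loop g x]x0.
  exact: to_base0.
- have k0 : pi (g - s (pi g)) = 0 by rewrite -opprB raddfN /= ker_sec oppr0.
  have xg : cval (v (g - s (pi g))) (to_base y) \in gcomp B g.
    by rewrite -[X in gcomp _ X](subrK (s (pi g))); apply: mem_cval (mem_to_base yg); apply: mem_v.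
  exists (cval (v (g - s (pi g))) (to_base y)) => //; apply: (to_base_inj (mem_to_loop _ _) yg).
  by rewrite (to_loopK xg) retract_cval // (retract_id (mem_to_base yg)).
have xyg := mem_gmul xg yh; apply: (to_base_inj (mem_to_loop _ _)).
  exact: mem_gmul (mem_to_loop _ _) (mem_to_loop _ _).
by rewrite (to_loopK xyg) to_base_gmul (to_loopK xg) (to_loopK yh) retract_gmul.
Qed.
End LoopRecognition.

Section Untwisting.
Variables (F : fieldType) (G : zmodType) (B : galgebra F G).
Hypothesis gcsB : graded_central_simple B.
Local Notation H := (centroid_support gcsB).

Lemma centroid_untwist : exists (t : G -> G -> F) (v : G -> gcar (centroid_alg (twist B t))),
  [/\ sym2cocycle t, forall h, h \in sg_pred H -> v h \in gcomp (centroid_alg (twist B t)) h,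
    forall h k, h \in sg_pred H -> k \in sg_pred H ->
      gmul (centroid_alg (twist B t)) (v h) (v k) = v (h + k) &
    forall x, cval (A := twist_galgebra B t) (v 0) x = x].
Proof.
have [u [t [tZ uH uM]]] := centroid_basis gcsB.
have tVZ := sym2cocycle_inv tZ; exists (fun a b => (t a b)^-1).
pose v h := centroid_twist tVZ h (u h); exists v.
have vD h k : h \in sg_pred H -> k \in sg_pred H ->
    gmul (centroid_alg (twist B (fun a b => (t a b)^-1))) (v h) (v k) = v (h + k).
  move=> hH kH; have [[uh _] [uk _]] := (uH _ hH, uH _ kH).
  rewrite /v (centroid_twist_gmul _ uh uk) uM // linearZZ scalerA mulVf ?scale1r //.
  exact: sym2cocycle_neq0.
split=> // [h _|x]; first exact: mem_centroid_twist.
have [u0 u0n] := uH 0 (sg0 H).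
have sT := twist_graded_simple (fun a b => sym2cocycle_neq0 a b tVZ) (proj1 gcsB).
apply: (centroid_homog_inj sT (mem_centroid_twist tVZ 0 (u 0))).
  by apply: contraNneq u0n => v00; apply/eqP/(centroid_twist_inj u0 v00).
by rewrite -[LHS]cval_gmul -/(v 0) vD ?sg0 // addr0.
Qed.

Lemma graded_central_simple_tloop : exists (A : galgebra F (quot H)) (t : G -> G -> F),
  [/\ central_simple A, sym2cocycle t & giso B (tloop (qproj H) A t)].
Proof.
have [t [v [tZ mem_v vD v1]]] := centroid_untwist; pose T := twist_galgebra B t.
have qH h : qproj H h = 0 -> h \in sg_pred H by rewrite -qproj_eq0 => ->.
have isoT := giso_loop_base (@qproj_val G H) (B := T) (fun h h0 => mem_v h (qH h h0))
  (fun h k h0 k0 => vD h k (qH h h0) (qH k k0)) v1.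
set A := loop_base _ _ in isoT; exists A, (fun a b => (t a b)^-1).
split; [|exact: sym2cocycle_inv|]; last first.
  apply: giso_trans (giso_twist _ isoT); apply/giso_sym/giso_twistV => a b.
  exact: sym2cocycle_neq0.
apply: (@loop_base_central_simple _ _ _ _ _ (@qproj_val G H)) => [|k].
  exact: giso_graded_central_simple isoT (twist_graded_central_simple tZ gcsB).
move=> /(giso_gsupport (giso_centroid_alg (giso_sym isoT))).
move=> /(giso_gsupport (giso_sym (giso_centroid_twist tZ (proj1 gcsB)))) suppB.
by apply/eqP; rewrite qproj_eq0; apply/centroid_supportP.
Qed.
End Untwisting.

Section LoopFunctoriality.
Variables (F : fieldType) (G Gb : zmodType) (pi : {additive G -> Gb}).
Implicit Types A B : galgebra F Gb.

Lemma giso_loop A B : giso A B -> giso (loop pi A) (loop pi B).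
Proof.
move=> /giso_graded_inverses [f [f' [[_ fM fA] [_ _ f'B] fK f'K]]].
have phi_linear g : linear (fun x : gcar (loop pi A) => loop_elt pi g (f (loop_aug x))).
  exact: (linearP (@loop_elt _ _ _ pi B g \o f \o @loop_aug _ _ _ pi A)).
have fP g x : x \in gcomp (loop pi A) g -> f (loop_aug x) \in gcomp B (pi g).
  by move=> /mem_loop_aug /fA.
apply: (@giso_intro _ _ (loop_galgebra pi A) (loop_galgebra pi B)
  (fun g => linear_pack (phi_linear g)))
  => [g x _|g x xg /= x0|g y yg|g h x y xg yh].
- exact: mem_loop_elt.
- apply: (loop_aug_inj xg (rpred0 _)); apply: (can_inj fK).
  by rewrite -(loop_aug_elt (fP g x xg)) x0 !linear0.
- have f'y := f'B _ _ (mem_loop_aug yg); exists (loop_elt pi g (f' (loop_aug y))).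
    exact: mem_loop_elt.
  by rewrite /= (loop_aug_elt f'y) f'K (loop_elt_aug yg).
by rewrite /= loop_aug_gmul fM loop_elt_gmul ?fP.
Qed.

Lemma loop_twist_gmul A mu g h (x y : gcar (loop pi A)) :
  x \in gcomp (loop pi A) g -> y \in gcomp (loop pi A) h ->
  gmul (loop pi (twist A mu)) x y = mu (pi g) (pi h) *: gmul (loop pi A) x y.
Proof.
move=> xg yh; have xyL : gmul (loop pi A) x y \in gcomp (loop pi A) (g + h) by apply: mem_gmul.
apply: (@loop_aug_inj _ _ _ pi A (g + h)); last 1 first.
- rewrite linearZZ /= loop_aug_gmul -(twist_gmul mu (mem_loop_aug xg) (mem_loop_aug yh)).
  exact: (@loop_aug_gmul _ _ _ pi (twist_galgebra A mu) x y).
- exact: (@mem_gmul _ _ (loop_galgebra pi (twist_galgebra A mu)) g h x y xg yh).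
- exact: rpredZ.
Qed.

Lemma loop_twist_shift A mu h g (x : gcar (loop pi A)) : x \in gcomp (loop pi A) g -> pi h = 0 ->
  cval (loop_shift pi (twist_galgebra A mu) h) x = cval (loop_shift pi A h) x.
Proof.
move=> xg h0; pose B := twist_galgebra A mu; apply: (@loop_aug_inj _ _ _ pi A (h + g)).
- exact: (@mem_cval _ _ (loop_galgebra pi B) _ h g x (mem_loop_shift pi B h) xg).
- exact: mem_cval (mem_loop_shift pi A h) xg.
rewrite loop_aug_shift //; exact: (@loop_aug_shift _ _ _ pi B h x h0).
Qed.

Lemma giso_loop_twist A (mu : Gb -> Gb -> F) :
  giso (twist (loop pi A) (fun a b => mu (pi a) (pi b))) (loop pi (twist A mu)).
Proof.
pose T := twist_galgebra (loop_galgebra pi A) (fun a b => mu (pi a) (pi b)).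
suff eqM g h x y : x \in gcomp (loop pi A) g -> y \in gcomp (loop pi A) h ->
    gmul T x y = gmul (loop pi (twist A mu)) x y.
  exact: (giso_eq_gmul (galgP T) (loop_galg pi (twist_galgebra A mu)) eqM).
move=> xg yh; rewrite (loop_twist_gmul mu xg yh).
exact: (twist_gmul (A := loop_galgebra pi A) _ xg yh).
Qed.

Lemma giso_tloop A1 A2 (mu : Gb -> Gb -> F) (t1 t2 : G -> G -> F) :
  cohomologous t1 (fun a b => mu (pi a) (pi b) * t2 a b) -> giso (twist A1 mu) A2 ->
  giso (tloop pi A1 t1) (tloop pi A2 t2).
Proof.
move=> /(giso_cohomologous (loop_galgebra pi A1)) t12 /giso_loop isoA.
apply: giso_trans t12 _; apply: giso_trans (giso_sym (giso_twist_twist _ _ t2)) _.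
apply: giso_twist; exact: giso_trans (giso_loop_twist A1 mu) isoA.
Qed.
End LoopFunctoriality.

Section LoopSupport.
Variables (F : fieldType) (G : zmodType).

Lemma gsupport_centroid_tloop (H : subgrp G) (A : galgebra F (quot H)) t k :
  central_simple A -> sym2cocycle t ->
  gsupport (centroid_alg (tloop (qproj H) A t)) k <-> k \in sg_pred H.
Proof.
move=> csA tZ; have isoC := giso_centroid_tloop csA tZ; rewrite -(gsupport_grpalg F H k).
by split=> [/(giso_gsupport isoC)|/(giso_gsupport (giso_sym isoC))].
Qed.

Lemma giso_tloop_ker (H1 H2 : subgrp G) (A1 : galgebra F (quot H1)) (A2 : galgebra F (quot H2))
    (t1 t2 : G -> G -> F) : central_simple A1 -> central_simple A2 ->
  sym2cocycle t1 -> sym2cocycle t2 -> giso (tloop (qproj H1) A1 t1) (tloop (qproj H2) A2 t2) ->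
  sg_pred H1 =i sg_pred H2.
Proof.
move=> cs1 cs2 t1Z t2Z /giso_centroid_alg isoC k; apply/idP/idP.
  move=> /(gsupport_centroid_tloop _ cs1 t1Z) /(giso_gsupport isoC).
  by move/(gsupport_centroid_tloop _ cs2 t2Z).
move=> /(gsupport_centroid_tloop _ cs2 t2Z) /(giso_gsupport (giso_sym isoC)).
by move/(gsupport_centroid_tloop _ cs1 t1Z).
Qed.
End LoopSupport.

Section TwistedLoopIso.
Variables (F : fieldType) (G Gb : zmodType) (pi : {additive G -> Gb}).
Variables (s : Gb -> G) (sK : cancel s pi) (A1 A2 : galgebra F Gb) (t : G -> G -> F).
Hypotheses (tZ : sym2cocycle t) (nzA1 : nonzero A1) (nzA2 : nonzero A2).
Hypotheses (cA2 : central A2) (sqA2 : sq_full A2).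
Local Notation L1 := (loop pi A1).
Local Notation L2 := (loop pi A2).
Local Notation T1 := (twist_galgebra (loop_galgebra pi A1) t).
Variables (f : {linear gcar T1 -> gcar L2}) (f' : {linear gcar L2 -> gcar T1}).
Hypothesis ff' : graded_inverses f f'.
Let homf : graded_hom f. Proof. by case: ff'. Qed.
Let fK : cancel f f'. Proof. by case: ff'. Qed.
Let f'K : cancel f' f. Proof. by case: ff'. Qed.

Let tshift h : gcar (centroid_alg T1) := centroid_twist tZ h (loop_shift pi A1 h).

Let tshiftE h g x : x \in gcomp L1 g -> cval (tshift h) x = t h g *: cval (loop_shift pi A1 h) x.
Proof. by move=> xg; apply: (centroid_twistE tZ (mem_loop_shift pi A1 h) xg). Qed.

Definition shift_multiplier (lam : G -> F) := forall h x, pi h = 0 ->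
  f (cval (tshift h) x) = lam h *: cval (loop_shift pi A2 h) (f x).

Lemma shift_multiplier_ex : exists lam, (forall h, pi h = 0 -> lam h != 0) /\ shift_multiplier lam.
Proof.
suff /functional_choice [lam lamP] h : exists a : F, pi h = 0 -> a != 0 /\
    forall x, f (cval (tshift h) x) = a *: cval (loop_shift pi A2 h) (f x).
  by exists lam; split=> [h|h x] /lamP [].
have [_ _ conj_deg] := centroid_conj_hom ff'.
have := conj_deg h _ (mem_centroid_twist tZ h (loop_shift pi A1 h)).
move=> /(loop_centroid_scalar sK cA2 sqA2) [a aE]; exists a => h0.
have aS x : f (cval (tshift h) x) = a *: cval (loop_shift pi A2 h) (f x).
  by rewrite -cvalZ -aE centroid_conjE fK.
split=> //; apply: contraNneq (loop_shift_neq0 sK nzA1 h0) => a0; apply/eqP.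
apply: (centroid_twist_inj (tZ := tZ) (mem_loop_shift pi A1 h)); apply: cval_inj => x.
by apply: (can_inj fK); rewrite aS a0 scale0r cval0 linear0.
Qed.

Lemma shift_multiplierM lam h k : shift_multiplier lam -> pi h = 0 -> pi k = 0 ->
  t h k * lam (h + k) = lam h * lam k.
Proof.
move=> lamS h0 k0; have hk0 : pi (h + k) = 0 by rewrite raddfD /= h0 k0 addr0.
have [y y0] := cval_neq0 (loop_shift_neq0 sK nzA2 hk0).
apply: (scalev_inj y0); rewrite -(f'K y) -scalerA -lamS // -linearZZ -cvalZ.
have -> : t h k *: tshift (h + k) = gmul (centroid_alg T1) (tshift h) (tshift k).
  rewrite (centroid_twist_gmul tZ (mem_loop_shift pi A1 h) (mem_loop_shift pi A1 k)).
  by rewrite loop_shift_gmul.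
by rewrite cval_gmul !lamS // linearZZ /= scalerA -cval_gmul loop_shift_gmul.
Qed.

Section Rescaling.
Variables (lam gam : G -> F) (mu : Gb -> Gb -> F).
Hypotheses (lamS : shift_multiplier lam) (gam0 : forall g, gam g != 0).
Hypothesis gamM : forall h g, pi h = 0 -> t h g * gam (h + g) = lam h * gam g.
Hypothesis tE : forall a b, t a b = mu (pi a) (pi b) * (gam a * gam b / gam (a + b)).
Local Notation B := (twist_galgebra A1 mu).
Local Notation LB := (loop_galgebra pi B).

Let phi_linear g : linear (fun x : gcar LB => (gam g)^-1 *: f x).
Proof. exact: (linearP ((gam g)^-1 \*: f)). Qed.

Let phi g : {linear gcar LB -> gcar L2} := linear_pack (phi_linear g).

Let phi_shift h g x : pi h = 0 -> x \in gcomp L1 g ->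
  phi (h + g) (cval (loop_shift pi B h) x) = cval (loop_shift pi A2 h) (phi g x).
Proof.
move=> h0 xg; rewrite (loop_twist_shift (A := A1) mu xg h0) linearZZ.
apply: (scalerI (mulf_neq0 (sym2cocycle_neq0 h g tZ) (gam0 (h + g)))).
rewrite {2}gamM // !scalerA mulfK // -mulrA divff // mulr1 -lamS // (tshiftE h xg).
exact/esym/linearZZ.
Qed.

Let phi_gmul g h x y : x \in gcomp LB g -> y \in gcomp LB h ->
  phi (g + h) (gmul LB x y) = gmul L2 (phi g x) (phi h y).
Proof.
move=> xg yh; have [_ fM _] := homf; have := fM x y.
rewrite (twist_gmul (A := loop_galgebra pi A1) t xg yh) linearZZ => fxy.
rewrite -[RHS]/(gmul L2 ((gam g)^-1 *: f x) ((gam h)^-1 *: f y)) gmulZZ -fxy.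
rewrite -[LHS]/((gam (g + h))^-1 *: f (gmul LB x y)) (loop_twist_gmul (A := A1) mu xg yh).
by rewrite linearZZ !scalerA tE; congr (_ *: _); field; rewrite !gam0.
Qed.

Lemma rescaled_giso_descent : giso (twist A1 mu) A2.
Proof.
have [_ _ fA] := homf; have [_ [_ _ f'A] _ _] := ff'.
have [||||p' pp'] := @glue_graded_inverses _ _ LB (loop_galgebra pi A2) phi.
- by move=> g x xg; apply: rpredZ; apply: fA.
- move=> g x xg /eqP; rewrite scaler_eq0 invr_eq0 (negbTE (gam0 g)) => /eqP fx0.
  by apply: (can_inj fK); rewrite linear0.
- move=> g y yg; exists (gam g *: (f' y : gcar LB)); first exact: rpredZ (f'A _ _ yg).
  by rewrite /= linearZZ f'K scalerA mulVf ?scale1r.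
- exact: phi_gmul.
pose p : {linear gcar LB -> gcar L2} := glue phi.
apply: (giso_loop_descent sK (f := p) pp') => h x h0.
rewrite -[LHS]/((p \o cval (loop_shift pi B h)) x) -[RHS]/((cval (loop_shift pi A2 h) \o p) x).
move: x; apply: linear_homog_ext => g x xg /=.
have xhg := mem_cval (mem_loop_shift pi B h) xg.
by rewrite (glue_homog _ xg) (glue_homog _ xhg) phi_shift.
Qed.
End Rescaling.

Lemma giso_tloop_cocycle : exists (gam : G -> F) (mu : Gb -> Gb -> F), [/\ forall g, gam g != 0,
  sym2cocycle mu, forall a b, t a b = mu (pi a) (pi b) * (gam a * gam b / gam (a + b)) &
  giso (twist A1 mu) A2].
Proof.
have [lam [lam0 lamS]] := shift_multiplier_ex.
have [h k|gam [mu [gam0 muZ gamM tE]]] := sym2cocycle_descend sK tZ lam0.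
  exact: shift_multiplierM.
by exists gam, mu; split=> //; apply: rescaled_giso_descent gam0 gamM tE.
Qed.
End TwistedLoopIso.

Section LoopClassification.
Variables (F : fieldType) (G Gb : zmodType) (pi : {additive G -> Gb}).
Variables (s : Gb -> G) (sK : cancel s pi).

Lemma giso_tloopP (A1 A2 : galgebra F Gb) (t1 t2 : G -> G -> F) :
  central_simple A1 -> central_simple A2 -> sym2cocycle t1 -> sym2cocycle t2 ->
  giso (tloop pi A1 t1) (tloop pi A2 t2) <->
  exists mu, [/\ sym2cocycle mu, cohomologous t1 (fun a b => mu (pi a) (pi b) * t2 a b) &
    giso (twist A1 mu) A2].
Proof.
move=> [[nzA1 _] _] [[nzA2 [sqA2 _]] cA2] t1Z t2Z; split; last first.
  by move=> [mu [_ t12 isoA]]; apply: giso_tloop isoA.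
move=> /(giso_twist (A := tloop pi A1 t1) (B := tloop pi A2 t2) (fun a b => (t2 a b)^-1)) isoT.
have tZ := sym2cocycle_mul t1Z (sym2cocycle_inv t2Z).
have : giso (twist (loop pi A1) (fun a b => t1 a b / t2 a b)) (loop pi A2).
  apply: giso_trans (giso_sym (giso_twist_twist _ t1 _)) _; apply: giso_trans isoT _.
  by apply: giso_twistV => a b; apply: sym2cocycle_neq0.
move=> /giso_graded_inverses [f [f' ff']].
have [gam [mu [gam0 muZ tE isoA]]] := giso_tloop_cocycle sK tZ nzA1 nzA2 cA2 sqA2 ff'.
exists mu; split=> //; exists gam; split=> // a b.
by rewrite -(mulfVK (sym2cocycle_neq0 a b t2Z) (t1 a b)) tE mulrAC.
Qed.
End LoopClassification.

Theorem theorem5p2 (F : fieldType) (G : zmodType) :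
  (* (1) *)
  (forall B : galg F G, is_galg B -> graded_central_simple B ->
     exists (H : subgrp G) (A : galg F (quot H)) (t : G -> G -> F),
       is_galg A /\ central_simple A /\ sym2cocycle t /\
       giso B (tloop (qproj H) A t))
  /\
  (* (2) *)
  (forall (H : subgrp G) (A : galg F (quot H)) (t : G -> G -> F),
     is_galg A -> central_simple A -> sym2cocycle t ->
     graded_central_simple (tloop (qproj H) A t) /\
     giso (centroid_alg (tloop (qproj H) A t)) (tgrpalg H (restr H t)))
  /\
  (* (3), "only if" part concerning the subgroups: H1 = H2 *)
  (forall (H1 H2 : subgrp G) (A1 : galg F (quot H1)) (A2 : galg F (quot H2))
          (t1 t2 : G -> G -> F),
     is_galg A1 -> central_simple A1 -> is_galg A2 -> central_simple A2 ->
     sym2cocycle t1 -> sym2cocycle t2 ->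
     giso (tloop (qproj H1) A1 t1) (tloop (qproj H2) A2 t2) ->
     sg_pred H1 =i sg_pred H2)
  /\
  (* (3), for H1 = H2 = H *)
  (forall (H : subgrp G) (A1 A2 : galg F (quot H)) (t1 t2 : G -> G -> F),
     is_galg A1 -> central_simple A1 -> is_galg A2 -> central_simple A2 ->
     sym2cocycle t1 -> sym2cocycle t2 ->
     (giso (tloop (qproj H) A1 t1) (tloop (qproj H) A2 t2) <->
      exists mu : quot H -> quot H -> F,
        sym2cocycle mu /\
        cohomologous t1 (fun a b => mu (qproj H a) (qproj H b) * t2 a b) /\
        giso (twist A1 mu) A2)).
Proof.
split=> [B galgB gcsB|].
  have [A [t [csA tZ isoB]]] := @graded_central_simple_tloop F G (GAlgebra galgB) gcsB.
  by exists (centroid_support (A := GAlgebra galgB) gcsB), A, t; split; first exact: galgP.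
split=> [H A t galgA csA tZ|].
  split; last exact: (@giso_centroid_tloop F G H (GAlgebra galgA)).
  apply: (@twist_graded_central_simple F G (loop_galgebra (qproj H) (GAlgebra galgA)) t tZ).
  exact: (@loop_graded_central_simple F G _ _ _ (@qproj_val G H) (GAlgebra galgA)).
split=> [H1 H2 A1 A2 t1 t2 galgA1 csA1 galgA2 csA2|H A1 A2 t1 t2 galgA1 csA1 galgA2 csA2 t1Z t2Z].
  exact: (@giso_tloop_ker F G H1 H2 (GAlgebra galgA1) (GAlgebra galgA2)).
have [isoP isoI] := giso_tloopP (A1 := GAlgebra galgA1) (A2 := GAlgebra galgA2)
  (@qproj_val G H) csA1 csA2 t1Z t2Z.
by split=> [/isoP [mu [? ? ?]]|[mu [? [? ?]]]]; [exists mu|apply: isoI; exists mu].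
Qed.
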